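(* Let $m\ge 3$, $\mu=\frac m2-1$, $k,l\in\mathbb{N}=\{0,1,2,\dots\}$, $t=\frac{\langle x,y\rangle}{|x||y|}$, and $c_k=-\frac{1}{(m+2k)^2}$. Define $$\widetilde{K}_k^m(x,y)=c_k\,\partial_{\underline{x}} K_{k+1}^m(x,y)\partial_{\underline{y}}=\frac{2\mu+k}{2\mu}|x|^k|y|^kC_k^\mu(t)+(\underline{x}\wedge\underline{y})|x|^{k-1}|y|^{k-1}C_{k-1}^{\mu+1}(t),$$ where $K_{k+1}^m(x,y)=\frac{k+1+\mu}{\mu}|x|^{k+1}|y|^{k+1}C_{k+1}^\mu(t)$ is the reproducing kernel of spherical harmonics of degree $k+1$. Then for any $M_l\in\mathcal{M}_l$, $$\langle\widetilde{K}_k^m(\cdot,y),M_l(\cdot)\rangle_{\mathbb{S}^{m-1}}=\delta_{kl}M_l(y),$$ and also $$\langle \widetilde{K}_k^m(\cdot,y),\underline{x}M_l(\cdot)\rangle_{\mathbb{S}^{m-1}}=0.$$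
   Context: $\mathcal{C}\ell_m$ is the Clifford algebra (with complex coefficients) generated by an orthonormal basis $e_1,\dots,e_m$ of $\mathbb{R}^m$ with $e_je_k+e_ke_j=-2\delta_{jk}$. For $x,y\in\mathbb{R}^m$: $\langle x,y\rangle=\sum_j x_jy_j$, $|x|=\sqrt{\langle x,x\rangle}$, $\underline{x}=\sum_{j=1}^m e_jx_j$, $\underline{x}\wedge\underline{y}=\sum_{j<k}e_je_k(x_jy_k-x_ky_j)$. The Dirac operator is $\partial_{\underline{x}}=\sum_{j=1}^me_j\partial_{x_j}$; acting from the right, $f\partial_{\underline{x}}=\sum_j(\partial_{x_j}f)e_j$. $\mathcal{M}_l$ (spherical monogenics of degree $l$) is the space of $\mathcal{C}\ell_m$-valued polynomials $M$ on $\mathbb{R}^m$ homogeneous of degree $l$ with $\partial_{\underline{x}}M=0$ (action from the left). The conjugation $\dagger$ on $\mathcal{C}\ell_m$ is the conjugate-linear map with $e_j^\dagger=-e_j$, $(XY)^\dagger=Y^\dagger X^\dagger$ and complex conjugation of scalars. The inner product on the sphere is $\langle P,Q\rangle_{\mathbb{S}^{m-1}}=\frac{1}{\omega_{m-1}}\int_{\mathbb{S}^{m-1}}P(x)^\dagger Q(x)\,d\sigma(x)$, with $\mathbb{S}^{m-1}$ the unit sphere of $\mathbb{R}^m$, $d\sigma$ its surface measure and $\omega_{m-1}=2\pi^{m/2}/\Gamma(m/2)$ its area. $C_k^\mu$ is the Gegenbauer polynomial $C_k^\mu(t)=\sum_{j=0}^{\lfloor k/2\rfloor}(-1)^j\frac{\Gamma(k-j+\mu)}{\Gamma(\mu)j!(k-2j)!}(2t)^{k-2j}$,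 with $C_k^\mu=0$ for negative $k$. *)

(* Defs.v *)
From HB Require Import structures.
From mathcomp Require Import all_boot all_order all_algebra.
From mathcomp Require Import complex ring.

Set Implicit Arguments.
Unset Strict Implicit.
Unset Printing Implicit Defensive.

Import Order.TTheory GRing.Theory Num.Theory.

Local Open Scope complex_scope.
Local Open Scope ring_scope.

Section SymmetricDifference.
Context {T : finType}.
Implicit Types A B C : {set T}.

Definition symd A B : {set T} := (A :\: B) :|: (B :\: A).

Lemma in_symd A B x : (x \in symd A B) = (x \in A) (+) (x \in B).
Proof. by rewrite !inE; case: (x \in A); case: (x \in B). Qed.

Lemma symdC A B : symd A B = symd B A.
Proof. by apply/setP => x; rewrite !in_symd addbC. Qed.

Lemma symdA A B C : symd A (symd B C) = symd (symd A B) C.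
Proof. by apply/setP => x; rewrite !in_symd addbA. Qed.

Lemma symd0 A : symd A set0 = A.
Proof. by apply/setP => x; rewrite in_symd inE addbF. Qed.

Lemma sym0d A : symd set0 A = A. Proof. by rewrite symdC symd0. Qed.

Lemma symdd A : symd A A = set0.
Proof. by apply/setP => x; rewrite in_symd inE addbb. Qed.

Lemma symdK A B : symd A (symd A B) = B.
Proof. by rewrite symdA symdd sym0d. Qed.

Lemma symdKd A B C : symd (symd A B) (symd A C) = symd B C.
Proof. by rewrite [symd A B]symdC -symdA symdK. Qed.

Lemma symd_eq A B C : (symd A B == C) = (B == symd A C).
Proof. by apply/eqP/eqP => [<-|->]; rewrite symdK. Qed.

End SymmetricDifference.

(* The element [x] of [cliff R m] is \sum_A x_A e_A, where A ranges over the
   subsets of {0, ..., m-1} and e_A = e_{a_1} ... e_{a_h} for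
   A = {a_1 < ... < a_h}. *)
Definition cliff (R : rcfType) (m : nat) := {ffun {set 'I_m} -> R[i]}.

(* Sorting e_A e_B takes one sign change for each pair (i, j) in A x B with
   j < i, and each common index contributes e_i^2 = -1. *)
Definition swaps m (A B : {set 'I_m}) : nat :=
  #|[set p : 'I_m * 'I_m | [&& p.1 \in A, p.2 \in B & (p.2 <= p.1)%N]]|.

Section CliffordAlgebra.
Context (R : rcfType) (m : nat).
Implicit Types (x y z : cliff R m) (A B C : {set 'I_m}).

HB.instance Definition _ := GRing.Lmodule.copy (cliff R m)
  {ffun {set 'I_m} -> (R[i])^o}.

Definition cliff_one : cliff R m := [ffun A => (A == set0)%:R].

Definition cliff_mul x y : cliff R m := [ffun C =>
  \sum_A \sum_(B | symd A B == C) (-1) ^+ swaps A B * (x A * y B)].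

Lemma cliff_mulE x y C : cliff_mul x y C =
  \sum_A (-1) ^+ swaps A (symd A C) * (x A * y (symd A C)).
Proof.
rewrite ffunE; apply: eq_bigr => A _.
by under eq_bigl do rewrite symd_eq; rewrite big_pred1_eq.
Qed.

Definition bit A B (i j : 'I_m) : bool := [&& i \in A, j \in B & (j <= i)%N].

Lemma swapsE A B : (-1) ^+ swaps A B =
  \prod_i \prod_j (-1) ^+ (bit A B i j) :> R[i].
Proof.
rewrite /swaps -sum1_card big_mkcond /= -prodrXr.
rewrite pair_big /=; apply: eq_bigr => -[i j] _ /=.
by rewrite inE /bit /=; case: ifP.
Qed.

Lemma swaps_symdl A B C : (-1) ^+ swaps (symd A B) C =
  (-1) ^+ swaps A C * (-1) ^+ swaps B C :> R[i].
Proof.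
rewrite !swapsE -big_split /=; apply: eq_bigr => i _.
rewrite -big_split /=; apply: eq_bigr => j _.
rewrite -signr_addb /bit in_symd; congr (_ ^+ nat_of_bool _).
by case: (i \in A); case: (i \in B); rewrite /= ?addbb ?addbF.
Qed.

Lemma swaps_symdr A B C : (-1) ^+ swaps A (symd B C) =
  (-1) ^+ swaps A B * (-1) ^+ swaps A C :> R[i].
Proof.
rewrite !swapsE -big_split /=; apply: eq_bigr => i _.
rewrite -big_split /=; apply: eq_bigr => j _.
rewrite -signr_addb /bit in_symd; congr (_ ^+ nat_of_bool _).
by case: (i \in A); case: (j \in B); case: (j \in C);
  rewrite /= ?addbb ?addbF.
Qed.

Lemma swaps0l A : swaps (set0 : {set 'I_m}) A = 0%N.
Proof. by apply: eq_card0 => p; rewrite !inE. Qed.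

Lemma swaps0r A : swaps A (set0 : {set 'I_m}) = 0%N.
Proof. by apply: eq_card0 => p; rewrite !inE andbF. Qed.

Lemma cliff_mulA : associative cliff_mul.
Proof.
move=> x y z; apply/ffunP => D; rewrite !cliff_mulE.
under eq_bigr => A _.
  rewrite cliff_mulE mulr_sumr mulr_sumr
    (reindex_inj (can_inj (symdK A))) /=.
  over.
rewrite exchange_big /=; apply: eq_bigr => E _.
rewrite cliff_mulE mulr_suml mulr_sumr; apply: eq_bigr => A _.
rewrite symdKd !swaps_symdr !swaps_symdl.
have c2 : (-1) ^+ swaps A D * (-1) ^+ swaps A D = 1 :> R[i].
  by rewrite -expr2 sqrr_sign.
by rewrite -[RHS]mul1r -[X in _ = X * _]c2; ring.
Qed.

Lemma cliff_mul1x : left_id cliff_one cliff_mul.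
Proof.
move=> x; apply/ffunP => C; rewrite cliff_mulE (bigD1 set0)//= big1 ?addr0.
  by rewrite swaps0l sym0d ffunE eqxx expr0 !mul1r.
by move=> A /negPf An0; rewrite [cliff_one A]ffunE An0 mul0r mulr0.
Qed.

Lemma cliff_mulx1 : right_id cliff_one cliff_mul.
Proof.
move=> x; apply/ffunP => C; rewrite cliff_mulE (bigD1 C)//= big1 ?addr0.
  by rewrite symdd swaps0r ffunE eqxx expr0 mul1r mulr1.
move=> A AnC; rewrite [cliff_one _]ffunE.
rewrite (_ : (symd A C == set0) = false) ?mulr0//.
by apply: contraNF AnC; rewrite symd_eq symd0 eq_sym.
Qed.

Lemma cliff_mulDl : left_distributive cliff_mul +%R.
Proof.
move=> x y z; apply/ffunP => C; rewrite [RHS]ffunE !cliff_mulE -big_split /=.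
by apply: eq_bigr => A _; rewrite ffunE mulrDl mulrDr.
Qed.

Lemma cliff_mulDr : right_distributive cliff_mul +%R.
Proof.
move=> x y z; apply/ffunP => C; rewrite [RHS]ffunE !cliff_mulE -big_split /=.
by apply: eq_bigr => A _; rewrite ffunE !mulrDr.
Qed.

Lemma cliff_one_neq0 : cliff_one != 0.
Proof.
apply/eqP => /ffunP /(_ set0); rewrite !ffunE eqxx => /eqP.
by rewrite oner_eq0.
Qed.

HB.instance Definition _ := GRing.Zmodule_isNzRing.Build (cliff R m)
  cliff_mulA cliff_mul1x cliff_mulx1 cliff_mulDl cliff_mulDr cliff_one_neq0.

Lemma cliff_scaleAl (c : R[i]) x y : c *: (x * y) = (c *: x) * y.
Proof.
apply/ffunP => C; rewrite ffunE !cliff_mulE /GRing.scale /= mulr_sumr.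
by apply: eq_bigr => A _; rewrite ffunE; rewrite /GRing.scale /=; ring.
Qed.

Lemma cliff_scaleAr (c : R[i]) x y : c *: (x * y) = x * (c *: y).
Proof.
apply/ffunP => C; rewrite ffunE !cliff_mulE /GRing.scale /= mulr_sumr.
by apply: eq_bigr => A _; rewrite [(_ *: y) _]ffunE /GRing.scale /=; ring.
Qed.

HB.instance Definition _ :=
  GRing.Lmodule_isLalgebra.Build R[i] (cliff R m) cliff_scaleAl.
HB.instance Definition _ :=
  GRing.Lalgebra_isAlgebra.Build R[i] (cliff R m) cliff_scaleAr.

(* The generator e_j *)
Definition gen (j : 'I_m) : cliff R m := [ffun A => (A == [set j])%:R].

Lemma cliff_mulrE x y C : (x * y) C =
  \sum_A (-1) ^+ swaps A (symd A C) * (x A * y (symd A C)).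
Proof. exact: cliff_mulE. Qed.

Lemma cliff_1E A : (1 : cliff R m) A = (A == set0)%:R.
Proof. exact: ffunE. Qed.

Lemma gen_mulE j x C :
  (gen j * x) C = (-1) ^+ swaps [set j] (symd [set j] C) * x (symd [set j] C).
Proof.
rewrite cliff_mulrE (bigD1 [set j])//= big1 ?addr0 ?ffunE ?eqxx ?mul1r//.
by move=> A /negPf Aj; rewrite ffunE Aj mul0r mulr0.
Qed.

Lemma swaps1 (j k : 'I_m) : swaps [set j] [set k] = (k <= j)%N.
Proof.
rewrite /swaps; have [kj|kj] := boolP (k <= j)%N.
  apply: (@eq_card1 _ (j, k)) => -[a b] /=; rewrite !inE xpair_eqE /=.
  by case: eqP => // ->; case: eqP => // ->.
apply: eq_card0 => -[a b] /=; rewrite !inE /=.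
by case: eqP => // ->; case: eqP => // ->; rewrite (negPf kj).
Qed.

Lemma gen_sqr j : gen j * gen j = -1.
Proof.
apply/ffunP => C; rewrite gen_mulE [RHS]ffunE cliff_1E [gen j _]ffunE.
rewrite symd_eq symdd; case: eqP => [->|]; last by rewrite mulr0 oppr0.
by rewrite symd0 swaps1 leqnn mulr1.
Qed.

Lemma gen_anticomm j k :
  gen j * gen k + gen k * gen j = - (2 * (j == k)%:R).
Proof.
have [->|jk] := eqVneq j k; first by rewrite gen_sqr mulr1 -opprD.
rewrite mulr0 oppr0; apply/ffunP => C.
rewrite [LHS]ffunE !gen_mulE ![gen _ _]ffunE [RHS]ffunE !symd_eq.
rewrite [symd [set k] [set j]]symdC; case: eqP => [->|]; last first.
  by rewrite !mulr0 addr0.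
rewrite symdK [symd [set j] _]symdC symdK !swaps1 !mulr1.
case: (ltngtP k j) => [_|_|/val_inj kj]; rewrite ?addNr ?addrN//.
by rewrite kj eqxx in jk.
Qed.

Definition blade A : cliff R m := [ffun B => (B == A)%:R].

Lemma cliff_blade x : x = \sum_A x A *: blade A.
Proof.
apply/ffunP => C; rewrite sum_ffunE (bigD1 C)//= big1 ?addr0.
  by rewrite !ffunE eqxx /GRing.scale /= mulr1.
by move=> A nAC; rewrite !ffunE eq_sym (negPf nAC) scaler0.
Qed.

Lemma bladeM A B :
  blade A * blade B = (-1) ^+ swaps A B *: blade (symd A B).
Proof.
apply/ffunP => C; rewrite cliff_mulrE (bigD1 A)//= big1 ?addr0.
  rewrite !ffunE eqxx mul1r symd_eq [RHS]/GRing.scale /=.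
  by case: eqP => [->|]; rewrite ?symdK// !mulr0.
by move=> D DA; rewrite ffunE (negPf DA) mul0r mulr0.
Qed.

Lemma blade_gen A : blade A = \prod_(i <- enum A) gen i.
Proof.
have sA : sorted (fun i j : 'I_m => (i < j)%N) (enum A).
  rewrite {1}/enum_mem -enumT; apply: sorted_filter.
    by move=> ? ? ?; apply: ltn_trans.
  by have := iota_ltn_sorted 0 m; rewrite -val_enum_ord sorted_map.
rewrite -[in LHS](set_enum A).
elim: (enum A) sA => [_|j s IHs /= js].
  rewrite big_nil; apply/ffunP => B; rewrite [LHS]ffunE set_nil.
  exact/esym/cliff_1E.
rewrite big_cons -IHs ?(path_sorted js)//.
have lt_js : {in s, forall k : 'I_m, (j < k)%N}.
  apply/allP; rewrite (order_path_min _ js)// => ? ? ?; exact: ltn_trans.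
have sw0 : swaps [set j] [set:: s] = 0%N.
  apply: eq_card0 => -[a b] /=; rewrite !inE /=.
  apply/negP => /and3P[/eqP -> /lt_js jb].
  by rewrite leqNgt jb.
have -> : gen j = blade [set j] by [].
rewrite bladeM sw0 scale1r; congr blade; apply/setP => k.
rewrite in_symd !inE; case: eqP => [->|//].
by case: (boolP (j \in s)) => // /lt_js; rewrite ltnn.
Qed.

(* e_A e_A^dagger = 1 and e_A e_A = (-1) ^+ swaps A A, whence the sign.
   [dagger] is determined by [daggerD], [daggerZ], [dagger_gen], [daggerM]. *)
Definition dagger x : cliff R m :=
  [ffun A => (-1) ^+ swaps A A * (x A)^*].

Lemma daggerD : {morph dagger : x y / x + y}.
Proof. by move=> x y; apply/ffunP => A; rewrite !ffunE rmorphD mulrDr. Qed.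

Lemma daggerZ (c : R[i]) x : dagger (c *: x) = c^* *: dagger x.
Proof.
apply/ffunP => A; rewrite !ffunE /GRing.scale /= rmorphM.
by rewrite mulrCA.
Qed.

Lemma dagger_gen j : dagger (gen j) = - gen j.
Proof.
apply/ffunP => A; rewrite !ffunE; case: eqP => [->|].
  by rewrite swaps1 leqnn rmorph1 mulr1.
by rewrite rmorph0 mulr0 oppr0.
Qed.

Lemma daggerM x y : dagger (x * y) = dagger y * dagger x.
Proof.
apply/ffunP => C; rewrite ffunE !cliff_mulrE.
rewrite [RHS](reindex_inj (can_inj (_ : involutive (symd^~ C)))) /=; last first.
  by move=> A; rewrite -symdA symdd symd0.
rewrite rmorph_sum mulr_sumr; apply: eq_bigr => A _.
rewrite !ffunE -symdA symdd symd0 !rmorphM rmorphXn rmorphN1.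
have [B ->] : exists B, C = symd A B by exists (symd A C); rewrite symdK.
rewrite symdK !swaps_symdl !swaps_symdr.
have sq (D E : {set 'I_m}) : (-1) ^+ swaps D E * (-1) ^+ swaps D E = 1 :> R[i].
  by rewrite -expr2 sqrr_sign.
rewrite -[RHS]mul1r -[X in _ = X * _](sq A B) /=.
set a := (-1) ^+ swaps A A; set b := (-1) ^+ swaps A B.
set c := (-1) ^+ swaps B A; set d := (-1) ^+ swaps B B.
by ring.
Qed.

End CliffordAlgebra.

From mathcomp Require Import all_classical all_reals all_analysis.
From mathcomp Require Import measurable_realfun.
Import numFieldNormedType.Exports.

Local Open Scope classical_set_scope.

Section Euclidean.
Context (R : realType) (m : nat).
Implicit Types x y : 'rV[R]_m.

Definition dotp x y : R := \sum_j x 0 j * y 0 j.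

(* The norm [`|x|] of ['rV[R]_m] is the sup norm. *)
Definition enorm x : R := Num.sqrt (dotp x x).

(* The scalar a of R in the algebra *)
Definition cliff_real (a : R) : cliff R m := a%:C%:A.

(* [vec x] is the vector x seen in the algebra, \sum_j e_j x_j *)
Definition vec x : cliff R m := \sum_j (x 0 j)%:C *: gen R j.

Definition wedge x y : cliff R m :=
  \sum_(j < m) \sum_(k < m | (j < k)%N)
    (x 0 j * y 0 k - x 0 k * y 0 j)%:C *: (gen R j * gen R k).

End Euclidean.

Section Dirac.
Context (R : realType) (m : nat).
Implicit Types f : 'rV[R]_m -> cliff R m.

(* The j-th partial derivative, taken in each real coordinate of the algebra *)
Definition partial (j : 'I_m) f (x : 'rV[R]_m) : cliff R m := [ffun A =>
  'D_(delta_mx 0 j) (fun z => complex.Re (f z A)) x +i*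
  'D_(delta_mx 0 j) (fun z => complex.Im (f z A)) x].

Definition Dirac f x : cliff R m := \sum_j gen R j * partial j f x.

Definition Dirac_r f x : cliff R m := \sum_j partial j f x * gen R j.

(* Polynomials with coefficients in the algebra, as functions; the exponents
   of a monomial of degree l are at most l. *)
Definition homogeneous_poly (l : nat) f :=
  exists a : {ffun 'I_m -> 'I_l.+1} -> cliff R m, forall x,
    f x = \sum_(alpha : {ffun 'I_m -> 'I_l.+1} | (\sum_i alpha i == l)%N)
            (\prod_i x 0 i ^+ alpha i)%:C *: a alpha.

Definition spherical_monogenic (l : nat) f :=
  homogeneous_poly l f /\ forall x, Dirac f x = 0.

End Dirac.


Section LebesgueMeasure.
Context (R : realType).
Local Notation T := (measurableTypeR R).

Section Cons.
Context (n : nat) (mu : {measure set (n.-tuple T) -> \bar R}).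

Definition tuple_cons (p : T * n.-tuple T) : n.+1.-tuple T :=
  [the n.+1.-tuple T of p.1 :: p.2].

Lemma measurable_tuple_cons : measurable_fun setT tuple_cons.
Proof. exact: measurable_cons. Qed.

Definition cons_measure : set (n.+1.-tuple T) -> \bar R :=
  pushforward (lebesgue_measure \x^ mu)%E tuple_cons.

Lemma cons_measure0 : cons_measure set0 = 0%E.
Proof. by rewrite /cons_measure /pushforward preimage_set0 measure0. Qed.

Lemma cons_measure_ge0 A : (0 <= cons_measure A)%E.
Proof. by rewrite /cons_measure /pushforward; exact: measure_ge0. Qed.

Lemma cons_measure_additive : semi_sigma_additive cons_measure.
Proof.
move=> F mF tF mUF; rewrite /cons_measure.
exact: (@measure_semi_sigma_additive _ _ _
  (measure_function_pushforward__canonical__measure_function_Measure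
    (lebesgue_measure \x^ mu)%E measurable_tuple_cons)
  F mF tF mUF).
Qed.

HB.instance Definition _ := isMeasure.Build _ _ _ cons_measure
  cons_measure0 cons_measure_ge0 cons_measure_additive.

End Cons.

(* Lebesgue measure on R^n, as an iterated product *)
Fixpoint lebesgue_tuple (n : nat) : {measure set (n.-tuple T) -> \bar R} :=
  if n is n'.+1 then cons_measure (lebesgue_tuple n') else \d_[tuple].

Lemma lebesgue_tuple_box (n : nat) (A : 'I_n -> set T) :
  (forall i, measurable (A i)) ->
  lebesgue_tuple n [set t | forall i, A i (tnth t i)] =
  (\prod_(i < n) lebesgue_measure (A i))%E.
Proof.
elim: n A => [|n IHn] A mA /=.
  rewrite big_ord0 /dirac /= indicE mem_set//; by case.
rewrite big_ord_recl -IHn; last by move=> i; exact: mA.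
rewrite /cons_measure /pushforward -product_measure2E//=; last first.
  rewrite (_ : mkset _ = \bigcap_(i in [set: 'I_n])
      (fun t : n.-tuple T => tnth t i) @^-1` A (lift ord0 i)).
    apply: fin_bigcap_measurable => // i _.
    by rewrite -[X in measurable X]setTI; exact: measurable_tnth.
  by apply/seteqP; split => t /= tA i; [move=> _; exact: tA|exact: tA].
congr (_ _); apply/seteqP; split => -[a t] /=.
  move=> At; split; first exact: (At ord0).
  by move=> i; have := At (lift ord0 i); rewrite tnthS.
move=> [Aa At] i; have [->//|i0] := eqVneq i ord0.
have [j ->] : exists j, i = lift ord0 j.
  by case: (unliftP ord0 i) => [j|] ij; [exists j|rewrite ij eqxx in i0].
by rewrite tnthS; exact: At.
Qed.

End LebesgueMeasure.

Section SphereMeasure.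
Context (R : realType) (m : nat).
Local Notation T := (m.-tuple (measurableTypeR R)).

Definition point (t : T) : 'rV[R]_m := \row_i tnth t i.

Definition direction (t : T) : T := [tuple tnth t i / enorm (point t) | i < m].

Definition unit_sphere : set T := [set t | enorm (point t) = 1].

Definition punctured_ball : set T := [set t | 0 < enorm (point t) <= 1].

(* The surface measure of the unit sphere, by polar coordinates:
   sigma(E) = m * lambda {r u | u in E, 0 < r <= 1}. *)
Definition sphere_measure (E : set T) : \bar R :=
  (m%:R%:E * lebesgue_tuple R m (punctured_ball `&` direction @^-1` E))%E.

Lemma measurable_enorm : measurable_fun setT (fun t : T => enorm (point t)).
Proof.
apply: (measurableT_comp (f := @Num.sqrt R)) => //.
  by apply: continuous_measurable_fun; exact: sqrt_continuous.
apply: measurable_sum => i; apply: measurable_funM;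
  by under eq_fun do rewrite mxE; exact: measurable_tnth.
Qed.

Lemma measurable_punctured_ball : measurable punctured_ball.
Proof.
rewrite (_ : punctured_ball =
    setT `&` (fun t : T => enorm (point t)) @^-1` `]0, 1]).
  exact: (measurable_enorm measurableT (measurable_itv _)).
by rewrite setTI; apply/seteqP; split => t /=; rewrite in_itv.
Qed.

Lemma measurable_direction : measurable_fun setT direction.
Proof.
apply/measurable_fun_tnthP => i.
rewrite (_ : _ \o _ = fun t : T => tnth t i * enorm (point t) `^ (-1)).
  apply: measurable_funM; first exact: measurable_tnth.
  apply: (measurableT_comp (f := (@powR R ^~ (-1)))).
    exact: measurable_powR.
  exact: measurable_enorm.
by apply/funext => t /=; rewrite tnth_mktuple powR_inv1// sqrtr_ge0.
Qed.

Lemma sphere_measureE : sphere_measure =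
  mscale (m%:R%:nng)
    (measure_function_pushforward__canonical__measure_function_Measure
      (mrestr (lebesgue_tuple R m) measurable_punctured_ball)
      measurable_direction).
Proof.
apply/funext => E.
by rewrite /sphere_measure /mscale /= /pushforward /mrestr setIC.
Qed.

Lemma sphere_measure0 : sphere_measure set0 = 0%E.
Proof. by rewrite sphere_measureE measure0. Qed.

Lemma sphere_measure_ge0 E : (0 <= sphere_measure E)%E.
Proof. by rewrite sphere_measureE; exact: measure_ge0. Qed.

Lemma sphere_measure_additive : semi_sigma_additive sphere_measure.
Proof. by rewrite sphere_measureE; exact: measure_semi_sigma_additive. Qed.

HB.instance Definition _ := isMeasure.Build _ _ _ sphere_measure
  sphere_measure0 sphere_measure_ge0 sphere_measure_additive.

Definition sphere_integral (f : 'rV[R]_m -> R) : R :=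
  \int[sphere_measure]_(t in unit_sphere) f (point t).

Definition cliff_sphere_integral (f : 'rV[R]_m -> cliff R m) : cliff R m :=
  [ffun A => sphere_integral (fun x => complex.Re (f x A)) +i*
             sphere_integral (fun x => complex.Im (f x A))].

End SphereMeasure.

Section Kernels.
Context (R : realType).

Definition Gamma (s : R) : R :=
  \int[lebesgue_measure]_(t in `]0, +oo[) (t `^ (s - 1) * expR (- t)).

(* C_k^mu, with C_k^mu = 0 for k < 0 *)
Definition gegenbauer (k : int) (mu t : R) : R :=
  if k is Posz n then
    \sum_(0 <= j < n./2.+1)
      (-1) ^+ j * (Gamma ((n - j)%N%:R + mu) /
                   (Gamma mu * j`!%:R * (n - 2 * j)%N`!%:R)) *
      (2 * t) ^+ (n - 2 * j)
  else 0.

Definition sphere_area (m : nat) : R :=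
  2 * pi `^ (m%:R / 2) / Gamma (m%:R / 2).

Context (m : nat).
Implicit Types (x y : 'rV[R]_m) (P Q : 'rV[R]_m -> cliff R m).

Definition sphere_inner P Q : cliff R m :=
  ((sphere_area m)^-1)%:C *:
    cliff_sphere_integral (fun x => dagger (P x) * Q x).

(* The parameter mu of the Gegenbauer polynomials *)
Definition gorder : R := m%:R / 2 - 1.

(* When x or y vanishes, 0^-1 = 0 gives t = 0; the kernels below then still
   take the value of the polynomials in (x, y) they agree with elsewhere. *)
Definition cosine x y : R := dotp x y / (enorm x * enorm y).

(* K_n^m *)
Definition harmonic_kernel (n : nat) x y : R :=
  (n%:R + gorder) / gorder * enorm x ^+ n * enorm y ^+ n *
  gegenbauer n gorder (cosine x y).

(* c_k (Dirac_x K_{k+1}^m Dirac_y), with c_k = - 1 / (m + 2 k)^2 *)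
Definition monogenic_kernel (k : nat) x y : cliff R m :=
  (- ((m + 2 * k)%N%:R ^+ 2)^-1)%:C *:
  Dirac_r (fun y' =>
    Dirac (fun x' => cliff_real m (harmonic_kernel k.+1 x' y')) x) y.

Definition monogenic_kernel_closed (k : nat) x y : cliff R m :=
  cliff_real m ((2 * gorder + k%:R) / (2 * gorder) *
    enorm x ^+ k * enorm y ^+ k * gegenbauer k gorder (cosine x y)) +
  (enorm x ^ (k%:Z - 1) * enorm y ^ (k%:Z - 1) *
    gegenbauer (k%:Z - 1) (gorder + 1) (cosine x y))%:C *: wedge x y.

End Kernels.

(* Main.v *)
(* In polar coordinates the integral over the sphere of a homogeneous polynomial
   F of degree d is its integral over R^m against exp (- |x|^2), divided by
   Gamma ((m + d) / 2) / 2, and against this weight multiplication by x_j is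
   half the derivative in x_j.

   Let P be the conjugate of the kernel: it is a polynomial of degree k killed
   by the Dirac operator from the right (Gegenbauer identities), while M is
   killed from the left. Integrating x by parts, P x M has Gaussian integral 0.
   In P x x M either x can be integrated by parts, which multiplies the integral
   of P M by - (m + 2 l) / 2 or by - (m + 2 k) / 2; so it vanishes for k <> l.
   For k = l, expand P: powers of <x,y> below degree k integrate to 0 against
   M, hence so do their products with |x|^2, and <x,y>^k gives a multiple of
   M y. Only the leading Gegenbauer coefficients remain. *)
From HB Require Import structures.
Require Import Defs.
From mathcomp Require Import all_boot all_order all_algebra.
From mathcomp Require Import complex ring lra zify.
From mathcomp Require Import all_classical all_reals all_analysis.
From mathcomp Require Import measurable_realfun gauss_integral.
Import Order.TTheory GRing.Theory Num.Theory.
Import numFieldNormedType.Exports.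
Set Implicit Arguments.
Unset Strict Implicit.
Unset Printing Implicit Defensive.
Local Open Scope classical_set_scope.
Local Open Scope ring_scope.

(** * Gaussian moments and the Gamma function *)

(** The surface measure is given by cones in the unit ball, so integration by parts on the sphere is
    not at hand. On R^m the Gaussian weight leaves no boundary term: integration by parts is a
    recurrence between one-dimensional moments, checked on monomials and extended by linearity.
    Polar coordinates come from Tonelli's theorem: a radial weight is an integral of indicators of
    balls, and balls are compared by scaling. All this takes place in the extended reals, for
    nonnegative functions, where nothing has to converge beforehand. [Gamma] is the [fine] part of
    such an integral; at half-integers it is finite and positive because the Gaussian integral of 1
    is pi^(m/2). The kernels contain norms and quotients that are singular at 0. Gegenbauer
    polynomials homogenised in s = <x,y> and q = |x|^2 |y|^2 make them polynomials in x and y,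
    differentiable everywhere. Their degrees are integers, since the computations reach degree k -
    3, which is negative for small k. *)

Lemma tonelli_region d1 d2 (T1 : measurableType d1) (T2 : measurableType d2)
    (R : realType) (m1 : {sigma_finite_measure set T1 -> \bar R})
    (m2 : {sigma_finite_measure set T2 -> \bar R})
    (E : set (T1 * T2)) (F : T1 * T2 -> R) :
  measurable E -> measurable_fun setT F -> (forall p, E p -> 0 <= F p) ->
  (\int[m1]_x \int[m2]_(y in [set y | E (x, y)]) (F (x, y))%:E =
   \int[m2]_y \int[m1]_(x in [set x | E (x, y)]) (F (x, y))%:E)%E.
Proof.
move=> mE mF F0.
(* Extension by 0 outside [E] makes the integrand nonnegative everywhere; weights such as 2 x
   exp(-x^2) are negative off the region. *)
have := @fubini_tonelli _ _ _ _ _ m1 m2 ((EFin \o F) \_ E).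
rewrite -(measurable_restrictT _ mE) => /(_ _ _) /=.
have H : measurable_fun E (EFin \o F).
  by apply/measurable_EFinP; exact: measurable_funTS.
have H0 p : (0 <= ((EFin \o F) \_ E) p)%E.
  rewrite patchE; case: ifPn => // /set_mem pE; rewrite lee_fin; exact: F0.
move=> /(_ H H0) FT; transitivity
    (\int[m1]_x \int[m2]_y ((EFin \o F) \_ E) (x, y))%E.
  apply: eq_integral => x _; rewrite integral_mkcond; apply: eq_integral => y _.
  by rewrite !patchE; congr (if _ then _ else _); apply/idP/idP; rewrite !inE.
rewrite FT; apply: eq_integral => y _; rewrite [RHS]integral_mkcond.
apply: eq_integral => x _.
by rewrite !patchE; congr (if _ then _ else _); apply/idP/idP; rewrite !inE.
Qed.

Section HalfLine.
Context {R : realType}.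
Local Notation mu := (@lebesgue_measure R).

(* The power is singular at the origin when [s < 1]. *)
Lemma integral_powR (s x : R) : 0 < s -> 0 < x ->
  (\int[mu]_(u in `]0%R, x]) (s * u `^ (s - 1))%:E = (x `^ s)%:E)%E.
Proof.
move=> s0 x0.
have cp u : 0 < u -> {for u, continuous (fun u => s * u `^ (s - 1))}.
  move=> u0; apply: continuousM; first exact: cvg_cst.
  apply: differentiable_continuous; apply/derivable1_diffP.
  by apply: derivable_powR; rewrite in_itv/= u0.
(* These intervals stay away from the singularity and exhaust ]0, x]; monotone convergence
   concludes. *)
pose F n := `[x / n.+1%:R, x]%classic.
have FE : `]0, x]%classic = \bigcup_n F n.
  apply/seteqP; split => u /=.
    rewrite in_itv/= => /andP[u0 ux].
    exists (Num.trunc (x / u)) => //; rewrite /F /= in_itv/= ux andbT.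
    rewrite ler_pdivrMr// mulrC -ler_pdivrMr//.
    by rewrite ltW// truncnS_gt.
  move=> [n _]; rewrite /F /= !in_itv/= => /andP[xu ux]; rewrite ux andbT.
  by apply: lt_le_trans xu; rewrite divr_gt0.
have H n : (\int[mu]_(u in F n) (s * u `^ (s - 1))%:E =
    (x `^ s)%:E - ((x / n.+1%:R) `^ s)%:E)%E.
  have xn0 : 0 < x / n.+1%:R by rewrite divr_gt0.
  (* For n = 0 the interval is a single point, outside the scope of the fundamental theorem of
     calculus. *)
  case: n xn0 => [|n] xn0.
    by rewrite /F divr1 set_itv1 integral_set1 subee.
  have cF u : 0 < u -> {for u, continuous (fun u : R => u `^ s)}.
    move=> u0; apply: differentiable_continuous; apply/derivable1_diffP.
    by apply: derivable_powR; rewrite in_itv/= u0.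
  rewrite /F (@continuous_FTC2 _ _ (fun u => u `^ s))//.
  - by rewrite ltr_pdivrMr// ltr_pMr// ltr1n.
  - apply: continuous_in_subspaceT => u /set_mem /=; rewrite in_itv/= => /andP[xu _].
    by apply: cp; exact: lt_le_trans xu.
  - split.
    + move=> u; rewrite in_itv/= => /andP[xu _]; apply: derivable_powR.
      by rewrite in_itv/= andbT (lt_trans _ xu).
    + exact/cvg_at_right_filter/cF.
    + exact/cvg_at_left_filter/cF.
  - move=> u; rewrite in_itv/= => /andP[xu _]; apply: powR_derive1.
    by rewrite in_itv/= andbT (lt_trans _ xu).
have mf : measurable_fun setT (fun u => (s * u `^ (s - 1))%:E).
  apply/measurable_EFinP; apply: measurable_funM => //; exact: measurable_powR.
have cvI : (\int[mu]_(u in F n) (s * u `^ (s - 1))%:E)%E @[n --> \oo] -->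
    (\int[mu]_(u in `]0%R, x]) (s * u `^ (s - 1))%:E)%E.
  rewrite FE; apply: ge0_nondecreasing_set_cvg_integral => //.
  - apply/nondecreasing_seqP => n; rewrite subsetEset; apply: subset_itvr.
    by rewrite bnd_simp ler_pM2l// lef_pV2 ?posrE// ler_nat.
  - by move=> n; exact: measurable_itv.
  - by move=> n; exact: measurable_funTS.
  - by move=> n u _; rewrite lee_fin mulr_ge0 ?powR_ge0// ltW.
apply/esym/(cvg_unique _ _ cvI) => //.
rewrite (_ : (fun n => _) = EFin \o (fun n => x `^ s - (x / n.+1%:R) `^ s)); last first.
  by apply/funext => n /=; rewrite H.
apply: cvg_EFin; first exact: nearW.
rewrite -[X in _ --> X]subr0; apply: cvgB; first exact: cvg_cst.
have /cvg_at_rightP := powR_cvg0 s0; apply; split=> [n|]; first by rewrite divr_gt0.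
rewrite -[X in _ --> X](mulr0 x); apply: cvgM; first exact: cvg_cst.
exact: cvg_harmonic.
Qed.

(** Both sides are the integral of w(x) v(u) over the region 0 < u <= x. This is integration by
    parts on the half-line, in a form that makes sense for infinite integrals. *)
Lemma layer_cake (v w V W : R -> R) :
  measurable_fun setT v -> measurable_fun setT w ->
  (forall x, 0 < x -> 0 <= v x) -> (forall x, 0 < x -> 0 <= w x) ->
  (forall x, 0 < x -> (\int[mu]_(u in `]0%R, x]) (v u)%:E = (V x)%:E)%E) ->
  (forall u, 0 < u -> (\int[mu]_(x in `[u, +oo[) (w x)%:E = (W u)%:E)%E) ->
  (\int[mu]_(x in `]0%R, +oo[) (w x * V x)%:E =
   \int[mu]_(u in `]0%R, +oo[) (v u * W u)%:E)%E.
Proof.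
move=> mv mw v0 w0 vV wW.
pose E : set (measurableTypeR R * measurableTypeR R) :=
  [set p | 0 < p.2] `&` [set p | p.2 <= p.1].
have mE : measurable E.
  rewrite /E; apply: measurableI.
    rewrite -[X in measurable X]setTI.
    exact: (@measurable_fun_ltr _ _ _ setT (cst 0) snd).
  rewrite -[X in measurable X]setTI; exact: measurable_fun_ler.
have := @tonelli_region _ _ _ _ R mu mu E (fun p => w p.1 * v p.2) mE.
rewrite /E /= => T; rewrite integral_mkcond [RHS]integral_mkcond /=.
transitivity (\int[mu]_x \int[mu]_(y in [set y | (0 < y)%R /\ (y <= x)%R])
  (w x * v y)%:E)%E.
  apply: eq_integral => x _; rewrite patchE mem_setE in_itv/= andbT.
  case: ifPn => [x0|].
    rewrite EFinM -vV// -ge0_integralZl_EFin//=.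
    - by congr (integral _ _ _); apply/seteqP; split => y /=; rewrite in_itv/= => /andP.
    - by move=> y /=; rewrite in_itv/= lee_fin => /andP[? _]; exact: v0.
    - by apply/measurable_EFinP; exact: measurable_funTS.
    - exact: w0.
  rewrite -leNgt => x0; rewrite (_ : mkset _ = set0) ?integral_set0//.
  by apply/seteqP; split => y //= [y0 /(lt_le_trans y0)]; rewrite ltNge x0.
rewrite T.
- apply: eq_integral => u _; rewrite patchE mem_setE in_itv/= andbT.
  case: ifPn => [u0|].
    under eq_integral do rewrite mulrC EFinM.
    rewrite EFinM -wW// -ge0_integralZl_EFin//=.
    - by congr (integral _ _ _); apply/seteqP; split => y /=; rewrite in_itv/= andbT => // -[].
    - by move=> y /=; rewrite in_itv/= lee_fin andbT => uy; apply: w0; exact: lt_le_trans uy.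
    - by apply/measurable_EFinP; exact: measurable_funTS.
    - exact: v0.
  rewrite -leNgt => x0; rewrite (_ : mkset _ = set0) ?integral_set0//.
  by apply/seteqP; split => y //= [].
- by apply: measurable_funM; exact: measurableT_comp.
- move=> [x u] [/= u0 ux]; rewrite mulr_ge0// ?v0// w0//; exact: lt_le_trans ux.
Qed.

Lemma integral_exp_tail (u : R) :
  (\int[mu]_(x in `[u, +oo[) (expR (- x))%:E = (expR (- u))%:E)%E.
Proof.
have cF : continuous (fun x : R => - expR (- x)).
  move=> x; apply: cvgN; apply: continuous_comp; first exact: opp_continuous.
  exact: continuous_expR.
rewrite (@ge0_continuous_FTC2y _ _ (fun x => - expR (- x)) _ 0).
- by rewrite -EFinB opprK add0r.
- by move=> x _; exact: expR_ge0.
- apply: continuous_subspaceT => x; apply: continuous_comp; first exact: opp_continuous.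
  exact: continuous_expR.
- by rewrite -oppr0; apply: cvgN; exact: cvgr_expR.
- by move=> x _; exact: ex_derive.
- exact/cvg_at_right_filter/cF.
- move=> x _; rewrite derive1E; rewrite derive_val.
  by rewrite mulrN1 opprK.
Qed.

Lemma integral_gauss_tail (u : R) : 0 <= u ->
  (\int[mu]_(x in `[u, +oo[) (2 * x * expR (- x ^+ 2))%:E =
   (expR (- u ^+ 2))%:E)%E.
Proof.
move=> u0.
have cE : continuous (fun x : R => expR (- x ^+ 2)) by exact: continuous_gauss_fun.
rewrite (@ge0_continuous_FTC2y _ _ (fun x => - expR (- x ^+ 2)) _ 0).
- by rewrite -EFinB opprK add0r.
- by move=> x ux; rewrite mulr_ge0 ?expR_ge0// mulr_ge0// (le_trans u0).
- apply: continuous_subspaceT => x; apply: continuousM; last exact: cE.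
  by apply: continuousM; [exact: cvg_cst|exact: cvg_id].
- by rewrite -oppr0; apply: cvgN; exact: cvg_gauss_fun.
- by move=> x _; exact: ex_derive.
- by apply: cvg_at_right_filter; apply: cvgN; exact: cE.
- move=> x _; rewrite derive1E; rewrite derive_val.
  by rewrite [x%:A]mulr1; ring.
Qed.

(** The integral behind [Gamma], before [fine] sends infinite values to 0. *)
Definition eGamma (s : R) : \bar R :=
  (\int[mu]_(t in `]0%R, +oo[) (t `^ (s - 1) * expR (- t))%:E)%E.

Lemma measurable_expRN : measurable_fun setT (fun x : R => expR (- x)).
Proof. by apply: measurableT_comp => //; exact: measurable_funN. Qed.

(** [layer_cake] with t^s as the integral of s u^(s-1) and exp(-u) as the tail integral of
    exp(-x). *)
Lemma eGammaD1 (s : R) : 0 < s -> eGamma (s + 1) = (s%:E * eGamma s)%E.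
Proof.
move=> s0.
have := @layer_cake (fun u => s * u `^ (s - 1)) (fun x => expR (- x))
  (fun x => x `^ s) (fun u => expR (- u)).
move=> /(_ _ _ _ _ _ _) H.
rewrite /eGamma addrK.
under eq_integral do rewrite mulrC.
rewrite H; last 6 first.
- by apply: measurable_funM => //; exact: measurable_powR.
- exact: measurable_expRN.
- by move=> x x0; rewrite mulr_ge0 ?powR_ge0// ltW.
- by move=> x _; exact: expR_ge0.
- by move=> x x0; exact: integral_powR.
- by move=> u _; exact: integral_exp_tail.
under eq_integral do rewrite -mulrA EFinM.
rewrite ge0_integralZl_EFin//.
- by move=> x _; rewrite lee_fin mulr_ge0 ?powR_ge0 ?expR_ge0.
- apply/measurable_EFinP/measurable_funTS/measurable_funM.
    exact: measurable_powR.
  exact: measurable_expRN.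
- exact: ltW.
Qed.

Lemma eGamma_ge0 (s : R) : (0 <= eGamma s)%E.
Proof.
by apply: integral_ge0 => x _; rewrite lee_fin mulr_ge0 ?powR_ge0 ?expR_ge0.
Qed.

Lemma GammaE (s : R) : Gamma s = fine (eGamma s). Proof. by []. Qed.

(** [layer_cake] again, with exp(-u^2) as the tail integral of 2 x exp(-x^2) and x^(a+1) as the
    integral of (a+1) u^a. *)
Lemma gauss_half_moment (a : nat) :
  (2%:E * \int[mu]_(x in `]0%R, +oo[) (x ^+ a.+2 * expR (- x ^+ 2))%:E =
   a.+1%:R%:E * \int[mu]_(x in `]0%R, +oo[) (x ^+ a * expR (- x ^+ 2))%:E)%E.
Proof.
have mX n : measurable_fun setT (fun x : R => x ^+ n).
  by apply: continuous_measurable_fun; exact: exprn_continuous.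
have mE : measurable_fun setT (fun x : R => expR (- x ^+ 2)).
  exact: measurable_gauss_fun.
have pos n (x : R) : x \in `]0, +oo[ -> 0 <= x ^+ n * expR (- x ^+ 2).
  by rewrite in_itv/= andbT => x0; rewrite mulr_ge0 ?expR_ge0// exprn_ge0// ltW.
have mXE n : measurable_fun (`]0, +oo[ : set R) (fun x : R => (x ^+ n * expR (- x ^+ 2))%:E).
  by apply/measurable_EFinP/measurable_funTS/measurable_funM.
rewrite -!ge0_integralZl_EFin//; last 4 first.
- by move=> x; exact: pos.
- exact: mXE.
- by move=> x; exact: pos.
- exact: mXE.
have := @layer_cake (fun u => a.+1%:R * u ^+ a) (fun x => 2 * x * expR (- x ^+ 2))
  (fun x => x ^+ a.+1) (fun u => expR (- u ^+ 2)).
move=> /(_ _ _ _ _ _ _) H.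
rewrite [LHS](_ : _ = \int[mu]_(x in `]0%R, +oo[)
    (2 * x * expR (- x ^+ 2) * x ^+ a.+1)%:E)%E; last first.
  by apply: eq_integral => x _; rewrite -EFinM !exprS; congr EFin; ring.
rewrite H.
- by apply: eq_integral => x _; rewrite -EFinM mulrA.
- by apply: measurable_funM.
- by apply: measurable_funM => //; exact: measurable_funM.
- by move=> x x0; rewrite mulr_ge0// exprn_ge0// ltW.
- by move=> x x0; rewrite mulr_ge0 ?expR_ge0// mulr_ge0// ltW.
- move=> x x0; rewrite -powR_mulrn ?ltW// -integral_powR//.
  apply: eq_integral => u; rewrite mem_setE in_itv/= => /andP[u0 _].
  by rewrite -[a.+1%:R]natr1 addrK powR_mulrn// ltW.
- by move=> u u0; apply: integral_gauss_tail; exact: ltW.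
Qed.

(** Both sides are measures that agree on half-open intervals. A negative [r] exchanges the ends of
    an interval; it serves the reflection x -> -x, which kills the odd moments. *)
Lemma lebesgue_measure_scale (r : R) (A : set (measurableTypeR R)) :
  r != 0 -> measurable A ->
  (mu A = `|r|%:E * mu [set x | (r * x)%R \in A])%E.
Proof.
move=> r0 mA.
have mr : @measurable_fun _ _ (measurableTypeR R) (measurableTypeR R) setT
    (fun x => r * x).
  by apply: continuous_measurable_fun; exact: mulrl_continuous.
pose nu : {measure set (measurableTypeR R) -> \bar R} :=
  [the measure _ _ of mscale (NngNum (normr_ge0 r))
    (measure_function_pushforward__canonical__measure_function_Measure mu mr)].
suff -> : mu A = nu A.
  rewrite /nu /mscale /= /pushforward; congr (_ * mu _)%E.
  by apply/seteqP; split => x /=; rewrite inE.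
apply: lebesgue_measure_unique => // _ [[a b] _ <-].
rewrite lebesgue_measure_itv /nu/= lte_fin /mscale/= /pushforward.
have [rp|rn] := ltP 0 r.
  rewrite (_ : _ @^-1` _ = `]a / r, b / r]%classic); last first.
    by apply/seteqP; split => x /=; rewrite !in_itv/= ltr_pdivrMr// ler_pdivlMr// mulrC.
  rewrite lebesgue_measure_itv/= lte_fin ltr_pM2r ?invr_gt0//.
  case: ifP => _; last by rewrite mule0.
  by rewrite -EFinB -EFinM gtr0_norm// -mulrBl mulrC divfK// gt_eqF.
have {r0 rn}rn : r < 0 by rewrite lt_neqAle r0.
rewrite (_ : _ @^-1` _ = `[b / r, a / r[%classic); last first.
  apply/seteqP; split => x /=; rewrite !in_itv/= ltr_ndivlMr// ler_ndivrMr// mulrC => /andP[-> ->] //.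
rewrite lebesgue_measure_itv/= lte_fin ltr_nM2r ?invr_lt0//.
case: ifP => _; last by rewrite mule0.
by rewrite -EFinB -EFinM ltr0_norm// -mulrBl mulNr mulrC divfK ?opprB// lt_eqF.
Qed.

Lemma ge0_integral_scale (r : R) (f : measurableTypeR R -> \bar R) :
  r != 0 -> measurable_fun setT f -> (forall x, 0 <= f x)%E ->
  (\int[mu]_x f x = `|r|%:E * \int[mu]_x f (r * x)%R)%E.
Proof.
move=> r0 mf f0.
have mr : @measurable_fun _ _ (measurableTypeR R) (measurableTypeR R) setT
    (fun x => r * x).
  by apply: continuous_measurable_fun; exact: mulrl_continuous.
pose pu := measure_function_pushforward__canonical__measure_function_Measure mu mr.
pose nu : {measure set (measurableTypeR R) -> \bar R} :=
  [the measure _ _ of mscale (NngNum (normr_ge0 r)) pu].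
rewrite (eq_measure_integral nu); last first.
  move=> A mA _; apply: (etrans (lebesgue_measure_scale r0 mA)).
  rewrite /nu /mscale /= /pushforward; congr (_ * mu _)%E.
  by apply/seteqP; split => x /=; rewrite inE.
by rewrite ge0_integral_mscale// ge0_integral_pushforward.
Qed.

Lemma gauss_half_moment_lty (a : nat) :
  (\int[mu]_(x in `]0%R, +oo[) (x ^+ a * expR (- x ^+ 2))%:E < +oo)%E.
Proof.
have mX n : measurable_fun setT (fun x : R => x ^+ n * expR (- x ^+ 2)).
  apply: measurable_funM; last exact: measurable_gauss_fun.
  by apply: continuous_measurable_fun; exact: exprn_continuous.
(* The recurrence moves by two, so the induction carries two consecutive exponents. It starts from
   the Gaussian integral and from the tail integral at 0. *)
suff /(_ a)[] : forall a, (\int[mu]_(x in `]0%R, +oo[) (x ^+ a * expR (- x ^+ 2))%:E < +oo /\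
  \int[mu]_(x in `]0%R, +oo[) (x ^+ a.+1 * expR (- x ^+ 2))%:E < +oo)%E by [].
elim=> [|{}a [IH1 IH2]]; split => //.
- rewrite integral_itv_obnd_cbnd; last by apply/measurable_EFinP/measurable_funTS; exact: mX.
  under eq_integral do rewrite expr0 mul1r.
  by have := @integral0y_gauss R; rewrite /gauss_fun => ->; rewrite ltry.
- rewrite -(@lte_pmul2l _ 2%:E)//.
  rewrite -ge0_integralZl_EFin//; last 2 first.
    by move=> x /=; rewrite in_itv/= andbT lee_fin => x0; rewrite mulr_ge0 ?expR_ge0// exprn_ge0// ltW.
    by apply/measurable_EFinP/measurable_funTS; exact: mX.
  rewrite integral_itv_obnd_cbnd; last first.
    apply/measurable_EFinP/measurable_funTS; apply: measurable_funM => //; exact: mX.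
  under eq_integral do rewrite expr1 -EFinM mulrA.
  by rewrite integral_gauss_tail// expr0n/= oppr0 expR0 gt0_muley// ltry.
- rewrite -(@lte_pmul2l _ 2%:E)// gauss_half_moment gt0_muley//.
  by rewrite lte_mul_pinfty.
Qed.

Lemma gauss_moment_even (a : nat) : ~~ odd a ->
  (\int[mu]_x (x ^+ a * expR (- x ^+ 2))%:E =
  2%:E * \int[mu]_(x in `]0%R, +oo[) (x ^+ a * expR (- x ^+ 2))%:E)%E.
Proof.
move=> a2.
have cX : continuous (fun x : R => x ^+ a * expR (- x ^+ 2)).
  move=> x.
  have H := @continuousM _ _ (fun x : R => x ^+ a) (fun x : R => expR (- x ^+ 2)) x.
  by apply: H; [exact: exprn_continuous|exact: continuous_gauss_fun].
rewrite ge0_symfun_integralT//.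
- congr (_ * _)%E; rewrite integral_itv_obnd_cbnd; last first.
    by apply/measurable_EFinP/measurable_funTS; exact: continuous_measurable_fun.
  by congr (integral _ _ _); apply/seteqP; split => x /=; rewrite in_itv/= andbT.
- by move=> x; rewrite mulr_ge0 ?expR_ge0// exprn_even_ge0.
- by move=> x /=; rewrite sqrrN exprNn -[in RHS]signr_odd (negbTE a2) expr0 mul1r.
Qed.

Lemma gauss_moment_integrable (a : nat) :
  mu.-integrable setT (fun x : measurableTypeR R => (x ^+ a * expR (- x ^+ 2))%:E).
Proof.
have mX n : measurable_fun setT (fun x : R => x ^+ n * expR (- x ^+ 2)).
  apply: measurable_funM; last exact: measurable_gauss_fun.
  by apply: continuous_measurable_fun; exact: exprn_continuous.
have half n : ~~ odd n -> (\int[mu]_x (x ^+ n * expR (- x ^+ 2))%:E < +oo)%E.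
  by move=> n2; rewrite gauss_moment_even// lte_mul_pinfty// gauss_half_moment_lty.
have pos n (x : R) : ~~ odd n -> 0 <= x ^+ n * expR (- x ^+ 2).
  by move=> n2; rewrite mulr_ge0 ?expR_ge0// exprn_even_ge0.
(* Domination by |t| <= 1 + t^2 with t = x^a: only even exponents remain, whose integrands are
   nonnegative and symmetric. *)
apply: (@le_integrable _ _ _ mu setT measurableT _
    (fun x => ((x ^+ 0 * expR (- x ^+ 2)) + x ^+ (2 * a) * expR (- x ^+ 2))%:E)) => //.
- by apply/measurable_EFinP; exact: mX.
- move=> x _; rewrite /= lee_fin normrM (ger0_norm (expR_ge0 _)).
  rewrite (ger0_norm (addr_ge0 (pos 0%N x isT) (pos (2 * a)%N x _))) ?oddM//.
  rewrite -mulrDl ler_pM2r ?expR_gt0//.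
  rewrite normrX mulnC exprM -[x ^+ a ^+ 2]real_normK ?num_real// normrX expr0.
  set t := `|x| ^+ a; have := sqr_ge0 (t - 1); nra.
- have := @integrableD _ _ _ mu setT measurableT
   (fun x => (x ^+ 0 * expR (- x ^+ 2))%:E) (fun x => (x ^+ (2 * a) * expR (- x ^+ 2))%:E).
  apply; apply/integrableP; (split; first by apply/measurable_EFinP; exact: mX).
    under eq_integral do rewrite abse_EFin ger0_norm ?pos//.
    exact: half.
  under eq_integral do rewrite abse_EFin ger0_norm ?pos ?oddM//.
  by apply: half; rewrite oddM.
Qed.

Definition gauss_moment (a : nat) : R := \int[mu]_x (x ^+ a * expR (- x ^+ 2)).

Lemma gauss_moment0 : gauss_moment 0 = Num.sqrt pi.
Proof.
rewrite /gauss_moment /Rintegral; under eq_integral do rewrite expr0 mul1r.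
by have := @integralT_gauss R; rewrite /gauss_fun => ->.
Qed.

Lemma gauss_moment_odd (a : nat) : odd a -> gauss_moment a = 0.
Proof.
move=> a1; rewrite /gauss_moment /Rintegral.
set f := fun x : measurableTypeR R => (x ^+ a * expR (- x ^+ 2))%:E.
have fN x : f (- x)%R = (- f x)%E.
  by rewrite /f sqrrN exprNn -signr_odd a1 expr1 mulN1r mulNr EFinN.
have intf : mu.-integrable setT f by exact: gauss_moment_integrable.
(* The reflection x -> -x exchanges the positive and the negative part of the integrand. *)
rewrite integralE (_ : \int[mu]_x f^\- x = \int[mu]_x f^\+ x)%E.
  rewrite subee// ge0_fin_numE ?integral_ge0//.
  exact: integral_funepos_lt_pinfty intf.
rewrite [RHS](@ge0_integral_scale (-1)) ?oppr_eq0 ?oner_eq0//.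
- rewrite normrN1 mul1e; apply: eq_integral => x _.
  by rewrite funeposE funenegE mulN1r fN.
- by apply: measurable_funepos; exact: measurable_int intf.
Qed.

Lemma gauss_momentSS (a : nat) :
  gauss_moment a.+2 = a.+1%:R / 2 * gauss_moment a.
Proof.
have [a1|a2] := boolP (odd a).
  by rewrite !gauss_moment_odd//= ?negbK// mulr0.
rewrite /gauss_moment /Rintegral !gauss_moment_even//= ?negbK//.
rewrite gauss_half_moment; set h := (integral _ _ _).
have : h \is a fin_num.
  rewrite ge0_fin_numE ?gauss_half_moment_lty//.
  apply: integral_ge0 => x /=; rewrite in_itv/= andbT lee_fin => x0.
  by rewrite mulr_ge0 ?expR_ge0// exprn_ge0// ltW.
by move=> /fineK <-; rewrite -!EFinM /=; field.
Qed.

End HalfLine.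

(** * Products over tuples *)

Section TupleMeasure.
Context {R : realType}.
Local Notation T := (measurableTypeR R).
Local Notation mu := (@lebesgue_measure R).

Lemma lebesgue_tuple_sigma_finite n : sigma_finite setT (lebesgue_tuple R n).
Proof.
exists (fun k => [set t : n.-tuple T | forall i : 'I_n, `[- k%:R, k%:R]%classic (tnth t i)]).
  apply/esym/seteqP; split => // t _ /=.
  exists (Num.trunc (\sum_(i < n) `|tnth t i|)).+1 => // i; rewrite in_itv/= -ler_norml.
  apply: le_trans (ltW (truncnS_gt _)).
  by rewrite (bigD1 i)//= lerDl sumr_ge0.
move=> k; split.
  rewrite (_ : mkset _ = \bigcap_(i in [set: 'I_n])
      (fun t : n.-tuple T => tnth t i) @^-1` `[- k%:R, k%:R]%classic); last first.
    by apply/seteqP; split => t /= tA i; [move=> _; exact: tA|exact: tA].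
  apply: fin_bigcap_measurable => // i _.
  by rewrite -[X in measurable X]setTI; exact: measurable_tnth.
rewrite (@lebesgue_tuple_box R n (fun=> `[- k%:R, k%:R]%classic)); last first.
  by move=> i; exact: measurable_itv.
rewrite -ge0_fin_numE; last by apply: prode_ge0 => i _; exact: measure_ge0.
apply: (big_ind (fun x : \bar R => x \is a fin_num)) => // [x y|i _].
  exact: fin_numM.
by rewrite lebesgue_measure_itv/=; case: ifP.
Qed.

(** A name of its own for [lebesgue_tuple], to carry the sigma-finite structure that Fubini and
    Tonelli ask for. *)
Definition tuple_measure n : set (n.-tuple T) -> \bar R := lebesgue_tuple R n.

HB.instance Definition _ n := Measure.copy (@tuple_measure n) (lebesgue_tuple R n).
HB.instance Definition _ n := Measure_isSigmaFinite.Build _ _ _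
  (@tuple_measure n) (@lebesgue_tuple_sigma_finite n).

(** [cons_measure] is built on the product measure that integrates in the opposite order; the two
    agree on rectangles, hence everywhere. *)
Lemma cons_measureE n (A : set (T * n.-tuple T)) : measurable A ->
  (mu \x (@tuple_measure n))%E A = (mu \x^ lebesgue_tuple R n)%E A.
Proof.
move=> mA; apply: product_measure_unique => // B C mB mC.
exact: product_measure2E.
Qed.

Lemma ge0_integral_tupleS n (f : n.+1.-tuple T -> \bar R) :
  measurable_fun setT f -> (forall t, 0 <= f t)%E ->
  (\int[@tuple_measure n.+1]_t f t =
   \int[mu]_a \int[@tuple_measure n]_t f (tuple_cons (a, t)))%E.
Proof.
move=> mf f0.
rewrite -(@fubini_tonelli1 _ _ _ _ _ _ _ (fun p => f (tuple_cons p)))//; last first.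
  by apply: measurableT_comp => //; exact: measurable_tuple_cons.
rewrite (eq_measure_integral (mu \x^ lebesgue_tuple R n)%E); last first.
  by move=> A mA _; exact: cons_measureE.
exact: (ge0_integral_pushforward (@measurable_tuple_cons R n) _ measurableT).
Qed.

Lemma integral_tuple0 (f : 0.-tuple T -> \bar R) : measurable_fun setT f ->
  (\int[@tuple_measure 0]_t f t = f [tuple])%E.
Proof. by move=> mf; rewrite integral_dirac// diracT mul1e. Qed.

Definition tuple_scale n (r : R) (t : n.-tuple T) : n.-tuple T :=
  [tuple r * tnth t i | i < n].

Lemma measurable_tuple_scale n r : measurable_fun setT (@tuple_scale n r).
Proof.
apply/measurable_fun_tnthP => i.
rewrite (_ : _ \o _ = fun t : n.-tuple T => r * tnth t i); last first.
  by apply/funext => t /=; rewrite tnth_mktuple.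
by apply: measurable_funM => //; exact: measurable_tnth.
Qed.

Lemma tuple_scale_cons n r a (t : n.-tuple T) :
  tuple_scale r (tuple_cons (a, t)) = tuple_cons (r * a, tuple_scale r t).
Proof.
apply: eq_from_tnth => i; rewrite tnth_mktuple /tuple_cons /=.
have [j ->|->] := unliftP ord0 i; last by rewrite !tnth0.
by rewrite !tnthS tnth_mktuple.
Qed.

Lemma ge0_integral_tuple_scale n (r : R) (f : n.-tuple T -> \bar R) :
  0 < r -> measurable_fun setT f -> (forall t, 0 <= f t)%E ->
  (\int[@tuple_measure n]_t f t =
   (r ^+ n)%:E * \int[@tuple_measure n]_t f (tuple_scale r t))%E.
Proof.
move=> r0; elim: n f => [|n IH] f mf f0.
  rewrite !integral_tuple0//; last first.
    by apply: measurableT_comp => //; exact: measurable_tuple_scale.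
  by rewrite expr0 mul1e; congr f; apply: eq_from_tnth => -[].
have mfs : measurable_fun setT (fun t => f (tuple_scale r t)).
  by apply: measurableT_comp => //; exact: measurable_tuple_scale.
have mc (g : n.+1.-tuple T -> \bar R) : measurable_fun setT g ->
    measurable_fun setT (fun p : T * n.-tuple T => g (tuple_cons p)).
  by move=> mg; apply: measurableT_comp => //; exact: measurable_tuple_cons.
have mF (g : n.+1.-tuple T -> \bar R) : measurable_fun setT g -> (forall t, 0 <= g t)%E ->
    measurable_fun setT (fun a : T => \int[@tuple_measure n]_t g (tuple_cons (a, t)))%E.
  move=> mg g0.
  by apply: (measurable_fun_fubini_tonelli_F (fun p => g (tuple_cons p))) => //; exact: mc.
rewrite !ge0_integral_tupleS// (@ge0_integral_scale _ r) ?gt_eqF//; last 2 first.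
- exact: mF.
- by move=> a; exact: integral_ge0.
rewrite exprS EFinM gtr0_norm// -muleA; congr (_ * _)%E.
rewrite -ge0_integralZl_EFin ?exprn_ge0 ?ltW//; last 2 first.
- by move=> a _; exact: integral_ge0.
- exact: (mF _ mfs).
apply: eq_integral => a _; rewrite IH//; last first.
  apply: (measurableT_comp (mc _ mf)); exact: pair1_measurable.
by congr (_ * _)%E; apply: eq_integral => t _; rewrite tuple_scale_cons.
Qed.

Lemma integrable_tupleS n (f : n.+1.-tuple T -> \bar R) :
  measurable_fun setT f ->
  (mu \x @tuple_measure n)%E.-integrable setT (fun p => f (tuple_cons p)) ->
  (@tuple_measure n.+1).-integrable setT f /\
  (\int[@tuple_measure n.+1]_t f t =
   \int[mu]_a \int[@tuple_measure n]_t f (tuple_cons (a, t)))%E.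
Proof.
move=> mf intf.
have mc : measurable_fun setT (fun p : T * n.-tuple T => f (tuple_cons p)).
  by apply: measurableT_comp => //; exact: measurable_tuple_cons.
split.
  apply/integrableP; split => //.
  rewrite ge0_integral_tupleS//; last exact: measurableT_comp.
  by move: intf => /integrable12ltyP; apply.
rewrite (integral12_prod_meas1 intf).
rewrite [RHS](eq_measure_integral (mu \x^ lebesgue_tuple R n)%E); last first.
  by move=> A mA _; exact: cons_measureE.
apply: (integral_pushforward (@measurable_tuple_cons R n)) => //.
apply/integrableP; split; first exact: mc.
move/integrableP : intf => [_]; congr (_ < _)%E.
by apply: eq_measure_integral => A mA _; first [exact: cons_measureE|apply/esym; exact: cons_measureE].
Qed.

Lemma measurable_prod_tnth n (g : 'I_n -> R -> R) :
  (forall i, measurable_fun setT (g i)) ->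
  measurable_fun setT (fun t : n.-tuple T => \prod_i g i (tnth t i)).
Proof.
move=> mg; apply: measurable_prod => i _.
by apply: (measurableT_comp (mg i)); exact: measurable_tnth.
Qed.

Lemma integral_tuple_prod n (g : 'I_n -> R -> R) :
  (forall i, mu.-integrable setT (EFin \o g i)) ->
  (@tuple_measure n).-integrable setT (fun t => (\prod_i g i (tnth t i))%:E) /\
  (\int[@tuple_measure n]_t (\prod_i g i (tnth t i))%:E =
   (\prod_i \int[mu]_x g i x)%:E)%E.
Proof.
elim: n g => [|n IH] g ig; have mg i : measurable_fun setT (g i)
  by apply/measurable_EFinP; exact: measurable_int (ig i).
  have m1 : measurable_fun setT (fun t : 0.-tuple T => (\prod_(i < 0) g i (tnth t i))%:E).
    by apply/measurable_EFinP; exact: measurable_prod_tnth.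
  split; last by rewrite (integral_tuple0 m1) !big_ord0.
  apply/integrableP; split => //; rewrite integral_tuple0; last exact: measurableT_comp.
  by rewrite /= big_ord0 ltry.
have [inth inth2] := IH (fun i => g (lift ord0 i)) (fun i => ig _).
pose h (t : n.-tuple T) := \prod_(i < n) g (lift ord0 i) (tnth t i).
have gE a t : \prod_i g i (tnth (tuple_cons (a, t)) i) = g ord0 a * h t.
  by rewrite big_ord_recl tnth0; congr (_ * _); apply: eq_bigr => i _; rewrite tnthS.
have := @integrable_tupleS n (fun t => (\prod_i g i (tnth t i))%:E).
case.
- by apply/measurable_EFinP; exact: measurable_prod_tnth.
- apply/integrable12ltyP.
    apply/measurable_EFinP; apply: (measurableT_comp
      (f := fun t : n.+1.-tuple T => \prod_i g i (tnth t i))).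
      exact: measurable_prod_tnth.
    exact: measurable_tuple_cons.
  under eq_integral => a _.
    under eq_integral do rewrite gE EFinM abseM.
    rewrite ge0_integralZl//; last by apply: measurableT_comp => //; exact: measurable_int inth.
    over.
  rewrite /= ge0_integralZr//; last 2 first.
    - by apply/measurable_EFinP; apply: measurableT_comp => //; exact: mg.
    - exact: integral_ge0.
  apply: lte_mul_pinfty.
  + exact: integral_ge0.
  + have /integrableP[_] := ig ord0; rewrite ge0_fin_numE//; exact: integral_ge0.
  + by have /integrableP[] := inth.
- move=> H1 H2; split => //; rewrite H2.
  under eq_integral => a _.
    under eq_integral do rewrite gE EFinM.
    rewrite integralZl// inth2 -EFinM mulrC EFinM.
    over.
  rewrite integralZl//; last exact: ig.
  by rewrite big_ord_recl mulrC EFinM; congr (_ * _)%E; rewrite /Rintegral fineK//; exact: (integrable_fin_num _ (ig ord0)).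
Qed.
End TupleMeasure.

(** * Polar coordinates *)

Section Polar.
Context {R : realType} (m : nat).
Local Notation T := (measurableTypeR R).
Local Notation mu := (@lebesgue_measure R).
Local Notation nu := (@tuple_measure R m).
Implicit Types (t : m.-tuple T) (f : m.-tuple T -> R).

Definition tnorm t : R := enorm (Defs.point t).

Lemma tnorm_ge0 t : 0 <= tnorm t. Proof. exact: sqrtr_ge0. Qed.

Lemma measurable_tnorm : measurable_fun setT tnorm.
Proof. exact: measurable_enorm. Qed.

Lemma tnorm_scale r t : 0 <= r -> tnorm (tuple_scale r t) = r * tnorm t.
Proof.
move=> r0; rewrite /tnorm /enorm /dotp.
rewrite (_ : \sum_j _ = r ^+ 2 * \sum_j Defs.point t 0 j * Defs.point t 0 j).
  by rewrite sqrtrM ?sqr_ge0// sqrtr_sqr ger0_norm.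
by rewrite mulr_sumr; apply: eq_bigr => j _; rewrite !mxE tnth_mktuple; ring.
Qed.

(** Positive scalars only, so that the positive and negative parts of a homogeneous function are
    again homogeneous. *)
Definition homogeneous (d : nat) f :=
  forall r t, 0 < r -> f (tuple_scale r t) = r ^+ d * f t.

Definition ball_integral f : \bar R :=
  (\int[nu]_(t in @punctured_ball R m) (f t)%:E)%E.

Lemma measurable_tnorm_itv (rho : R) : measurable [set t | 0 < tnorm t <= rho].
Proof.
rewrite (_ : mkset _ = setT `&` tnorm @^-1` `]0, rho]).
  exact: (measurable_tnorm measurableT (measurable_itv _)).
by rewrite setTI; apply/seteqP; split => t /=; rewrite in_itv.
Qed.

Lemma integral_ball_radius d f (rho : R) :
  measurable_fun setT f -> (forall t, 0 <= f t) -> homogeneous d f -> 0 < rho ->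
  (\int[nu]_(t in [set t | 0 < tnorm t <= rho]%R) (f t)%:E =
   (rho ^+ (m + d))%:E * ball_integral f)%E.
Proof.
move=> mf f0 hf r0; rewrite integral_mkcond (@ge0_integral_tuple_scale _ _ rho)//.
- rewrite exprD EFinM -muleA; congr (_ * _)%E.
  rewrite /ball_integral -ge0_integralZl_EFin//.
  + rewrite [RHS]integral_mkcond; apply: eq_integral => t _.
    have E : (tuple_scale rho t \in [set t | 0 < tnorm t <= rho]) = (t \in @punctured_ball R m).
      have E0 : (0 < tnorm (tuple_scale rho t) <= rho) = (0 < tnorm t <= 1).
        by rewrite (tnorm_scale _ (ltW r0)) pmulr_rgt0// ger_pMr.
      by apply/idP/idP => /set_mem H; apply/mem_set; move: H; rewrite /mkset E0.
    by rewrite [LHS]patchE [RHS]patchE E hf// EFinM.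
  + exact: measurable_punctured_ball.
  + by move=> t _; rewrite lee_fin.
  + by apply/measurable_EFinP; exact: measurable_funTS.
  + by rewrite exprn_ge0// ltW.
- apply/(measurable_restrictT (EFin \o f)); first exact: measurable_tnorm_itv.
  by apply/measurable_EFinP; exact: measurable_funTS.
- by move=> t; rewrite patchE; case: ifPn; rewrite ?lee_fin.
Qed.

(** The s-integral on the left is a radial weight, a superposition of indicators of balls of radius
    [rho s]. Exchanging the integrals leaves the integral of f over each ball, which scales as the
    power m + d of the radius. *)
Lemma polar_layer d f (D : set T) (v rho : R -> R) :
  measurable_fun setT f -> (forall t, 0 <= f t) -> homogeneous d f ->
  measurable D -> measurable_fun setT v -> measurable_fun setT rho ->
  (forall s, D s -> 0 <= v s) -> (forall s, D s -> 0 < rho s) ->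
  (\int[nu]_(t in [set t | 0 < tnorm t]%R)
     ((f t)%:E * \int[mu]_(s in [set s | D s /\ (tnorm t <= rho s)%R]) (v s)%:E) =
   (\int[mu]_(s in D) (v s * rho s ^+ (m + d))%:E) * ball_integral f)%E.
Proof.
move=> mf f0 hf mD mv mrho v0 rho0.
pose E : set (m.-tuple T * T) :=
  ([set p | 0 < tnorm p.1] `&` (snd @^-1` D)) `&` [set p | tnorm p.1 <= rho p.2].
have mN : measurable_fun setT (fun p : m.-tuple T * T => tnorm p.1).
  by apply: (measurableT_comp measurable_tnorm); exact: measurable_fst.
have mE : measurable E.
  apply: measurableI; first apply: measurableI.
  - rewrite -[X in measurable X]setTI.
    by apply: measurable_fun_ltr => //; exact: measurable_cst.
  - by rewrite -[X in measurable X]setTI; exact: measurable_snd.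
  - rewrite -[X in measurable X]setTI; apply: measurable_fun_ler => //.
    by apply: (measurableT_comp mrho); exact: measurable_snd.
have := @tonelli_region _ _ _ _ R nu mu E (fun p => f p.1 * v p.2) mE.
rewrite /E /= => TR.
transitivity (\int[nu]_t \int[mu]_(s in [set s | ((0 < tnorm t)%R /\ D s) /\ (tnorm t <= rho s)%R])
  (f t * v s)%:E)%E.
  rewrite integral_mkcond; apply: eq_integral => t _; rewrite patchE.
  have mDt : measurable [set s | D s /\ (tnorm t <= rho s)%R].
    rewrite (_ : mkset _ = D `&` [set s | (tnorm t <= rho s)%R])//.
    apply: measurableI => //; rewrite -[X in measurable X]setTI.
    by apply: measurable_fun_ler => //; exact: measurable_cst.
  case: ifPn => [/set_mem/= t0|/negP t0].
    rewrite -ge0_integralZl_EFin//=.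
    - by congr (integral _ _ _); apply/seteqP; split => s /= => [[? ?]|[[_ ?] ?]].
    - by move=> s [Ds _]; rewrite lee_fin; exact: v0.
    - by apply/measurable_EFinP; exact: measurable_funTS.
  rewrite (_ : mkset _ = set0) ?integral_set0//.
  by apply/seteqP; split => s //= [[t1 _] _]; case: t0; exact/mem_set.
rewrite TR; last 2 first.
- by apply: measurable_funM; [exact: (measurableT_comp mf)|exact: (measurableT_comp mv)].
- by move=> p [[_ Dp] _]; rewrite mulr_ge0// v0.
rewrite -ge0_integralZr//.
- rewrite [RHS]integral_mkcond; apply: eq_integral => s _; rewrite patchE.
  case: ifPn => [/set_mem Ds|nD].
    rewrite EFinM -muleA -integral_ball_radius ?rho0// -ge0_integralZl_EFin ?v0//.
    + rewrite (_ : mkset _ = [set t | 0 < tnorm t <= rho s]).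
        by apply: eq_integral => t _; rewrite mulrC EFinM.
      by apply/seteqP; split => t /=; [move=> [[-> _] ->]|move=> /andP[-> ->]].
    + exact: measurable_tnorm_itv.
    + by move=> t _; rewrite lee_fin.
    + by apply/measurable_EFinP; exact: measurable_funTS.
  rewrite (_ : mkset _ = set0) ?integral_set0//.
  by apply/seteqP; split => t //= [[_ /mem_set]]; rewrite (negbTE nD).
- apply/measurable_EFinP/measurable_funTS; apply: measurable_funM => //.
  exact: measurable_funX.
- by move=> s Ds; rewrite lee_fin mulr_ge0 ?v0// exprn_ge0// ltW// rho0.
- by apply: integral_ge0 => t _; rewrite lee_fin.
Qed.

Lemma polar_gauss d f :
  measurable_fun setT f -> (forall t, 0 <= f t) -> homogeneous d f ->
  (\int[nu]_(t in [set t | 0 < tnorm t]%R) (f t * expR (- tnorm t ^+ 2))%:E =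
   eGamma ((m + d)%:R / 2 + 1) * ball_integral f)%E.
Proof.
move=> mf f0 hf.
(* exp(-|t|^2) is the integral of exp(-s) over s >= |t|^2, a superposition of balls of radius sqrt
   s. The power (m + d) / 2 of s then yields the Gamma integral at (m + d) / 2 + 1. *)
transitivity (\int[nu]_(t in [set t | 0 < tnorm t]%R)
   ((f t)%:E * \int[mu]_(s in [set s : R | `]0%R, +oo[%classic s /\ (tnorm t <= Num.sqrt s)%R])
      (expR (- s))%:E))%E.
  apply: eq_integral => t; rewrite inE/= => t0; rewrite EFinM -integral_exp_tail.
  congr (_ * integral _ _ _)%E; apply/seteqP; split => s /=.
    rewrite !in_itv/= !andbT => ts.
    have s0 : 0 < s by apply: lt_le_trans ts; rewrite exprn_gt0.
    by split=> //; rewrite -(ger0_norm (ltW t0)) -sqrtr_sqr ler_wsqrtr.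
  rewrite !in_itv/= !andbT => -[s0 ts].
  rewrite -(sqr_sqrtr (ltW s0)) ler_pXn2r// nnegrE; [exact: ltW|exact: sqrtr_ge0].
rewrite (@polar_layer d)//.
- congr (_ * _)%E; apply: eq_integral => s; rewrite inE/= in_itv/= andbT => s0.
  rewrite addrK mulrC; congr (_ * _)%:E.
  by rewrite mulrC powRrM powR12_sqrt ?ltW// powR_mulrn ?sqrtr_ge0.
- exact: measurable_expRN.
- by apply: continuous_measurable_fun; exact: sqrt_continuous.
- by move=> s /=; rewrite in_itv/= andbT sqrtr_gt0.
Qed.

Lemma integral_inverse_power d (r : R) : 0 < r <= 1 ->
  (\int[mu]_(s in [set s : R | `]0%R, 1%R]%classic s /\ (r <= s)%R])
     (d%:R * s `^ (- d%:R - 1))%:E = (r ^- d - 1)%:E)%E.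
Proof.
move=> /andP[r0 r1]; rewrite (_ : mkset _ = `[r, 1]%classic); last first.
  apply/seteqP; split => s /=; rewrite !in_itv/=; first by move=> [/andP[_ ->] ->].
  by move=> /andP[rs ->]; rewrite (lt_le_trans r0 rs).
move: r1; rewrite le_eqVlt => /predU1P[->|r1].
  by rewrite set_itv1 integral_set1 expr1n invr1 subrr.
have cp p u : 0 < u -> {for u, continuous (fun u : R => u `^ p)}.
  move=> u0; apply: differentiable_continuous; apply/derivable1_diffP.
  by apply: derivable_powR; rewrite in_itv/= u0.
rewrite (@continuous_FTC2 _ _ (fun u => - u `^ (- d%:R)))//.
- by rewrite -EFinB powR1 opprK addrC -[r `^ _]invrK -powRN opprK powR_mulrn// ltW.
- apply: continuous_in_subspaceT => u /set_mem /=; rewrite in_itv/= => /andP[ru _].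
  have H := @continuousM _ _ (fun=> d%:R) (fun u : R => u `^ (- d%:R - 1)) u.
  by apply: H; [exact: cvg_cst|apply: cp; exact: lt_le_trans ru].
- have dF u : 0 < u -> derivable (fun u : R => - u `^ (- d%:R)) u 1.
    by move=> u0; apply: derivableN; apply: derivable_powR; rewrite in_itv/= u0.
  have cF u : 0 < u -> {for u, continuous (fun u : R => - u `^ (- d%:R))}.
    by move=> u0; apply: differentiable_continuous; apply/derivable1_diffP; exact: dF.
  split.
  + by move=> u; rewrite in_itv/= => /andP[ru _]; apply: dF; exact: lt_trans ru.
  + exact/cvg_at_right_filter/cF.
  + exact/cvg_at_left_filter/cF.
- move=> u; rewrite in_itv/= => /andP[ru _]; have u0 := lt_trans r0 ru.
  rewrite derive1E deriveN; last by apply: derivable_powR; rewrite in_itv/= u0.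
  rewrite -derive1E powR_derive1; last by rewrite in_itv/= u0.
  by rewrite mulNr opprK.
Qed.

Lemma tuple_scale_direction t : direction t = tuple_scale (tnorm t)^-1 t.
Proof. by apply: eq_from_tnth => i; rewrite !tnth_mktuple mulrC. Qed.

(* On the ball, [f \o direction] is [f] over the [d]-th power of the norm, and
   |t|^(-d) = 1 + \int_|t|^1 d s^(-d-1) ds. *)
Lemma ball_integral_direction d f : (0 < m)%N ->
  measurable_fun setT f -> (forall t, 0 <= f t) -> homogeneous d f ->
  ball_integral (f \o @direction R m) = (((m + d)%:R / m%:R)%:E * ball_integral f)%E.
Proof.
move=> m0 mf f0 hf.
have mP : measurable (@punctured_ball R m) by exact: measurable_punctured_ball.
have mfP : measurable_fun (@punctured_ball R m) (EFin \o f).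
  by apply/measurable_EFinP; exact: measurable_funTS.
have mS : measurable [set t | 0 < tnorm t].
  rewrite (_ : mkset _ = setT `&` tnorm @^-1` `]0, +oo[).
    exact: (measurable_tnorm measurableT (measurable_itv _)).
  by rewrite setTI; apply/seteqP; split => t /=; rewrite in_itv/= andbT.
have PS : @punctured_ball R m `<=` [set t | 0 < tnorm t] by move=> t /andP[].
pose v (s : R) := d%:R * s `^ (- d%:R - 1).
have mv : measurable_fun setT v by apply: measurable_funM => //; exact: measurable_powR.
pose h t := (f t * (tnorm t `^ (- d%:R) - 1)).
have mh : measurable_fun setT h.
  apply: measurable_funM => //; apply: measurable_funB => //.
  apply: (measurableT_comp (f := (@powR R ^~ (- d%:R)))).
    exact: measurable_powR.
  exact: measurable_tnorm.
have h0 t : punctured_ball t -> 0 <= h t.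
  move=> /andP[t0 t1]; rewrite mulr_ge0// subr_ge0 powRN powR_mulrn ?tnorm_ge0//.
  by rewrite invf_ge1 ?exprn_gt0// exprn_ile1 ?tnorm_ge0.
transitivity (\int[nu]_(t in @punctured_ball R m) ((f t)%:E + (h t)%:E))%E.
  apply: eq_integral => t /set_mem /andP[t0 t1].
  rewrite -EFinD /h mulrBr mulr1 addrC subrK /= tuple_scale_direction hf ?invr_gt0//.
  by rewrite mulrC exprVn powRN powR_mulrn ?tnorm_ge0.
rewrite ge0_integralD//; last 2 first.
- by move=> t _; rewrite lee_fin.
- by apply/measurable_EFinP; exact: measurable_funTS.
(* By [polar_layer] the correction [h] contributes d times the integral of s^(m-1) over ]0, 1], that
   is d / m. *)
rewrite (_ : \int[nu]_(t in _) (h t)%:E = (d%:R / m%:R)%:E * ball_integral f)%E.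
  rewrite -/(ball_integral f) -[X in (X + _)%E]mul1e -ge0_muleDl//.
  by rewrite -EFinD natrD mulrDl divff// pnatr_eq0 -lt0n.
transitivity (\int[nu]_(t in [set t | 0 < tnorm t]%R)
   ((f t)%:E * \int[mu]_(s in [set s : R | `]0%R, 1%R]%classic s /\ (tnorm t <= s)%R]) (v s)%:E))%E.
  rewrite integral_mkcond [RHS]integral_mkcond; apply: eq_integral => t _.
  rewrite [LHS]patchE [RHS]patchE; case: ifPn => [tP|/negP tP].
    rewrite mem_set; last by apply: PS; exact: set_mem.
    move/set_mem : tP => tP; rewrite integral_inverse_power//.
    by rewrite -EFinM /h powRN powR_mulrn ?tnorm_ge0.
  case: ifPn => // /set_mem/= t0.
  rewrite (_ : mkset _ = set0) ?integral_set0 ?mule0//.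
  apply/seteqP; split => s //= [+ ts]; rewrite in_itv/= => /andP[_ s1].
  by apply: tP; apply/mem_set; rewrite /punctured_ball/= -/(tnorm t) t0 (le_trans ts).
rewrite (@polar_layer d)//; last 2 first.
- by move=> s _; rewrite mulr_ge0 ?powR_ge0.
- by move=> s /=; rewrite in_itv/= => /andP[].
congr (_ * _)%E.
have m0' : 0 < m%:R :> R by rewrite ltr0n.
transitivity (\int[mu]_(s in `]0%R, 1%R]) ((d%:R / m%:R)%:E * (m%:R * s `^ (m%:R - 1))%:E))%E.
  apply: eq_integral => s; rewrite inE/= in_itv/= => /andP[s0 s1].
  rewrite -EFinM /v; congr EFin.
  rewrite mulrA divfK ?gt_eqF// -mulrA; congr (_ * _).
  rewrite -powR_mulrn ?ltW// -powRD; last first.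
    by apply/implyP => _; rewrite gt_eqF.
  by congr (_ `^ _); rewrite natrD; ring.
rewrite ge0_integralZl_EFin//=.
- by rewrite integral_powR// powR1 mule1.
- by move=> s _; rewrite lee_fin mulr_ge0 ?powR_ge0.
- apply/measurable_EFinP/measurable_funTS; apply: measurable_funM => //.
Qed.

Lemma ge0_integral_sphere f :
  measurable_fun setT f -> (forall t, 0 <= f t) ->
  (\int[@sphere_measure R m]_(t in @unit_sphere R m) (f t)%:E =
   m%:R%:E * ball_integral (f \o @direction R m))%E.
Proof.
move=> mf f0.
have mS : measurable (@unit_sphere R m).
  rewrite (_ : @unit_sphere R m = setT `&` tnorm @^-1` [set 1]).
    exact: (measurable_tnorm measurableT (measurable_set1 _)).
  by rewrite setTI; apply/seteqP; split => t /=.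
have mP : measurable (@punctured_ball R m) by exact: measurable_punctured_ball.
have PS t : punctured_ball t -> unit_sphere (direction t).
  move=> /andP[t0 t1]; rewrite /unit_sphere/= -/(tnorm _) tuple_scale_direction.
  by rewrite tnorm_scale ?invr_ge0 ?ltW// mulVf// gt_eqF.
pose rnu := mrestr nu mP.
pose prnu := measure_function_pushforward__canonical__measure_function_Measure
  rnu (@measurable_direction R m).
rewrite (eq_measure_integral (mscale (NngNum (ler0n R m)) prnu)); last first.
  by move=> A mA _; rewrite /= sphere_measureE.
rewrite ge0_integral_mscale//; last 2 first.
- by apply/measurable_EFinP; exact: measurable_funTS.
- by move=> t _; rewrite lee_fin.
have mD : measurable (@direction R m @^-1` @unit_sphere R m).
  by rewrite -[X in measurable X]setTI; exact: (@measurable_direction R m measurableT).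
have mfd : measurable_fun setT (fun t => (f (direction t))%:E).
  by apply/measurable_EFinP; exact: (measurableT_comp mf (@measurable_direction R m)).
congr (_ * _)%E; rewrite ge0_integral_pushforward//=; first last.
- by move=> t _; rewrite lee_fin.
- by apply/measurable_EFinP; exact: measurable_funTS.
- exact: measurable_direction.
(* The restricted measure does not charge the complement of the ball, and every point of the ball
   has its direction on the sphere. *)
rewrite (@ge0_negligible_integral _ _ _ _ _ (~` @punctured_ball R m))//=; last 4 first.
- exact: measurableC.
- exact: measurable_funTS.
- by move=> t _; rewrite lee_fin.
- by rewrite /rnu /mrestr setICl measure0.
rewrite (_ : _ `\` _ = @punctured_ball R m); last first.
  by rewrite setDE setCK; apply/seteqP; split => t [] // *; split => //; apply: PS.
rewrite (eq_measure_integral nu)// => A mA AP.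
by rewrite /= /rnu /mrestr setIidl.
Qed.

Hypothesis m0 : (0 < m)%N.

Lemma tuple_measure_origin : nu [set t | tnorm t = 0] = 0%E.
Proof.
apply/eqP; rewrite eq_le measure_ge0 andbT.
rewrite -[leRHS](_ : lebesgue_tuple R m [set t | forall i, [set 0%R] (tnth t i)] = 0%E).
  rewrite (_ : [set t | tnorm t = 0] = [set t | forall i, [set 0%R] (tnth t i)])//.
  apply/seteqP; split => t /=.
    move=> /eqP; rewrite sqrtr_eq0 => dp i.
    have : dotp (Defs.point t) (Defs.point t) == 0.
      by rewrite eq_le dp sumr_ge0// => j _; rewrite -expr2 sqr_ge0.
    rewrite psumr_eq0; last by move=> j _; rewrite -expr2 sqr_ge0.
    by move=> /allP/(_ i); rewrite mem_index_enum mxE mulf_eq0 orbb => /(_ isT)/eqP.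
  move=> t0; rewrite /tnorm /enorm /dotp big1 ?sqrtr0// => i _.
  by rewrite mxE t0 mul0r.
rewrite (@lebesgue_tuple_box R m (fun=> [set 0%R])).
  case: m m0 => // k _; rewrite big_ord_recl lebesgue_measure_set1 mul0e//.
by move=> i; exact: measurable_set1.
Qed.

Definition gauss_integral f : \bar R :=
  (\int[nu]_t (f t * expR (- tnorm t ^+ 2))%:E)%E.

Lemma measurable_gauss_weight f : measurable_fun setT f ->
  measurable_fun setT (fun t => f t * expR (- tnorm t ^+ 2)).
Proof.
move=> mf; apply: measurable_funM => //.
by apply: (measurableT_comp measurable_gauss_fun); exact: measurable_tnorm.
Qed.

Lemma ge0_gauss_integral_sphere d f :
  measurable_fun setT f -> (forall t, 0 <= f t) -> homogeneous d f ->
  (gauss_integral f = eGamma ((m + d)%:R / 2) * (2^-1%:E *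
     \int[@sphere_measure R m]_(t in @unit_sphere R m) (f t)%:E))%E.
Proof.
move=> mf f0 hf.
have mN0 : measurable [set t | tnorm t = 0].
  rewrite (_ : mkset _ = setT `&` tnorm @^-1` [set 0]).
    exact: (measurable_tnorm measurableT (measurable_set1 _)).
  by rewrite setTI; apply/seteqP; split.
rewrite /gauss_integral (@ge0_negligible_integral _ _ _ _ _ [set t | tnorm t = 0])//; last 3 first.
- by apply/measurable_EFinP; exact: measurable_gauss_weight.
- by move=> t _; rewrite lee_fin mulr_ge0 ?expR_ge0.
- exact: tuple_measure_origin.
rewrite setTD (_ : ~` _ = [set t | 0 < tnorm t]); last first.
  by apply/seteqP; split => t /=; rewrite lt_neqAle tnorm_ge0 andbT eq_sym => /eqP.
rewrite (@polar_gauss d)// ge0_integral_sphere// (@ball_integral_direction d)//.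
have md0 : 0 < (m + d)%:R :> R by rewrite ltr0n addn_gt0 m0.
(* With n = m + d, the sphere integral is n times the ball integral and Gamma (n/2 + 1) = (n/2)
   Gamma (n/2); the factors n cancel and 1/2 remains. *)
rewrite eGammaD1 ?divr_gt0// -muleA muleCA; congr (_ * _)%E.
rewrite !muleA -!EFinM; congr (_%:E * _)%E.
by field; rewrite pnatr_eq0 -lt0n.
Qed.

End Polar.

Lemma tnorm_sqr (R : realType) m (t : m.-tuple (measurableTypeR R)) :
  tnorm t ^+ 2 = \sum_i tnth t i ^+ 2.
Proof.
rewrite /tnorm /enorm sqr_sqrtr; last by apply: sumr_ge0 => i _; rewrite -expr2 sqr_ge0.
by apply: eq_bigr => i _; rewrite !mxE expr2.
Qed.

Lemma gauss_weight_prod (R : realType) m (t : m.-tuple (measurableTypeR R)) :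
  expR (- tnorm t ^+ 2) = \prod_i expR (- tnth t i ^+ 2).
Proof. by rewrite tnorm_sqr -sumrN expR_sum. Qed.

Definition monomial (R : realType) m (a : 'I_m -> nat) (x : 'rV[R]_m) : R :=
  \prod_i x 0 i ^+ a i.

Lemma gauss_integral_monomial (R : realType) m (a : 'I_m -> nat) :
  (@tuple_measure R m).-integrable setT
    (fun t => (monomial a (Defs.point t) * expR (- tnorm t ^+ 2))%:E) /\
  gauss_integral (fun t => monomial a (Defs.point t)) =
    (\prod_i @gauss_moment R (a i))%:E.
Proof.
have := @integral_tuple_prod R m (fun i x => x ^+ a i * expR (- x ^+ 2)).
case=> [i|]; first exact: gauss_moment_integrable.
have E t : \prod_i (tnth t i ^+ a i * expR (- tnth t i ^+ 2)) =
    monomial a (Defs.point t) * expR (- tnorm t ^+ 2).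
  rewrite big_split /= gauss_weight_prod; congr (_ * _).
  by apply: eq_bigr => i _; rewrite mxE.
move=> H1 H2; split.
  by apply: eq_integrable H1 => // t _; rewrite E.
by rewrite /gauss_integral -H2; apply: eq_integral => t _; rewrite E.
Qed.

Lemma gauss_integral1 (R : realType) m :
  @gauss_integral R m (fun=> 1) = (Num.sqrt pi ^+ m)%:E.
Proof.
have [_] := @gauss_integral_monomial R m (fun=> 0%N).
rewrite (eq_bigr (fun=> Num.sqrt pi)); last by move=> i _; exact: gauss_moment0.
rewrite prodr_const card_ord => <-; apply: eq_integral => t _.
by rewrite /monomial big1// => i _; rewrite expr0.
Qed.

(* The Gaussian integral of 1 is finite and positive, which forces both factors
   of its polar form to be so. *)
Lemma eGamma_half (R : realType) m : (0 < m)%N ->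
  eGamma (m%:R / 2 : R) \is a fin_num /\ (0 < eGamma (m%:R / 2 : R))%E.
Proof.
move=> m0; have := @ge0_gauss_integral_sphere R m m0 0 (fun=> 1).
rewrite addn0 gauss_integral1 => H.
have {H} := H (measurable_cst _) (fun=> ler01) (fun r t _ => esym (mul1r _)).
set I := (_ * \int[_]_(_ in _) _)%E.
have I0 : (0 <= I)%E.
  by rewrite mule_ge0 ?lee_fin ?invr_ge0//; apply: integral_ge0 => t _; rewrite lee_fin.
have : (0 <= eGamma (m%:R / 2 : R))%E by exact: eGamma_ge0.
have spi : 0 < Num.sqrt (pi : R) ^+ m by rewrite exprn_gt0// sqrtr_gt0 pi_gt0.
case: (eGamma _) => [g||] //.
  rewrite lee_fin le_eqVlt => /predU1P[<-|g0 _]; last by rewrite lte_fin.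
  by rewrite mul0e => -[s0]; rewrite -s0 ltxx in spi.
move=> _; move: I0; rewrite le_eqVlt => /predU1P[<-|I0].
  by rewrite mule0 => -[s0]; rewrite -s0 ltxx in spi.
by rewrite gt0_mulye.
Qed.

Lemma Gamma_half_gt0 (R : realType) m : (0 < m)%N -> 0 < Gamma (m%:R / 2 : R).
Proof.
by move=> /(eGamma_half R)[f0 g0]; rewrite GammaE -lte_fin fineK.
Qed.

Lemma GammaD1 (R : realType) (s : R) : 0 < s -> Gamma (s + 1) = s * Gamma s.
Proof.
move=> s0; rewrite !GammaE eGammaD1//.
(* If the integral is infinite, both sides are 0, the value of [fine] at infinity. *)
have := eGamma_ge0 s; case: (eGamma s) => [g||]//= _.
by rewrite gt0_muley//= mulr0.
Qed.

(** * Polar coordinates for integrands of variable sign *)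

Section SignedPolar.
Context {R : realType} (m : nat).
Hypothesis m0 : (0 < m)%N.
Local Notation nu := (@tuple_measure R m).
Implicit Types f : m.-tuple (measurableTypeR R) -> R.

Lemma gauss_integral_sphere d f :
  measurable_fun setT f -> homogeneous d f ->
  nu.-integrable setT (fun t => (f t * expR (- tnorm t ^+ 2))%:E) ->
  fine (gauss_integral f) = Gamma ((m + d)%:R / 2) / 2 *
    \int[@sphere_measure R m]_(t in @unit_sphere R m) f t.
Proof.
move=> mf hf intf.
have [Gf G0] : eGamma ((m + d)%:R / 2 : R) \is a fin_num /\
    (0 < eGamma ((m + d)%:R / 2 : R))%E.
  by apply: eGamma_half; rewrite addn_gt0 m0.
(* Both parts are nonnegative and homogeneous of degree d, so the extended-real formula applies to
   each. *)
pose fp t := Num.max (f t) 0; pose fn t := Num.max (- f t) 0.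
have mp : measurable_fun setT fp by exact: measurable_maxr.
have mn : measurable_fun setT fn.
  by apply: measurable_maxr => //; exact: measurable_funN.
have p0 t : 0 <= fp t by rewrite le_max lexx orbT.
have n0 t : 0 <= fn t by rewrite le_max lexx orbT.
have hp : homogeneous d fp.
  by move=> r t r0; rewrite /fp hf// maxr_pMr ?mulr0// exprn_ge0// ltW.
have hn : homogeneous d fn.
  by move=> r t r0; rewrite /fn hf// -mulrN maxr_pMr ?mulr0// exprn_ge0// ltW.
have Ip := ge0_gauss_integral_sphere m0 mp p0 hp.
have In := ge0_gauss_integral_sphere m0 mn n0 hn.
have e0 t : 0 <= expR (- @tnorm R m t ^+ 2) by exact: expR_ge0.
have Ep t : (fun t => (f t * expR (- tnorm t ^+ 2))%:E)^\+%E t =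
    (fp t * expR (- tnorm t ^+ 2))%:E.
  by rewrite funeposE /fp maxr_pMl// mul0r -EFin_max.
have En t : (fun t => (f t * expR (- tnorm t ^+ 2))%:E)^\-%E t =
    (fn t * expR (- tnorm t ^+ 2))%:E.
  by rewrite funenegE /fn maxr_pMl// mul0r -EFinN mulNr -EFin_max.
have Fp : gauss_integral fp \is a fin_num.
  rewrite ge0_fin_numE; last by apply: integral_ge0 => t _; rewrite lee_fin mulr_ge0.
  rewrite /gauss_integral; under eq_integral do rewrite -Ep.
  exact: integral_funepos_lt_pinfty intf.
have Fn : gauss_integral fn \is a fin_num.
  rewrite ge0_fin_numE; last by apply: integral_ge0 => t _; rewrite lee_fin mulr_ge0.
  rewrite /gauss_integral; under eq_integral do rewrite -En.
  exact: integral_funeneg_lt_pinfty intf.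
(* The Gamma factor is positive, so an infinite sphere integral would make the Gaussian integral
   infinite. Finiteness is what allows the two parts to be subtracted. *)
have finS h (I := (\int[@sphere_measure R m]_(t in @unit_sphere R m) (h t)%:E)%E) :
    (forall t, 0 <= h t) ->
    gauss_integral h = (eGamma ((m + d)%:R / 2) * (2^-1%:E * I))%E ->
    gauss_integral h \is a fin_num -> I \is a fin_num.
  move=> h0 ->; have : (0 <= I)%E by apply: integral_ge0 => t _; rewrite lee_fin.
  by case: I => //= _; rewrite !gt0_muley.
have Sp := finS _ p0 Ip Fp; have Sn := finS _ n0 In Fn.
rewrite /gauss_integral integralE.
under eq_integral do rewrite Ep.
under [X in (_ - X)%E]eq_integral do rewrite En.
rewrite /Rintegral [in RHS]integralE.
rewrite [X in _ = _ * fine (X - _)%E](_ : _ = \int[@sphere_measure R m]_(t in @unit_sphere R m) (fp t)%:E)%E; last first.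
  by apply: eq_integral => t _; rewrite funeposE -EFin_max.
rewrite [X in _ = _ * fine (_ - X)%E](_ : _ = \int[@sphere_measure R m]_(t in @unit_sphere R m) (fn t)%:E)%E; last first.
  by apply: eq_integral => t _; rewrite funenegE -EFinN -EFin_max.
transitivity (fine (gauss_integral fp - gauss_integral fn)%E); first by [].
rewrite (fineB Fp Fn) (fineB Sp Sn) Ip In.
by rewrite !fineM ?fin_numM//= -!GammaE; ring.
Qed.

End SignedPolar.

(** * Gaussian integrals of polynomials *)

Section PolynomialFunctions.
Context {R : realType} (m : nat).
Local Notation rv := 'rV[R]_m.
Local Notation nu := (@tuple_measure R m).

(** Polynomials as plain functions, on which [derive] and the integrals act directly; analytic
    properties follow by induction on the construction. *)
Inductive polyfun : (rv -> R) -> Prop :=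
| polyfun_cst c : polyfun (fun=> c)
| polyfun_coord j : polyfun (fun x => x 0 j)
| polyfunD f g : polyfun f -> polyfun g -> polyfun (fun x => f x + g x)
| polyfunM f g : polyfun f -> polyfun g -> polyfun (fun x => f x * g x).

Lemma polyfunN f : polyfun f -> polyfun (fun x => - f x).
Proof.
move=> pf; rewrite (_ : (fun x => - f x) = fun x => -1 * f x).
  by apply: polyfunM => //; exact: polyfun_cst.
by apply/funext => x; rewrite mulN1r.
Qed.

Lemma polyfunX f n : polyfun f -> polyfun (fun x => f x ^+ n).
Proof.
move=> pf; elim: n => [|n IH]; first exact: polyfun_cst.
under eq_fun do rewrite exprS.
exact: polyfunM.
Qed.

Lemma polyfun_sum I (r : seq I) (P : pred I) (F : I -> rv -> R) :
  (forall i, P i -> polyfun (F i)) -> polyfun (fun x => \sum_(i <- r | P i) F i x).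
Proof.
move=> pF; elim: r => [|i r IH].
  under eq_fun do rewrite big_nil.
  exact: polyfun_cst.
under eq_fun do rewrite big_cons.
case Pi: (P i) => //.
by apply: polyfunD => //; exact: pF.
Qed.

Lemma polyfun_prod I (r : seq I) (P : pred I) (F : I -> rv -> R) :
  (forall i, P i -> polyfun (F i)) -> polyfun (fun x => \prod_(i <- r | P i) F i x).
Proof.
move=> pF; elim: r => [|i r IH].
  under eq_fun do rewrite big_nil.
  exact: polyfun_cst.
under eq_fun do rewrite big_cons.
case Pi: (P i) => //.
by apply: polyfunM => //; exact: pF.
Qed.

Lemma is_derive_coord (x v : rv) j : is_derive x v (fun z : rv => z 0 j) (v 0 j).
Proof.
have @f : {linear rv -> R}.
  by exists (fun z : rv => z 0 j); do 2![eexists]; do ?[constructor];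
     rewrite ?mxE// => ? *; rewrite ?mxE//; move=> ?; rewrite !mxE.
apply: DeriveDef; first by apply: diff_derivable; exact: differentiable_coord.
rewrite deriveE; last exact: differentiable_coord.
by rewrite (_ : (fun _ => _) = f)// diff_lin//; exact: coord_continuous.
Qed.

Lemma polyfun_derivable f x v : polyfun f -> derivable f x v.
Proof.
elim=> {f} [c|j|f g _ df _ dg|f g _ df _ dg].
- exact: derivable_cst.
- by case: (is_derive_coord x v j).
- exact: derivableD.
- exact: derivableM.
Qed.

Lemma derive_polyfunD f g x v : polyfun f -> polyfun g ->
  'D_v (fun z => f z + g z) x = 'D_v f x + 'D_v g x.
Proof. by move=> pf pg; apply: deriveD; exact: polyfun_derivable. Qed.

Lemma derive_polyfunM f g x v : polyfun f -> polyfun g ->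
  'D_v (fun z => f z * g z) x = 'D_v f x * g x + f x * 'D_v g x.
Proof.
move=> pf pg; rewrite (@deriveM _ _ f g); [|exact: polyfun_derivable..].
by rewrite addrC mulrC.
Qed.

Lemma polyfun_derive f v : polyfun f -> polyfun (fun x => 'D_v f x).
Proof.
elim=> {f} [c|j|f g pf pdf pg pdg|f g pf pdf pg pdg].
- under eq_fun do rewrite derive_cst.
  exact: polyfun_cst.
- rewrite (_ : (fun x => _) = fun=> v 0 j); first exact: polyfun_cst.
  by apply/funext => x; case: (is_derive_coord x v j).
- rewrite (_ : (fun x => _) = fun x => 'D_v f x + 'D_v g x); first exact: polyfunD.
  by apply/funext => x; exact: derive_polyfunD.
- rewrite (_ : (fun x => _) = fun x => 'D_v f x * g x + f x * 'D_v g x).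
    by apply: polyfunD; exact: polyfunM.
  by apply/funext => x; exact: derive_polyfunM.
Qed.

(** No theorem on mixed derivatives is involved: for a product, Leibniz's rule gives the same four
    terms in both orders. *)
Lemma polyfun_deriveC f u v x : polyfun f ->
  'D_u (fun z => 'D_v f z) x = 'D_v (fun z => 'D_u f z) x.
Proof.
move=> pf; elim: pf x => {f} [c|j|f g pf IHf pg IHg|f g pf IHf pg IHg] x.
- have E w : 'D_w (fun=> c : R) = cst (0 : R) :> (rv -> R).
    by apply/funext => z; exact: derive_cst.
  by rewrite !E !derive_cst.
- have E w : 'D_w (fun x : rv => x 0 j) = cst (w 0 j).
    by apply/funext => z; case: (is_derive_coord z w j).
  by rewrite !E !derive_cst.
- have E w : 'D_w (fun x => f x + g x) = fun z => 'D_w f z + 'D_w g z.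
    by apply/funext => z; exact: derive_polyfunD.
  by rewrite !E !derive_polyfunD ?IHf ?IHg//; exact: polyfun_derive.
- have E w : 'D_w (fun x => f x * g x) =
      fun z => 'D_w f z * g z + f z * 'D_w g z.
    by apply/funext => z; exact: derive_polyfunM.
  have p1 w := polyfun_derive w pf; have p2 w := polyfun_derive w pg.
  rewrite !E !derive_polyfunD ?derive_polyfunM ?IHf ?IHg//; do ?exact: polyfunM.
  by ring.
Qed.

Lemma polyfun_measurable f : polyfun f ->
  measurable_fun setT (fun t : m.-tuple (measurableTypeR R) => f (Defs.point t)).
Proof.
elim=> {f} [c|j|f g _ cf _ cg|f g _ cf _ cg].
- exact: measurable_cst.
- under eq_fun do rewrite mxE.
  exact: measurable_tnth.
- exact: measurable_funD.
- exact: measurable_funM.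
Qed.

Lemma monomial_polyfun a : polyfun (@monomial R m a).
Proof. by apply: polyfun_prod => i _; apply: polyfunX; exact: polyfun_coord. Qed.

Lemma monomialM a b x : @monomial R m a x * monomial b x =
  monomial (fun i => a i + b i)%N x.
Proof. by rewrite /monomial -big_split; apply: eq_bigr => i _; rewrite exprD. Qed.

(** The bridge to monomials, the only functions whose Gaussian integrals are computed explicitly. *)
Lemma polyfun_span f : polyfun f ->
  exists s : seq (R * ('I_m -> nat)),
    f = fun x => \sum_(u <- s) u.1 * monomial u.2 x.
Proof.
elim=> {f} [c|j|f g _ [s ->] _ [t ->]|f g _ [s ->] _ [t ->]].
- exists [:: (c, fun=> 0%N)]; apply/funext => x.
  by rewrite big_seq1 /monomial big1 ?mulr1// => i _; rewrite expr0.
- exists [:: (1, fun i => (i == j) : nat)]; apply/funext => x.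
  rewrite big_seq1 mul1r /monomial (bigD1 j)//= eqxx expr1 big1 ?mulr1//.
  by move=> i /negbTE ->; rewrite expr0.
- by exists (s ++ t); apply/funext => x; rewrite big_cat.
- exists [seq (u.1 * v.1, (fun i => u.2 i + v.2 i)%N) | u <- s, v <- t].
  apply/funext => x; rewrite big_allpairs_dep /= mulr_suml; apply: eq_bigr => u _.
  by rewrite mulr_sumr; apply: eq_bigr => v _ /=; rewrite -monomialM; ring.
Qed.

Lemma polyfun_gauss_integrable f : polyfun f ->
  nu.-integrable setT (fun t => (f (Defs.point t) * expR (- tnorm t ^+ 2))%:E).
Proof.
move=> /polyfun_span[s ->]; elim: s => [|u s IH].
  apply: eq_integrable (integrable0 _ _) => // t _.
  by rewrite big_nil mul0r.
have [H _] := @gauss_integral_monomial R m u.2.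
have := integrableD measurableT (integrableZl measurableT u.1 H) IH.
apply: eq_integrable => // t _.
by rewrite big_cons -EFinM -EFinD mulrDl mulrA.
Qed.

Definition gint (f : rv -> R) : R := fine (gauss_integral (fun t => f (Defs.point t))).

Lemma gintD f g : polyfun f -> polyfun g ->
  gint (fun x => f x + g x) = gint f + gint g.
Proof.
move=> /polyfun_gauss_integrable If /polyfun_gauss_integrable Ig.
have H := RintegralD measurableT If Ig.
rewrite /gint /gauss_integral -[RHS]H; congr fine.
by apply: eq_integral => t _; rewrite mulrDl.
Qed.

Lemma gintZ c f : polyfun f -> gint (fun x => c * f x) = c * gint f.
Proof.
move=> /polyfun_gauss_integrable If.
have H := RintegralZl c measurableT If.
rewrite /gint /gauss_integral -[RHS]H; congr fine.
by apply: eq_integral => t _; rewrite mulrA.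
Qed.

Lemma gint0 : gint (fun=> 0) = 0.
Proof.
by have := gintZ 0 (polyfun_cst 0); rewrite !mul0r.
Qed.

Lemma gint_sum I (r : seq I) (P : pred I) (F : I -> rv -> R) :
  (forall i, P i -> polyfun (F i)) ->
  gint (fun x => \sum_(i <- r | P i) F i x) = \sum_(i <- r | P i) gint (F i).
Proof.
move=> pF; elim: r => [|i r IH].
  rewrite big_nil -[RHS]gint0; congr gint; apply/funext => x; exact: big_nil.
rewrite big_cons; under [in LHS]eq_fun do rewrite big_cons.
case Pi: (P i) => //; rewrite gintD ?IH//; [exact: pF|exact: polyfun_sum].
Qed.

Lemma derive_sum_polyfun I (r : seq I) (F : I -> rv -> R) v x :
  (forall i, polyfun (F i)) ->
  'D_v (fun x => \sum_(i <- r) F i x) x = \sum_(i <- r) 'D_v (F i) x.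
Proof.
move=> pF; elim: r => [|i r IH].
  rewrite big_nil; under [X in derive X _ _]eq_fun do rewrite big_nil.
  exact: derive_cst.
rewrite big_cons; under [X in derive X _ _]eq_fun do rewrite big_cons.
by rewrite derive_polyfunD ?IH//; exact: polyfun_sum.
Qed.

(** When [a j] is 0 the truncated exponent does no harm, as its coefficient vanishes. *)
Lemma derive_monomial (a : 'I_m -> nat) j x :
  'D_(delta_mx 0 j) (@monomial R m a) x =
  (a j)%:R * monomial (fun i => a i - (i == j))%N x.
Proof.
pose g (z : rv) := \prod_(i | i != j) z 0 i ^+ a i.
have pg : polyfun g.
  by apply: polyfun_prod => i _; apply: polyfunX; exact: polyfun_coord.
have pj n : polyfun (fun z => z 0 j ^+ n) by apply: polyfunX; exact: polyfun_coord.
have dj i z : 'D_(delta_mx 0 j) (fun z : rv => z 0 i) z = (i == j)%:R.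
  case: (is_derive_coord z (delta_mx 0 j) i) => _ ->.
  by rewrite mxE eqxx.
have dX i n z : 'D_(delta_mx 0 j) (fun z : rv => z 0 i ^+ n) z =
    (i == j)%:R * (n%:R * z 0 i ^+ n.-1).
  elim: n => [|n IH]; first by rewrite mul0r mulr0; exact: derive_cst.
  under [X in derive X _ _]eq_fun do rewrite exprS.
  rewrite derive_polyfunM ?IH ?dj//; [|exact: polyfun_coord|].
    by case: n {IH} => [|n]; rewrite ?expr0 ?mul0r /= -?exprS -?natr1; [ring|rewrite exprS; ring].
  by apply: polyfunX; exact: polyfun_coord.
have dg z : 'D_(delta_mx 0 j) g z = 0.
  rewrite /g; elim: (index_enum _) => [|i r IH].
    under [X in derive X _ _]eq_fun do rewrite big_nil.
    exact: derive_cst.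
  under [X in derive X _ _]eq_fun do rewrite big_cons.
  case ij: (i != j) => //.
  rewrite derive_polyfunM ?IH ?dX ?(negbTE ij) ?mul0r ?mulr0 ?addr0//.
    by apply: polyfunX; exact: polyfun_coord.
  by apply: polyfun_prod => k _; apply: polyfunX; exact: polyfun_coord.
rewrite (_ : monomial a = fun z => z 0 j ^+ a j * g z); last first.
  by apply/funext => z; rewrite /monomial (bigD1 j).
rewrite derive_polyfunM// dg mulr0 addr0 dX eqxx mul1r -mulrA; congr (_ * _).
rewrite /monomial (bigD1 j)//= eqxx subn1; congr (_ * _); rewrite /g.
by apply: eq_bigr => i /negbTE ->; rewrite subn0.
Qed.

Lemma gint_monomial a : gint (@monomial R m a) = \prod_i gauss_moment (a i).
Proof. by rewrite /gint; have [_ ->] := @gauss_integral_monomial R m a. Qed.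

(** Integration by parts against exp(-|x|^2). On a monomial it is the recurrence [gauss_momentSS] in
    the j-th variable. *)
Lemma gint_coordM f j : polyfun f ->
  gint (fun x => x 0 j * f x) = 2^-1 * gint (fun x => 'D_(delta_mx 0 j) f x).
Proof.
move=> /polyfun_span[s ->].
have pM u : polyfun (fun x => u.1 * @monomial R m u.2 x).
  by apply: polyfunM; [exact: polyfun_cst|exact: monomial_polyfun].
rewrite [in RHS](_ : (fun x => _) = fun x : rv => \sum_(u <- s)
    'D_(delta_mx 0 j) (fun x => u.1 * @monomial R m u.2 x) x); last first.
  by apply/funext => x; exact: derive_sum_polyfun.
rewrite gint_sum; last by move=> u _; exact: polyfun_derive.
rewrite (_ : (fun x => _) = fun x : rv => \sum_(u <- s)
    x 0 j * (u.1 * @monomial R m u.2 x)); last first.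
  by apply/funext => x; rewrite mulr_sumr.
rewrite gint_sum; last by move=> u _; apply: polyfunM => //; exact: polyfun_coord.
rewrite mulr_sumr; apply: eq_bigr => -[c a] _ /=.
pose b i := (a i + (i == j))%N.
rewrite [in LHS](_ : (fun x => _) = fun x : rv => c * monomial b x); last first.
  apply/funext => x; rewrite mulrCA; congr (_ * _).
  rewrite /monomial (bigD1 j)//= [in RHS](bigD1 j)//= /b eqxx addn1 exprS mulrA.
  by congr (_ * _); apply: eq_bigr => i /negbTE ->; rewrite addn0.
rewrite gintZ ?gint_monomial; last exact: monomial_polyfun.
pose a' i := (a i - (i == j))%N.
rewrite [in RHS](_ : (fun x => _) = fun x : rv => (c * (a j)%:R) * monomial a' x); last first.
  apply/funext => x; rewrite derive_polyfunM ?derive_cst ?mul0r ?add0r ?derive_monomial ?mulrA//.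
    exact: polyfun_cst.
  exact: monomial_polyfun.
rewrite gintZ ?gint_monomial; last exact: monomial_polyfun.
rewrite (bigD1 j)//= [in RHS](bigD1 j)//= /b /a' eqxx addn1 subn1.
rewrite (eq_bigr (fun i => gauss_moment (a i))); last by move=> i /negbTE ->; rewrite addn0.
rewrite [in RHS](eq_bigr (fun i => gauss_moment (a i))); last by move=> i /negbTE ->; rewrite subn0.
(* Exponent 0 in the j-th variable: an odd moment on the left, a zero coefficient on the right. *)
case: (a j) => [|n] /=; first by rewrite gauss_moment_odd// !(mul0r, mulr0).
by rewrite gauss_momentSS; ring.
Qed.

Lemma gint_sphere d f : (0 < m)%N -> polyfun f ->
  (forall r x, 0 < r -> f (r *: x) = r ^+ d * f x) ->
  gint f = Gamma ((m + d)%:R / 2) / 2 * sphere_integral f.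
Proof.
move=> m0 pf hf; apply: gauss_integral_sphere => //.
- exact: polyfun_measurable.
- move=> r t r0; rewrite -hf//; congr f.
  by apply/rowP => i; rewrite !mxE tnth_mktuple.
- exact: polyfun_gauss_integrable.
Qed.

Lemma gint1 : gint (fun=> 1) = Num.sqrt pi ^+ m.
Proof. by rewrite /gint gauss_integral1. Qed.

End PolynomialFunctions.

Local Open Scope complex_scope.

(** * Complex-valued polynomials *)

Section ComplexPolynomialFunctions.
Context {R : realType} (m : nat).
Local Notation rv := 'rV[R]_m.
Local Notation Re := complex.Re.
Local Notation Im := complex.Im.
Implicit Types f g : rv -> R[i].

Definition cpolyfun f := polyfun (fun x => Re (f x)) /\ polyfun (fun x => Im (f x)).

Definition cderive (v : rv) f (x : rv) : R[i] :=
  'D_v (fun z => Re (f z)) x +i* 'D_v (fun z => Im (f z)) x.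

Definition cgint f : R[i] :=
  gint (fun x => Re (f x)) +i* gint (fun x => Im (f x)).

Lemma ReM (a b : R[i]) : Re (a * b) = Re a * Re b - Im a * Im b.
Proof. by case: a b => [? ?] [? ?]. Qed.

Lemma ImM (a b : R[i]) : Im (a * b) = Re a * Im b + Im a * Re b.
Proof. by case: a b => [? ?] [? ?]. Qed.

Lemma ReD (a b : R[i]) : Re (a + b) = Re a + Re b.
Proof. by case: a b => [? ?] [? ?]. Qed.

Lemma ImD (a b : R[i]) : Im (a + b) = Im a + Im b.
Proof. by case: a b => [? ?] [? ?]. Qed.

Lemma realM_complex (r a b : R) : r%:C * (a +i* b) = r * a +i* (r * b).
Proof. by apply/eqP; rewrite eq_complex ReM ImM /= !mul0r subr0 addr0 !eqxx. Qed.

Lemma cpolyfun_cst c : cpolyfun (fun=> c).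
Proof. by split; exact: polyfun_cst. Qed.

Lemma cpolyfun_real (p : rv -> R) : polyfun p -> cpolyfun (fun x => (p x)%:C).
Proof. by move=> pp; split => //; exact: polyfun_cst. Qed.

Lemma cpolyfunD f g : cpolyfun f -> cpolyfun g -> cpolyfun (fun x => f x + g x).
Proof.
move=> [rf jf] [rg jg]; split.
  by under eq_fun do rewrite ReD; exact: polyfunD.
by under eq_fun do rewrite ImD; exact: polyfunD.
Qed.

Lemma cpolyfunM f g : cpolyfun f -> cpolyfun g -> cpolyfun (fun x => f x * g x).
Proof.
move=> [rf jf] [rg jg]; split.
  under eq_fun do rewrite ReM.
  by apply: polyfunD; [exact: polyfunM|apply: polyfunN; exact: polyfunM].
under eq_fun do rewrite ImM.
by apply: polyfunD; exact: polyfunM.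
Qed.

Lemma cpolyfun_derive f v : cpolyfun f -> cpolyfun (cderive v f).
Proof. by move=> [rf jf]; split; exact: polyfun_derive. Qed.

Lemma cderive_cst v c x : cderive v (fun=> c) x = 0.
Proof. by rewrite /cderive !derive_cst. Qed.

Lemma cderive_real v (p : rv -> R) x : cderive v (fun x => (p x)%:C) x = ('D_v p x)%:C.
Proof. by rewrite /cderive/= derive_cst. Qed.

Lemma cderiveD v f g x : cpolyfun f -> cpolyfun g ->
  cderive v (fun z => f z + g z) x = cderive v f x + cderive v g x.
Proof.
move=> [rf jf] [rg jg]; rewrite /cderive.
under [X in derive X _ _]eq_fun do rewrite ReD.
under [X in _ +i* derive X _ _]eq_fun do rewrite ImD.
by rewrite !derive_polyfunD.
Qed.

Lemma cderiveM v f g x : cpolyfun f -> cpolyfun g ->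
  cderive v (fun z => f z * g z) x = cderive v f x * g x + f x * cderive v g x.
Proof.
move=> [rf jf] [rg jg]; rewrite /cderive.
under [X in derive X _ _]eq_fun do rewrite ReM.
under [X in _ +i* derive X _ _]eq_fun do rewrite ImM.
have pm (p q : rv -> R) : polyfun p -> polyfun q -> polyfun (fun x => p x * q x) by exact: polyfunM.
rewrite [X in X +i* _](@derive_polyfunD _ _ (fun x => Re (f x) * Re (g x))
  (fun x => - (Im (f x) * Im (g x)))); [|exact: pm|apply: polyfunN; exact: pm].
rewrite [X in _ +i* X](@derive_polyfunD _ _ (fun x => Re (f x) * Im (g x))
  (fun x => Im (f x) * Re (g x))); [|exact: pm..].
rewrite (_ : (fun x => - (Im (f x) * Im (g x))) = fun x => (-1) * (Im (f x) * Im (g x))); last first.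
  by apply/funext => z; rewrite mulN1r.
rewrite (@derive_polyfunM _ _ (fun=> -1)); [|exact: polyfun_cst|exact: pm].
rewrite derive_cst mul0r add0r !derive_polyfunM//.
by apply/eqP; rewrite eq_complex /= ReD ImD !ReM !ImM /=; apply/andP; split; apply/eqP; ring.
Qed.

Lemma cderiveC u v f x : cpolyfun f ->
  cderive u (cderive v f) x = cderive v (cderive u f) x.
Proof.
move=> [rf jf]; rewrite /cderive /=.
by rewrite (polyfun_deriveC u v x rf) (polyfun_deriveC u v x jf).
Qed.

Lemma cgintD f g : cpolyfun f -> cpolyfun g ->
  cgint (fun x => f x + g x) = cgint f + cgint g.
Proof.
move=> [rf jf] [rg jg]; rewrite /cgint.
under [X in gint X +i* _]eq_fun do rewrite ReD.
under [X in _ +i* gint X]eq_fun do rewrite ImD.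
by rewrite !gintD.
Qed.

Lemma cgintZ c f : cpolyfun f -> cgint (fun x => c * f x) = c * cgint f.
Proof.
move=> [rf jf]; rewrite /cgint.
under [X in gint X +i* _]eq_fun do rewrite ReM -mulNr.
under [X in _ +i* gint X]eq_fun do rewrite ImM.
have pm k (p : rv -> R) : polyfun p -> polyfun (fun x => k * p x).
  by move=> pp; apply: polyfunM => //; exact: polyfun_cst.
rewrite !gintD; do ?exact: pm; rewrite !gintZ//.
by case: c => a b; rewrite mulNr.
Qed.

Lemma cgint_coordM f j : cpolyfun f ->
  cgint (fun x => (x 0 j)%:C * f x) = (2^-1)%:C * cgint (cderive (delta_mx 0 j) f).
Proof.
move=> [rf jf]; rewrite /cgint /cderive /=.
under [X in gint X +i* _]eq_fun do rewrite ReM /= mul0r subr0.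
under [X in _ +i* gint X]eq_fun do rewrite ImM /= mul0r addr0.
by rewrite (gint_coordM j rf) (gint_coordM j jf) realM_complex.
Qed.

Lemma cgint_sphere d f : (0 < m)%N -> cpolyfun f ->
  (forall r x, 0 < r -> f (r *: x) = (r ^+ d)%:C * f x) ->
  cgint f = (Gamma ((m + d)%:R / 2) / 2)%:C *
    (sphere_integral (fun x => Re (f x)) +i* sphere_integral (fun x => Im (f x))).
Proof.
move=> m0 [rf jf] hf; rewrite /cgint.
rewrite (@gint_sphere _ _ d _ m0 rf); last first.
  by move=> r x r0; rewrite hf// ReM/= mul0r subr0.
rewrite (@gint_sphere _ _ d _ m0 jf) ?realM_complex//.
by move=> r x r0; rewrite hf// ImM/= mul0r addr0.
Qed.

End ComplexPolynomialFunctions.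

(** * Clifford-valued polynomials *)

Section CliffordPolynomialFunctions.
Context {R : realType} (m : nat).
Local Notation rv := 'rV[R]_m.
Local Notation cl := (cliff R m).
Implicit Types F H : rv -> cl.

Definition clpolyfun F := forall A, cpolyfun (fun x => F x A).

Definition clgint F : cl := [ffun A => cgint (fun x => F x A)].

Lemma cliff_scaleE (c : R[i]) (a : cl) A : (c *: a) A = c * a A.
Proof. by rewrite ffunE. Qed.

Lemma cliff_addE (a b : cl) A : (a + b) A = a A + b A.
Proof. by rewrite ffunE. Qed.

Lemma partialE j F x A :
  partial j F x A = cderive (delta_mx 0 j) (fun z => F z A) x.
Proof. by rewrite ffunE. Qed.

Lemma cpolyfun_sum I (r : seq I) (P : pred I) (f : I -> rv -> R[i]) :
  (forall i, P i -> cpolyfun (f i)) -> cpolyfun (fun x => \sum_(i <- r | P i) f i x).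
Proof.
move=> pF; elim: r => [|i r IH].
  under eq_fun do rewrite big_nil.
  exact: cpolyfun_cst.
under eq_fun do rewrite big_cons.
case Pi: (P i) => //; apply: cpolyfunD => //; exact: pF.
Qed.

Lemma cderive_sum I (r : seq I) (f : I -> rv -> R[i]) v x :
  (forall i, cpolyfun (f i)) ->
  cderive v (fun x => \sum_(i <- r) f i x) x = \sum_(i <- r) cderive v (f i) x.
Proof.
move=> pF; elim: r => [|i r IH].
  under [X in cderive _ X]eq_fun do rewrite big_nil.
  by rewrite big_nil cderive_cst.
under [X in cderive _ X]eq_fun do rewrite big_cons.
rewrite big_cons cderiveD ?IH//; exact: cpolyfun_sum.
Qed.

Lemma cgint_sum I (r : seq I) (f : I -> rv -> R[i]) :
  (forall i, cpolyfun (f i)) ->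
  cgint (fun x => \sum_(i <- r) f i x) = \sum_(i <- r) cgint (f i).
Proof.
move=> pF; elim: r => [|i r IH].
  under [X in cgint X]eq_fun do rewrite big_nil.
  by rewrite big_nil /cgint !gint0.
under [X in cgint X]eq_fun do rewrite big_cons.
rewrite big_cons cgintD ?IH//; exact: cpolyfun_sum.
Qed.

Lemma clpolyfun_cst a : clpolyfun (fun=> a).
Proof. by move=> A; exact: cpolyfun_cst. Qed.

Lemma clpolyfunD F H : clpolyfun F -> clpolyfun H -> clpolyfun (fun x => F x + H x).
Proof.
move=> pF pH A; under eq_fun do rewrite cliff_addE.
exact: cpolyfunD.
Qed.

Lemma clpolyfunM F H : clpolyfun F -> clpolyfun H -> clpolyfun (fun x => F x * H x).
Proof.
move=> pF pH A; under eq_fun do rewrite cliff_mulrE.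
apply: cpolyfun_sum => B _; apply: cpolyfunM; first exact: cpolyfun_cst.
exact: cpolyfunM.
Qed.

Lemma clpolyfunZ (p : rv -> R) F : polyfun p -> clpolyfun F ->
  clpolyfun (fun x => (p x)%:C *: F x).
Proof.
move=> pp pF A; under eq_fun do rewrite cliff_scaleE.
by apply: cpolyfunM => //; exact: cpolyfun_real.
Qed.

Lemma clpolyfun_sum I (r : seq I) (P : pred I) (F : I -> rv -> cl) :
  (forall i, P i -> clpolyfun (F i)) -> clpolyfun (fun x => \sum_(i <- r | P i) F i x).
Proof.
move=> pF; elim: r => [|i r IH].
  under eq_fun do rewrite big_nil.
  exact: clpolyfun_cst.
under eq_fun do rewrite big_cons.
case Pi: (P i) => //; apply: clpolyfunD => //; exact: pF.
Qed.

Lemma clpolyfun_partial F j : clpolyfun F -> clpolyfun (partial j F).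
Proof.
move=> pF A; under eq_fun do rewrite partialE.
exact: cpolyfun_derive.
Qed.

Lemma partial_cst j a x : partial j (fun=> a : cl) x = 0.
Proof. by apply/ffunP => A; rewrite partialE cderive_cst ffunE. Qed.

Lemma partialD j F H x : clpolyfun F -> clpolyfun H ->
  partial j (fun z => F z + H z) x = partial j F x + partial j H x.
Proof.
move=> pF pH; apply/ffunP => A; rewrite cliff_addE !partialE.
under [X in cderive _ X]eq_fun do rewrite cliff_addE.
exact: cderiveD.
Qed.

Lemma partialM j F H x : clpolyfun F -> clpolyfun H ->
  partial j (fun z => F z * H z) x = partial j F x * H x + F x * partial j H x.
Proof.
move=> pF pH; apply/ffunP => A; rewrite cliff_addE !cliff_mulrE -big_split partialE.
under [X in cderive _ X]eq_fun do rewrite cliff_mulrE.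
rewrite cderive_sum; last first.
  move=> B; apply: cpolyfunM; [exact: cpolyfun_cst|exact: cpolyfunM].
apply: eq_bigr => B _; rewrite cderiveM; [|exact: cpolyfun_cst|exact: cpolyfunM].
by rewrite cderive_cst mul0r add0r cderiveM// mulrDr !partialE.
Qed.

Lemma partialZ j (p : rv -> R) F x : polyfun p -> clpolyfun F ->
  partial j (fun z => (p z)%:C *: F z) x =
  ('D_(delta_mx 0 j) p x)%:C *: F x + (p x)%:C *: partial j F x.
Proof.
move=> pp pF; apply/ffunP => A; rewrite cliff_addE !cliff_scaleE !partialE.
under [X in cderive _ X]eq_fun do rewrite cliff_scaleE.
rewrite cderiveM; [|exact: cpolyfun_real|exact: pF].
by rewrite cderive_real.
Qed.

Lemma partial_sum j I (r : seq I) (F : I -> rv -> cl) x :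
  (forall i, clpolyfun (F i)) ->
  partial j (fun x => \sum_(i <- r) F i x) x = \sum_(i <- r) partial j (F i) x.
Proof.
move=> pF; elim: r => [|i r IH].
  under [X in partial _ X]eq_fun do rewrite big_nil.
  by rewrite big_nil partial_cst.
under [X in partial _ X]eq_fun do rewrite big_cons.
rewrite big_cons partialD ?IH//; exact: clpolyfun_sum.
Qed.

Lemma partialC i j F x : clpolyfun F ->
  partial i (partial j F) x = partial j (partial i F) x.
Proof.
move=> pF; apply/ffunP => A; rewrite [LHS]partialE [RHS]partialE.
have E k : (fun z => partial k F z A) = cderive (delta_mx 0 k) (fun z => F z A).
  by apply/funext => z; rewrite partialE.
rewrite (E i) (E j); exact: (cderiveC _ _ _ (pF A)).
Qed.

Lemma clgintD F H : clpolyfun F -> clpolyfun H ->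
  clgint (fun x => F x + H x) = clgint F + clgint H.
Proof.
move=> pF pH; apply/ffunP => A; rewrite cliff_addE !ffunE -cgintD//.
by congr cgint; apply/funext => x; rewrite cliff_addE.
Qed.

Lemma clgintZ c F : clpolyfun F -> clgint (fun x => c *: F x) = c *: clgint F.
Proof.
move=> pF; apply/ffunP => A; rewrite cliff_scaleE !ffunE -cgintZ//.
by congr cgint; apply/funext => x; rewrite cliff_scaleE.
Qed.

Lemma clgint_mull a F : clpolyfun F -> clgint (fun x => a * F x) = a * clgint F.
Proof.
move=> pF; apply/ffunP => A; rewrite cliff_mulrE ffunE.
under [X in cgint X]eq_fun do rewrite cliff_mulrE.
have pa B : cpolyfun (fun x => a B * F x (symd B A)).
  by apply: cpolyfunM; [exact: cpolyfun_cst|exact: pF].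
rewrite cgint_sum; last by move=> B; apply: cpolyfunM; [exact: cpolyfun_cst|exact: pa].
by apply: eq_bigr => B _; rewrite cgintZ// cgintZ// ffunE.
Qed.

Lemma clgint_sum I (r : seq I) (F : I -> rv -> cl) :
  (forall i, clpolyfun (F i)) ->
  clgint (fun x => \sum_(i <- r) F i x) = \sum_(i <- r) clgint (F i).
Proof.
move=> pF; elim: r => [|i r IH].
  under [X in clgint X]eq_fun do rewrite big_nil.
  by rewrite big_nil; apply/ffunP => A; rewrite !ffunE /cgint !gint0.
under [X in clgint X]eq_fun do rewrite big_cons.
rewrite big_cons clgintD ?IH//; exact: clpolyfun_sum.
Qed.

Lemma clgint_coordM F j : clpolyfun F ->
  clgint (fun x => (x 0 j)%:C *: F x) = (2^-1)%:C *: clgint (partial j F).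
Proof.
move=> pF; apply/ffunP => A; rewrite cliff_scaleE !ffunE.
under [X in cgint X]eq_fun do rewrite cliff_scaleE.
rewrite cgint_coordM//; congr (_ * cgint _); apply/funext => x.
by rewrite partialE.
Qed.

Lemma clgint_sphere d F : (0 < m)%N -> clpolyfun F ->
  (forall r x, 0 < r -> F (r *: x) = (r ^+ d)%:C *: F x) ->
  clgint F = (Gamma ((m + d)%:R / 2) / 2)%:C *: cliff_sphere_integral F.
Proof.
move=> m0 pF hF; apply/ffunP => A; rewrite cliff_scaleE !ffunE.
by apply: cgint_sphere => // r x r0; rewrite hF// cliff_scaleE.
Qed.

Lemma clgint_cst (a : cl) : clgint (fun=> a) = (Num.sqrt pi ^+ m)%:C *: a.
Proof.
rewrite (_ : (fun=> a) = fun x => a * 1); last by apply/funext => x; rewrite mulr1.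
rewrite clgint_mull; last exact: clpolyfun_cst.
rewrite (_ : clgint (fun=> 1) = (Num.sqrt pi ^+ m)%:C *: 1) -?scalerAr ?mulr1//.
apply/ffunP => A; rewrite cliff_scaleE [LHS]ffunE !cliff_1E /cgint.
case: (A == finset.set0) => /=; last by rewrite !gint0 mulr0.
by rewrite gint1 gint0 mulr1.
Qed.

End CliffordPolynomialFunctions.

(** * Homogenised Gegenbauer polynomials *)

Section Gegenbauer.
Context {R : realType}.
Implicit Types (l s q : R) (n j : nat) (k : int).

(** The Pochhammer symbol (l)_n, which stands for Gamma (l + n) / Gamma l and makes the Gegenbauer
    identities algebraic. *)
Definition rising l n : R := \prod_(0 <= i < n) (l + i%:R).

Lemma risingSr l n : rising l n.+1 = rising l n * (l + n%:R).
Proof. by rewrite /rising big_nat_recr. Qed.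

Lemma risingSl l n : rising l n.+1 = l * rising (l + 1) n.
Proof.
rewrite /rising big_nat_recl//= addr0; congr (_ * _).
by apply: eq_bigr => i _; rewrite -addrA -natr1 [1 + _]addrC.
Qed.

Lemma factr_neq0 n : n`!%:R != 0 :> R.
Proof. by rewrite pnatr_eq0 -lt0n fact_gt0. Qed.

(** The coefficient of (2 s)^a q^j in degree k = a + 2 j. With [a] as a parameter instead of k - 2
    j, the relations below are free of truncated subtraction. *)
Definition gegcoef l a j : R := (-1) ^+ j * rising l (a + j) / (a`!%:R * j`!%:R).

Lemma gegcoef_Sa l a j : a.+1%:R * gegcoef l a.+1 j = l * gegcoef (l + 1) a j.
Proof.
rewrite /gegcoef addSn risingSl factS natrM; field.
by rewrite !factr_neq0 nat1r pnatr_eq0.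
Qed.

Lemma gegcoef_Sj l a j : j.+1%:R * gegcoef l a j.+1 = - (l * gegcoef (l + 1) a j).
Proof.
rewrite /gegcoef addnS risingSl factS natrM exprS; field.
by rewrite !factr_neq0 nat1r pnatr_eq0.
Qed.

Lemma gegcoef_shift l a j : l * gegcoef (l + 1) a j = (l + (a + j)%:R) * gegcoef l a j.
Proof.
have -> : (l + (a + j)%:R) * gegcoef l a j =
  (-1) ^+ j * (rising l (a + j).+1) / (a`!%:R * j`!%:R) by rewrite risingSr /gegcoef; ring.
by rewrite risingSl /gegcoef; ring.
Qed.

(** The range is longer than n/2 and the filter cuts it, so that sums of different degrees can be
    brought to a common range by [bounded_sum]. *)
Definition hgegnat l n s q : R :=
  \sum_(0 <= j < n.+1 | (2 * j <= n)%N) gegcoef l (n - 2 * j) j * (2 * s) ^+ (n - 2 * j) * q ^+ j.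

(* The homogenised Gegenbauer polynomial: |x|^k |y|^k C_k^l(t) is
   [hgeg l k <x,y> (|x|^2 |y|^2)]. *)
Definition hgeg l k s q : R := if k is Posz n then hgegnat l n s q else 0.

Lemma bounded_sum (F : nat -> R) n N : (n < N)%N ->
  \sum_(0 <= j < N | (2 * j <= n)%N) F j = \sum_(0 <= j < n.+1 | (2 * j <= n)%N) F j.
Proof.
move=> nN; rewrite (@big_cat_nat _ _ _ n.+1)//= [X in _ + X]big_nat_cond [X in _ + X]big_pred0 ?addr0//.
by move=> j; apply/negP; lia.
Qed.

(** The left side is the term-by-term derivative in s: the homogenised form of (C_k^l)' = 2 l
    C_(k-1)^(l+1). *)
Lemma hgeg_ds l k s q :
  (if k is Posz n then
     \sum_(0 <= j < n.+1 | (2 * j <= n)%N) gegcoef l (n - 2 * j) j *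
       ((n - 2 * j)%:R * (2 * (2 * s) ^+ (n - 2 * j).-1)) * q ^+ j else 0)
  = 2 * l * hgeg (l + 1) (k - 1) s q.
Proof.
case: k => [[|n]|n] /=; last by rewrite mulr0.
  by rewrite big_mkcond big_nat1 /= mul0r mulr0 mul0r mulr0.
rewrite subSS subn0.
rewrite /= /hgegnat -(@bounded_sum _ n n.+2)// mulr_sumr.
rewrite big_mkcond [RHS]big_mkcond /=; apply: eq_bigr => j _.
have [jn|nj] := leqP (2 * j) n.
  rewrite leqW// subSn//= mulrA [_ * (_.+1)%:R]mulrC gegcoef_Sa; ring.
case: ifP => // jn1; have -> : (n.+1 - 2 * j = 0)%N by lia.
by rewrite mul0r mulr0 mul0r.
Qed.

(** The term-by-term derivative in q. The term j = 0 drops out and j is shifted by one, which lowers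
    the degree by two. *)
Lemma hgeg_dq l k s q :
  (if k is Posz n then
     \sum_(0 <= j < n.+1 | (2 * j <= n)%N) gegcoef l (n - 2 * j) j *
       (2 * s) ^+ (n - 2 * j) * (j%:R * q ^+ j.-1) else 0)
  = - l * hgeg (l + 1) (k - 2) s q.
Proof.
case: k => [[|[|n]]|n] /=; last by rewrite mulr0.
- by rewrite big_mkcond big_nat1 /= mul0r !mulr0.
- by rewrite big_mkcond big_nat_recr//= big_nat1 /= mul0r !mulr0 add0r.
rewrite !subSS subn0.
rewrite /= /hgegnat -(@bounded_sum _ n n.+2)// mulr_sumr.
rewrite big_mkcond big_nat_recl//= mul0r mulr0 add0r [RHS]big_mkcond /=.
apply: eq_bigr => j _.
have -> : (2 * j.+1 <= n.+2)%N = (2 * j <= n)%N by lia.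
case: ifP => // jn; have -> : (n.+2 - 2 * j.+1 = n - 2 * j)%N by lia.
rewrite mulrACA [_ * _.+1%:R]mulrC.
transitivity (((j.+1)%:R * gegcoef l (n - 2 * j) j.+1) * (2 * s) ^+ (n - 2 * j) * q ^+ j); first by ring.
by rewrite gegcoef_Sj; ring.
Qed.

Lemma hgeg_sum_a l n s q :
  \sum_(0 <= j < n.+1 | (2 * j <= n)%N)
    (n - 2 * j)%:R * (gegcoef l (n - 2 * j) j * (2 * s) ^+ (n - 2 * j) * q ^+ j) =
  2 * l * s * hgeg (l + 1) (n%:Z - 1) s q.
Proof.
rewrite mulrAC -hgeg_ds [RHS]mulrC mulr_sumr; apply: eq_bigr => j _.
by case: (n - 2 * j)%N => [|a] /=; rewrite ?exprS; ring.
Qed.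

Lemma hgeg_sum_j l n s q :
  \sum_(0 <= j < n.+1 | (2 * j <= n)%N)
    j%:R * (gegcoef l (n - 2 * j) j * (2 * s) ^+ (n - 2 * j) * q ^+ j) =
  - l * q * hgeg (l + 1) (n%:Z - 2) s q.
Proof.
rewrite mulrAC -hgeg_dq [RHS]mulrC mulr_sumr; apply: eq_bigr => j _.
by case: j => [|a] /=; rewrite ?exprS; ring.
Qed.

(** Euler's identity with weight 1 for s and 2 for q, from k = (k - 2 j) + 2 j in each term. At q =
    1 it reads k C_k^l = 2 l (t C_(k-1)^(l+1) - C_(k-2)^(l+1)). *)
Lemma hgeg_euler l k s q :
  k%:~R * hgeg l k s q =
  2 * l * (s * hgeg (l + 1) (k - 1) s q - q * hgeg (l + 1) (k - 2) s q).
Proof.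
case: k => n; last by rewrite /= mulr0 !mulr0 subr0 mulr0.
transitivity (2 * l * s * hgeg (l + 1) (n%:Z - 1) s q +
  2 * (- l * q * hgeg (l + 1) (n%:Z - 2) s q)); last by ring.
rewrite -hgeg_sum_a -hgeg_sum_j /= /hgegnat !mulr_sumr -big_split /=.
rewrite big_nat_cond [RHS]big_nat_cond; apply: eq_bigr => j /andP[_ jn].
rewrite (mulrA 2) -mulrDl; congr (_ * _).
by rewrite -[(n%:Z)%:~R]/(n%:R) -natrM -natrD subnK.
Qed.

(** With a = k - 2 j, each term satisfies k + 2 l = 2 (l + a + j) - a: the first summand raises the
    parameter by [gegcoef_shift], the second is s d/ds. *)
Lemma hgeg_shift l k s q :
  (k%:~R + 2 * l) * hgeg l k s q =
  2 * l * (hgeg (l + 1) k s q - s * hgeg (l + 1) (k - 1) s q).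
Proof.
case: k => n; last by rewrite /= !mulr0 subr0 mulr0.
transitivity (2 * (l * hgeg (l + 1) n s q) -
  2 * l * s * hgeg (l + 1) (n%:Z - 1) s q); last by ring.
rewrite -hgeg_sum_a /= /hgegnat !mulr_sumr -sumrB.
rewrite big_nat_cond [RHS]big_nat_cond; apply: eq_bigr => j /andP[_ jn].
rewrite 2!(mulrA l) gegcoef_shift -[(n%:Z)%:~R]/(n%:R).
have {1}-> : n = (n - 2 * j + 2 * j)%N by rewrite subnK.
by ring.
Qed.

(** Half the sum of the two preceding relations. *)
Lemma hgeg_dim l k s q :
  (k%:~R + l) * hgeg l k s q =
  l * (hgeg (l + 1) k s q - q * hgeg (l + 1) (k - 2) s q).
Proof.
have := hgeg_euler l k s q; have := hgeg_shift l k s q; lra.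
Qed.

Lemma Gamma_rising (u : R) n : 0 < u -> Gamma (n%:R + u) = rising u n * Gamma u.
Proof.
move=> u0; elim: n => [|n IH]; first by rewrite add0r /rising big_nil mul1r.
rewrite -natr1 -addrA [1 + u]addrC addrA GammaD1; last by rewrite ltr_wpDl.
by rewrite IH risingSr; ring.
Qed.

End Gegenbauer.

(** * Homogeneous Clifford-valued polynomials *)

Section HomogeneousPolynomials.
Context {R : realType} (m : nat).
Local Notation rv := 'rV[R]_m.
Local Notation cl := (cliff R m).
Local Notation e := (gen R).
Implicit Types F H : rv -> cl.

Lemma real_complexM (a b : R) : (a * b)%:C = a%:C * b%:C.
Proof. exact: rmorphM. Qed.

Lemma real_complex_nat n : n%:R%:C = n%:R :> R[i].
Proof. exact: rmorph_nat. Qed.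

(** The degree is an index, and 0 belongs to every degree so that sums and derivatives stay inside.
    Factors are Clifford-valued and keep their order. *)
Inductive hpoly : nat -> (rv -> cl) -> Prop :=
| hpoly_cst a : hpoly 0 (fun=> a)
| hpoly0 d : hpoly d (fun=> 0)
| hpoly_coord j : hpoly 1 (fun x => (x 0 j)%:C%:A)
| hpolyD d F H : hpoly d F -> hpoly d H -> hpoly d (fun x => F x + H x)
| hpolyM d d' F H : hpoly d F -> hpoly d' H -> hpoly (d + d') (fun x => F x * H x).

Lemma hpoly_clpolyfun d F : hpoly d F -> clpolyfun F.
Proof.
elim=> {d F} [a|d|j|d F H _ pF _ pH|d d' F H _ pF _ pH].
- exact: clpolyfun_cst.
- exact: clpolyfun_cst.
- by apply: clpolyfunZ; [exact: polyfun_coord|exact: clpolyfun_cst].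
- exact: clpolyfunD.
- exact: clpolyfunM.
Qed.

Lemma hpoly_homogeneous d F r x : hpoly d F -> F (r *: x) = (r ^+ d)%:C *: F x.
Proof.
elim=> {d F} [a|d|j|d F H _ pF _ pH|d d' F H _ pF _ pH].
- by rewrite expr0 scale1r.
- by rewrite scaler0.
- by rewrite mxE expr1 real_complexM scalerA.
- by rewrite pF pH scalerDr.
- by rewrite pF pH -scalerAl -scalerAr scalerA -real_complexM -exprD.
Qed.

Lemma partial_coord i j (x : rv) :
  partial i (fun z : rv => (z 0 j)%:C%:A : cl) x = (i == j)%:R.
Proof.
rewrite partialZ; [|exact: polyfun_coord|exact: clpolyfun_cst].
rewrite partial_cst scaler0 addr0.
case: (is_derive_coord x (delta_mx 0 i) j) => _ ->.
by rewrite mxE eqxx eq_sym /=; case: eqP; rewrite ?scale1r ?scale0r.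
Qed.

Lemma hpoly_euler d F (x : rv) : hpoly d F ->
  \sum_j (x 0 j)%:C *: partial j F x = d%:R *: F x.
Proof.
elim=> {d F} [a|d|j|d F H pF IHF pH IHH|d d' F H pF IHF pH IHH].
- by rewrite scale0r big1// => j _; rewrite partial_cst scaler0.
- by rewrite scaler0 big1// => j _; rewrite partial_cst scaler0.
- rewrite scale1r (bigD1 j)//= partial_coord eqxx big1 ?addr0// => i /negbTE ij.
  by rewrite partial_coord ij scaler0.
- have cF := hpoly_clpolyfun pF; have cH := hpoly_clpolyfun pH.
  rewrite scalerDr -IHF -IHH -big_split /=; apply: eq_bigr => j _.
  by rewrite partialD// scalerDr.
- have cF := hpoly_clpolyfun pF; have cH := hpoly_clpolyfun pH.
  rewrite natrD scalerDl scalerAl scalerAr -IHF -IHH mulr_suml mulr_sumr -big_split /=.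
  by apply: eq_bigr => j _; rewrite partialM// scalerDr scalerAl scalerAr.
Qed.

Lemma hpoly_partial d F j : hpoly d F ->
  if d is d'.+1 then hpoly d' (partial j F) else partial j F = fun=> 0.
Proof.
elim=> {d F} [a|d|i|d F H pF IHF pH IHH|d d' F H pF IHF pH IHH].
- by apply/funext => x; rewrite partial_cst.
- have -> : partial j (fun=> 0 : cl) = fun=> 0.
    by apply/funext => x; rewrite partial_cst.
  by case: d => // d; exact: hpoly0.
- rewrite (_ : partial _ _ = fun=> (j == i)%:R); first exact: hpoly_cst.
  by apply/funext => x; exact: partial_coord.
- have -> : partial j (fun x => F x + H x) = fun x => partial j F x + partial j H x.
    apply/funext => x.
    by rewrite (partialD _ _ (hpoly_clpolyfun pF) (hpoly_clpolyfun pH)).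
  case: d pF IHF pH IHH => [|d] _ IHF _ IHH; last exact: hpolyD.
  by rewrite IHF IHH; apply/funext => x; rewrite addr0.
- have -> : partial j (fun x => F x * H x) =
      fun x => partial j F x * H x + F x * partial j H x.
    apply/funext => x.
    by rewrite (partialM _ _ (hpoly_clpolyfun pF) (hpoly_clpolyfun pH)).
  case: d pF IHF => [|d] pF IHF; case: d' pH IHH => [|d'] pH IHH /=.
  + by rewrite IHF IHH; apply/funext => x; rewrite mul0r mulr0 addr0.
  + rewrite IHF (_ : (fun x => _) = fun x => F x * partial j H x).
      exact: (hpolyM pF IHH).
    by apply/funext => x; rewrite mul0r add0r.
  + rewrite IHH addn0 (_ : (fun x => _) = fun x => partial j F x * H x).
      by rewrite -[d]addn0; exact: (hpolyM IHF pH).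
    by apply/funext => x; rewrite mulr0 addr0.
  + apply: hpolyD; first exact: hpolyM.
    by rewrite addnS -addSn; exact: hpolyM.
Qed.

Lemma hpoly_degree0 F x y : hpoly 0 F -> F x = F y.
Proof.
have [d Ed] : exists d, d = 0%N by exists 0%N.
rewrite -{1}Ed => pF; elim: pF Ed => {d F} [a|d|j|d F H _ IHF _ IHH|d d' F H _ IHF _ IHH] //.
- by move=> d0; rewrite IHF// IHH.
- by move=> /eqP; rewrite addn_eq0 => /andP[/eqP d0 /eqP d'0]; rewrite IHF// IHH.
Qed.

Lemma hpoly_eq d d' F H : d = d' -> (forall x, F x = H x) -> hpoly d F -> hpoly d' H.
Proof. by move=> -> FH; rewrite (_ : F = H)//; apply/funext. Qed.

Lemma hpolyMl d a F : hpoly d F -> hpoly d (fun x => a * F x).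
Proof. by move=> pF; apply: (hpoly_eq _ _ (hpolyM (hpoly_cst a) pF)). Qed.

Lemma hpolyZ d c F : hpoly d F -> hpoly d (fun x => c *: F x).
Proof.
move=> pF; apply: (hpoly_eq _ _ (hpolyMl c%:A pF)) => // x.
by rewrite -scalerAl mul1r.
Qed.

Lemma hpoly_scale d d' (p : rv -> R) F : hpoly d (fun x => (p x)%:C%:A) -> hpoly d' F ->
  hpoly (d + d') (fun x => (p x)%:C *: F x).
Proof.
move=> pp pF; apply: (hpoly_eq _ _ (hpolyM pp pF)) => // x.
by rewrite -scalerAl mul1r.
Qed.

Lemma hpoly_realX d n (p : rv -> R) : hpoly d (fun x => (p x)%:C%:A) ->
  hpoly (n * d) (fun x => (p x ^+ n)%:C%:A).
Proof.
move=> pp; elim: n => [|n IH]; first by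
  apply: (hpoly_eq _ _ (hpoly_cst 1)) => // x; rewrite expr0 scale1r.
apply: (hpoly_eq _ _ (hpoly_scale pp IH)) => // x.
by rewrite scalerA -real_complexM exprS.
Qed.

Lemma hpoly_sum d I (r : seq I) (P : pred I) (F : I -> rv -> cl) :
  (forall i, P i -> hpoly d (F i)) -> hpoly d (fun x => \sum_(i <- r | P i) F i x).
Proof.
move=> pF; elim: r => [|i r IH].
  by apply: (hpoly_eq _ _ (hpoly0 d)) => // x; rewrite big_nil.
case Pi: (P i).
  by apply: (hpoly_eq _ _ (hpolyD (pF _ Pi) IH)) => // x; rewrite big_cons Pi.
by apply: (hpoly_eq _ _ IH) => // x; rewrite big_cons Pi.
Qed.

Lemma hpoly_vec : hpoly 1 (@vec R m).
Proof.
apply: hpoly_sum => j _; exact: (hpoly_scale (hpoly_coord j) (hpoly_cst _)).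
Qed.

Lemma hpoly_dotp (y : rv) : hpoly 1 (fun x => (dotp x y)%:C%:A).
Proof.
apply: (@hpoly_eq 1 1 (fun x => \sum_j (y 0 j)%:C *: (x 0 j)%:C%:A)) => //.
  move=> x; rewrite /dotp rmorph_sum scaler_suml; apply: eq_bigr => j _.
  by rewrite scalerA -real_complexM mulrC.
by apply: hpoly_sum => j _; apply: hpolyZ; exact: hpoly_coord.
Qed.

Lemma hpoly_sqr : hpoly 2 (fun x => (dotp x x)%:C%:A).
Proof.
apply: (@hpoly_eq 2 2 (fun x => \sum_j (x 0 j)%:C *: (x 0 j)%:C%:A)) => //.
  move=> x; rewrite /dotp rmorph_sum scaler_suml; apply: eq_bigr => j _.
  by rewrite scalerA -real_complexM.
by apply: hpoly_sum => j _; exact: (hpoly_scale (hpoly_coord j) (hpoly_coord j)).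
Qed.

Lemma homogeneous_poly_hpoly d F : homogeneous_poly d F -> hpoly d F.
Proof.
case=> a FE; apply: (@hpoly_eq d d (fun x => \sum_(alpha : {ffun 'I_m -> 'I_d.+1} |
  (\sum_i alpha i == d)%N) (\prod_i x 0 i ^+ alpha i)%:C *: a alpha)) => //.
apply: hpoly_sum => al /eqP ald.
suff H : hpoly (\sum_i al i) (fun x => (\prod_i x 0 i ^+ al i)%:C%:A).
  by apply: (hpoly_eq _ _ (hpoly_scale H (hpoly_cst (a al)))) => //; rewrite addn0.
elim: (index_enum _) => [|i r IH].
  by apply: (hpoly_eq _ _ (hpoly_cst 1)) => [|x]; rewrite big_nil ?scale1r.
apply: (hpoly_eq _ _ (hpoly_scale (hpoly_realX (al i) (hpoly_coord i)) IH)) => [|x].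
  by rewrite big_cons muln1.
by rewrite big_cons scalerA -real_complexM.
Qed.

Lemma clgint_hpoly_sphere d F : (0 < m)%N -> hpoly d F ->
  clgint F = (Gamma ((m + d)%:R / 2) / 2)%:C *: cliff_sphere_integral F.
Proof.
move=> m0 pF; apply: clgint_sphere => //; first exact: hpoly_clpolyfun pF.
by move=> r x _; exact: hpoly_homogeneous.
Qed.

End HomogeneousPolynomials.

(** * Monogenic polynomials under the Gaussian weight *)

Section Monogenic.
Context {R : realType} (m : nat).
Local Notation rv := 'rV[R]_m.
Local Notation cl := (cliff R m).
Local Notation e := (gen R).
Implicit Types (F H M P : rv -> cl) (x y : rv).

Lemma dotpC x y : dotp x y = dotp y x.
Proof. by apply: eq_bigr => j _; rewrite mulrC. Qed.

Lemma gen_vec j x : e j * vec x = - (vec x * e j) - (2 * x 0 j)%:C *: 1.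
Proof.
apply/eqP; rewrite -subr_eq0 opprD !opprK addrA; apply/eqP.
rewrite /vec mulr_sumr mulr_suml -big_split /=.
transitivity (\sum_i - ((x 0 i)%:C *: (2 * (j == i)%:R : cl)) + (2 * x 0 j)%:C *: 1).
  congr (_ + _); apply: eq_bigr => i _.
  by rewrite -scalerAl -scalerAr -scalerDr gen_anticomm scalerN.
rewrite (bigD1 j)//= eqxx big1 ?addr0 => [|i /negbTE]; last first.
  by rewrite eq_sym => ->; rewrite mulr0 scaler0 oppr0.
rewrite mulr1 real_complexM mulrC -scalerA (_ : 2%:C *: 1 = 2 :> cl) ?addNr//.
by rewrite real_complex_nat scaler_nat.
Qed.

Lemma vec_anticomm x y : vec x * vec y = - (vec y * vec x) - (2 * dotp x y)%:C *: 1.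
Proof.
rewrite {1}/vec mulr_suml.
under eq_bigr => j _ do rewrite -scalerAl gen_vec scalerBr scalerN scalerAr scalerA -real_complexM.
rewrite sumrB sumrN -mulr_sumr -scaler_suml -rmorph_sum /=; congr (_ - _%:C *: _).
by rewrite mulr_sumr; apply: eq_bigr => j _; ring.
Qed.

Lemma vec_sqr x : vec x * vec x = - (dotp x x)%:C *: 1.
Proof.
have /eqP := vec_anticomm x x.
rewrite -subr_eq0 opprD !opprK addrA => /eqP H.
apply: (@scalerI _ _ (2 : R[i])); first by rewrite pnatr_eq0.
rewrite scaler_nat mulr2n; apply/eqP; rewrite -subr_eq0; apply/eqP.
rewrite -[RHS]H; congr (_ + _).
by rewrite scaleNr scalerN opprK scalerA -real_complex_nat -real_complexM.
Qed.

Lemma vec_wedge x y : vec x * vec y = wedge x y - (dotp x y)%:C *: 1.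
Proof.
pose f j k : cl := (x 0 j * y 0 k)%:C *: (e j * e k).
have -> : vec x * vec y = \sum_j \sum_k f j k.
  rewrite /vec mulr_suml; apply: eq_bigr => j _; rewrite mulr_sumr.
  by apply: eq_bigr => k _; rewrite -scalerAl -scalerAr scalerA -real_complexM.
have fE j : \sum_k f j k = f j j + 
    (\sum_(k : 'I_m | (j < k)%N) f j k + \sum_(k : 'I_m | (k < j)%N) f j k).
  rewrite (bigD1 j)//= (bigID (fun k : 'I_m => (j < k)%N))/=; congr (_ + (_ + _)).
    by apply: eq_bigl => k; rewrite -val_eqE /=; case: ltngtP.
  by apply: eq_bigl => k; rewrite -val_eqE /=; case: ltngtP.
under eq_bigr do rewrite fE.
rewrite !big_split /= addrC; congr (_ + _).
  (* The pairs with k < j are renamed to j < k; e_k e_j = - e_j e_k then gives the second half of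
     [wedge]. The diagonal gives - <x,y>. *)
  rewrite /wedge [X in _ + X](exchange_big_dep xpredT)//= -big_split /=.
  apply: eq_bigr => j _; rewrite -big_split /=; apply: eq_bigr => k jk.
  rewrite /f (_ : e k * e j = - (e j * e k)).
    by rewrite scalerN -scalerBl -rmorphB.
  apply/eqP; rewrite -subr_eq0 opprK addrC gen_anticomm.
  by rewrite -val_eqE /= (ltn_eqF jk) mulr0 oppr0.
rewrite /dotp rmorph_sum scaler_suml -sumrN; apply: eq_bigr => j _.
by rewrite /f gen_sqr scalerN.
Qed.

Lemma dagger_scale_real (r : R) (a : cl) : dagger (r%:C *: a) = r%:C *: dagger a.
Proof. by rewrite daggerZ conj_Creal// complex_real. Qed.

Lemma dagger_vec x : dagger (vec x) = - vec x.
Proof.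
rewrite /vec -sumrN; elim: (index_enum _) => [|j r IH].
  by rewrite !big_nil -[X in dagger X](scale0r 0) daggerZ rmorph0 scale0r.
by rewrite !big_cons daggerD IH dagger_scale_real dagger_gen scalerN.
Qed.

Lemma clpolyfun_vec : clpolyfun (@vec R m).
Proof. exact: (hpoly_clpolyfun (@hpoly_vec R m)). Qed.

Lemma partial_vec j x : partial j (@vec R m) x = e j.
Proof.
rewrite /vec partial_sum => [|i]; last first.
  by apply: clpolyfunZ; [exact: polyfun_coord|exact: clpolyfun_cst].
under eq_bigr => i _.
  rewrite partialZ; [|exact: polyfun_coord|exact: clpolyfun_cst].
  rewrite partial_cst scaler0 addr0.
  case: (is_derive_coord x (delta_mx 0 j) i) => _ ->.
  rewrite mxE eqxx /=; over.
rewrite (bigD1 j)//= eqxx scale1r big1 ?addr0// => i /negbTE ->.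
by rewrite scale0r.
Qed.

Lemma sum_gen_sqr : \sum_j e j * e j = - (m%:R : R[i]) *: (1 : cl).
Proof.
under eq_bigr do rewrite gen_sqr.
by rewrite sumr_const card_ord mulNrn scaleNr scaler_nat.
Qed.

(** The Gaussian counterpart of the Clifford-Stokes formula: the vector variable between P and M
    becomes half the Dirac operator, acting on P from the right and on M from the left. *)
Lemma clgint_vec P M : clpolyfun P -> clpolyfun M ->
  clgint (fun x => P x * vec x * M x) =
  (2^-1)%:C *: clgint (fun x => Dirac_r P x * M x + P x * Dirac M x).
Proof.
move=> pP pM.
have pPM j : clpolyfun (fun x => P x * e j * M x).
  by apply: clpolyfunM => //; apply: clpolyfunM => //; exact: clpolyfun_cst.
rewrite [in LHS](_ : (fun x => _) = fun x => \sum_j (x 0 j)%:C *: (P x * e j * M x)); last first.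
  apply/funext => x; rewrite /vec mulr_sumr mulr_suml; apply: eq_bigr => j _.
  by rewrite -scalerAr -scalerAl.
rewrite clgint_sum; last by move=> j; apply: clpolyfunZ => //; exact: polyfun_coord.
under eq_bigr do rewrite clgint_coordM//.
rewrite -scaler_sumr -clgint_sum; last by move=> j; exact: clpolyfun_partial.
congr (_ *: clgint _); apply/funext => x.
rewrite /Dirac_r /Dirac mulr_suml mulr_sumr -big_split /=; apply: eq_bigr => j _.
have pPe : clpolyfun (fun x => P x * e j) by apply: clpolyfunM => //; exact: clpolyfun_cst.
rewrite partialM// partialM//; last exact: clpolyfun_cst.
by rewrite partial_cst mulr0 addr0 !mulrA.
Qed.

(** The Dirac operator D and the vector x satisfy D x + x D = - (m + 2 E) with E the Euler operator:
    m comes from e_j e_j = -1, and 2 E from moving e_j past x. *)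
Lemma Dirac_vecM l M x : hpoly l M -> Dirac M x = 0 ->
  Dirac (fun z => vec z * M z) x = - ((m + 2 * l)%:R : R[i]) *: M x.
Proof.
move=> pM M0; have cM := hpoly_clpolyfun pM.
rewrite /Dirac.
under eq_bigr => j _.
  rewrite (partialM _ _ clpolyfun_vec cM) partial_vec mulrDr mulrA gen_sqr mulN1r.
  rewrite mulrA gen_vec mulrBl mulNr -mulrA -scalerAl mul1r real_complexM -scalerA.
  over.
rewrite /= big_split /= sumr_const card_ord sumrB sumrN -mulr_sumr.
rewrite -/(Dirac M x) M0 mulr0 oppr0 sub0r -scaler_sumr (hpoly_euler _ pM).
rewrite real_complex_nat scalerA -natrM scaleNr natrD scalerDl opprD; congr (_ - _).
by rewrite scaler_nat mulNrn.
Qed.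

Lemma Dirac_r_Mvec l P x : hpoly l P -> Dirac_r P x = 0 ->
  Dirac_r (fun z => P z * vec z) x = - ((m + 2 * l)%:R : R[i]) *: P x.
Proof.
move=> pM M0; have cM := hpoly_clpolyfun pM.
have vec_gen j : vec x * e j = - (e j * vec x) - (2 * x 0 j)%:C *: 1.
  by rewrite gen_vec opprB opprK [_ + vec x * _]addrC addrK.
rewrite /Dirac_r.
under eq_bigr => j _.
  rewrite (partialM _ _ cM clpolyfun_vec) partial_vec mulrDl -!mulrA gen_sqr.
  rewrite vec_gen mulrBr mulrN mulrA -scalerAr mulr1 real_complexM -scalerA.
  over.
rewrite /= big_split sumrB /= sumrN -mulr_suml -/(Dirac_r P x) M0 mul0r oppr0 sub0r.
rewrite -scaler_sumr (hpoly_euler _ pM) sumr_const card_ord mulrN1 addrC.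
rewrite real_complex_nat scalerA -natrM scaleNr natrD scalerDl opprD; congr (_ - _).
by rewrite scaler_nat mulNrn.
Qed.

Lemma clgint_vec_monogenic P M : clpolyfun P -> clpolyfun M ->
  (forall x, Dirac_r P x = 0) -> (forall x, Dirac M x = 0) ->
  clgint (fun x => P x * vec x * M x) = 0.
Proof.
move=> pP pM P0 M0; rewrite clgint_vec//.
rewrite (_ : (fun x => _) = fun=> 0); last first.
  by apply/funext => x; rewrite P0 M0 mul0r mulr0 addr0.
by rewrite clgint_cst !scaler0.
Qed.

(* Both sides are the Gaussian integral of P x x M, where either vector
   variable is integrated by parts. *)
Lemma clgint_monogenic_degree k l P M : hpoly k P -> hpoly l M ->
  (forall x, Dirac_r P x = 0) -> (forall x, Dirac M x = 0) -> k != l ->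
  clgint (fun x => P x * M x) = 0.
Proof.
move=> hP hM P0 M0 kl.
have pP := hpoly_clpolyfun hP; have pM := hpoly_clpolyfun hM.
have pPM : clpolyfun (fun x => P x * M x) by exact: clpolyfunM.
have pV := clpolyfun_vec.
have E1 := clgint_vec pP (clpolyfunM pV pM).
have E2 := clgint_vec (clpolyfunM pP pV) pM.
have E3 : clgint (fun x => - ((m + 2 * l)%:R : R[i]) *: (P x * M x)) =
    clgint (fun x => - ((m + 2 * k)%:R : R[i]) *: (P x * M x)).
  apply: (@scalerI _ _ (2^-1)%:C); first by rewrite fmorph_eq0 invr_eq0 pnatr_eq0.
  transitivity (clgint (fun x => P x * vec x * (vec x * M x))).
    rewrite E1; congr (_ *: clgint _); apply/funext => x.
    by rewrite P0 mul0r add0r (Dirac_vecM hM)// scalerAr.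
  transitivity (clgint (fun x => P x * vec x * vec x * M x)).
    by congr clgint; apply/funext => x; rewrite !mulrA.
  rewrite E2; congr (_ *: clgint _); apply/funext => x.
  by rewrite M0 mulr0 addr0 (Dirac_r_Mvec hP)// scalerAl.
move: E3; rewrite !clgintZ// => /eqP; rewrite -subr_eq0 -scalerBl scaler_eq0.
move=> /orP[|/eqP//]; rewrite opprK addrC subr_eq0 eqr_nat.
by rewrite eqn_add2l eqn_pmul2l// (negbTE kl).
Qed.

End Monogenic.

Local Opaque partial clgint.

(** * Powers of <x,y> integrated against monogenics *)

Section Reproducing.
Context {R : realType} (m : nat) (y : 'rV[R]_m).
Local Notation rv := 'rV[R]_m.
Local Notation cl := (cliff R m).
Local Notation e := (gen R).
Implicit Types (F H M P : rv -> cl) (x : rv).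

Lemma clpolyfun_scale (c : R[i]) F : clpolyfun F -> clpolyfun (fun x => c *: F x).
Proof.
move=> pF A; under eq_fun do rewrite cliff_scaleE.
by apply: cpolyfunM => //; exact: cpolyfun_cst.
Qed.

Lemma polyfun_dotp (z : rv) : polyfun (fun x => dotp x z).
Proof.
by apply: polyfun_sum => j _; apply: polyfunM; [exact: polyfun_coord|exact: polyfun_cst].
Qed.

Lemma polyfun_dotpp : polyfun (fun x : rv => dotp x x).
Proof. by apply: polyfun_sum => j _; apply: polyfunM; exact: polyfun_coord. Qed.

Lemma derive_polyfunX (f : rv -> R) n (v x : rv) : polyfun f ->
  'D_v (fun z => f z ^+ n) x = n%:R * f x ^+ n.-1 * 'D_v f x.
Proof.
move=> pf; elim: n => [|n IH]; first by rewrite !mul0r; exact: derive_cst.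
under [X in derive X _ _]eq_fun do rewrite exprS.
rewrite derive_polyfunM//; last exact: polyfunX.
rewrite IH; case: n {IH} => [|n]; first by rewrite !expr0 /=; ring.
by rewrite /= -[n.+2%:R]natr1 exprS; ring.
Qed.

Lemma derive_coord i j x : 'D_(delta_mx 0 j) (fun z : rv => z 0 i) x = (i == j)%:R.
Proof. by case: (is_derive_coord x (delta_mx 0 j) i) => _ ->; rewrite mxE eqxx. Qed.

Lemma derive_dotp (z : rv) j x : 'D_(delta_mx 0 j) (fun x => dotp x z) x = z 0 j.
Proof.
rewrite derive_sum_polyfun; last first.
  by move=> i; apply: polyfunM; [exact: polyfun_coord|exact: polyfun_cst].
rewrite (bigD1 j)//= big1 ?addr0 => [|i /negbTE ij]; rewrite derive_polyfunM ?derive_coord;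
  do ?[exact: polyfun_coord|exact: polyfun_cst].
  by rewrite eqxx derive_cst mul1r mulr0 addr0.
by rewrite ij derive_cst mul0r mulr0 addr0.
Qed.

Lemma derive_dotpp j x : 'D_(delta_mx 0 j) (fun x : rv => dotp x x) x = 2 * x 0 j.
Proof.
rewrite derive_sum_polyfun; last by move=> i; apply: polyfunM; exact: polyfun_coord.
rewrite (bigD1 j)//= big1 ?addr0 => [|i /negbTE ij]; rewrite derive_polyfunM ?derive_coord;
  do ?[exact: polyfun_coord].
  by rewrite eqxx mul1r mulr1 mulr_natl mulr2n.
by rewrite ij mul0r mulr0 addr0.
Qed.

Definition directional F x : cl := \sum_j (y 0 j)%:C *: partial j F x.

Lemma hpoly_directional d M : hpoly d.+1 M -> hpoly d (directional M).
Proof. by move=> pM; apply: hpoly_sum => j _; apply: hpolyZ; exact: (hpoly_partial j pM). Qed.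

Lemma Dirac_directional d M : hpoly d M -> (forall x, Dirac M x = 0) ->
  forall x, Dirac (directional M) x = 0.
Proof.
move=> pM M0 x; have cM := hpoly_clpolyfun pM.
have cpM j : clpolyfun (partial j M) by exact: clpolyfun_partial.
have DP j : \sum_i e i * partial i (partial j M) x = 0.
  transitivity (partial j (Dirac M) x); last first.
    by rewrite (_ : Dirac M = fun=> 0) ?partial_cst//; exact/funext.
  rewrite /Dirac partial_sum; last first.
    by move=> i; apply: clpolyfunM => //; exact: clpolyfun_cst.
  apply: eq_bigr => i _; rewrite partialM//; last exact: clpolyfun_cst.
  by rewrite partial_cst mul0r add0r partialC.
rewrite /Dirac /directional.
have zp c j : clpolyfun (fun x => c%:C *: partial j M x).
  by apply: clpolyfunZ => //; exact: polyfun_cst.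
under eq_bigr => i _.
  rewrite partial_sum// mulr_sumr.
  under eq_bigr => j _.
    rewrite partialZ//; last exact: polyfun_cst.
    rewrite derive_cst scale0r add0r -scalerAr; over.
  over.
rewrite exchange_big /= big1// => j _.
by rewrite -scaler_sumr DP scaler0.
Qed.

(** Under the Gaussian weight, multiplication by <x,y> is half the derivative in the direction y. *)
Lemma clgint_dotp F : clpolyfun F ->
  clgint (fun x => (dotp x y)%:C *: F x) = (2^-1)%:C *: clgint (directional F).
Proof.
move=> pF; have cp j : clpolyfun (partial j F) by exact: clpolyfun_partial.
rewrite (_ : (fun x => _) = fun x => \sum_j (y 0 j)%:C *: ((x 0 j)%:C *: F x)); last first.
  apply/funext => x; rewrite /dotp rmorph_sum scaler_suml; apply: eq_bigr => j _.
  by rewrite scalerA -real_complexM mulrC.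
have pj j : clpolyfun (fun x => (x 0 j)%:C *: F x).
  by apply: clpolyfunZ => //; exact: polyfun_coord.
rewrite [LHS](@clgint_sum _ _ _ _ (fun j x => (y 0 j)%:C *: ((x 0 j)%:C *: F x))); last first.
  by move=> j; exact: clpolyfun_scale (pj j).
rewrite [in RHS]/directional [in RHS](@clgint_sum _ _ _ _ (fun j x => (y 0 j)%:C *: partial j F x)); last first.
  by move=> j; exact: clpolyfun_scale (cp j).
rewrite scaler_sumr; apply: eq_bigr => j _.
by rewrite [LHS](clgintZ _ (pj j)) [in RHS](clgintZ _ (cp j)) (clgint_coordM j pF) !scalerA mulrC.
Qed.

Lemma directional_dotpX n F x : clpolyfun F ->
  directional (fun x => (dotp x y ^+ n)%:C *: F x) x =
  (n%:R * dotp x y ^+ n.-1 * dotp y y)%:C *: F x +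
  (dotp x y ^+ n)%:C *: directional F x.
Proof.
move=> pF.
have E1 : \sum_j (y 0 j * (n%:R * dotp x y ^+ n.-1 * y 0 j)) =
    n%:R * dotp x y ^+ n.-1 * dotp y y.
  by rewrite /dotp mulr_sumr; apply: eq_bigr => j _; ring.
have E2 : \sum_j (y 0 j)%:C *: ((dotp x y ^+ n)%:C *: partial j F x) =
    (dotp x y ^+ n)%:C *: directional F x.
  by rewrite scaler_sumr; apply: eq_bigr => j _; rewrite !scalerA mulrC.
rewrite -E1 -E2 rmorph_sum scaler_suml -big_split; apply: eq_bigr => j _.
rewrite partialZ//; last by apply: polyfunX; exact: polyfun_dotp.
rewrite derive_polyfunX; last exact: polyfun_dotp.
by rewrite derive_dotp scalerDr scalerA -real_complexM.
Qed.

Lemma clpolyfun_dotpX n F : clpolyfun F -> clpolyfun (fun x => (dotp x y ^+ n)%:C *: F x).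
Proof.
by move=> pF; apply: clpolyfunZ => //; apply: polyfunX; exact: polyfun_dotp.
Qed.

(* The Gaussian form of the Hecke-Bochner formula, in the lowest degrees. *)
Lemma clgint_dotpX n l M : hpoly l M -> (forall x, Dirac M x = 0) -> (n <= l)%N ->
  clgint (fun x => (dotp x y ^+ n)%:C *: M x) =
  ((n == l)%:R * (Num.sqrt pi ^+ m * (l`!%:R / 2 ^+ l)))%:C *: M y.
Proof.
(* Strong induction: after one factor <x,y> is integrated by parts, the derivative of the remaining
   power leaves an exponent two lower with the same M, while the derivative of M lowers n and l
   together. *)
have [k] := ubnP n; elim: k n l M => // k IH n l M.
rewrite ltnS => nk pM M0 nl; have cM := hpoly_clpolyfun pM.
case: n nk nl => [|n] nk nl.
  rewrite (_ : (fun x => _) = M); last by apply/funext => x; rewrite scale1r.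
  case: l pM nl => [|l] pM _.
    rewrite (_ : M = fun=> M y); last first.
      by apply/funext => x; exact: hpoly_degree0.
    by rewrite clgint_cst eqxx mul1r divr1 mulr1.
  (* The constant 1 is monogenic of degree 0, hence orthogonal to M when l > 0. *)
  rewrite mul0r scale0r -[RHS](@clgint_monogenic_degree _ _ 0 l.+1 (fun=> 1) M)//.
  - by congr clgint; apply/funext => x; rewrite mul1r.
  - exact: hpoly_cst.
  - by move=> x; rewrite /Dirac_r big1// => j _; rewrite partial_cst mul0r.
case: l pM nl => // l pM nl.
rewrite (_ : (fun x => _) = fun x => (dotp x y)%:C *: ((dotp x y ^+ n)%:C *: M x)); last first.
  by apply/funext => x; rewrite scalerA -real_complexM exprS.
rewrite clgint_dotp; last exact: clpolyfun_dotpX.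
have -> : directional (fun x => (dotp x y ^+ n)%:C *: M x) = fun x =>
    (n%:R * dotp y y)%:C *: ((dotp x y ^+ n.-1)%:C *: M x) +
    (dotp x y ^+ n)%:C *: directional M x.
  apply/funext => x; rewrite directional_dotpX//.
  by rewrite [n%:R * _ * dotp y y]mulrAC (real_complexM (n%:R * dotp y y)) -scalerA.
have pdM := hpoly_directional pM; have cdM := hpoly_clpolyfun pdM.
rewrite clgintD; last 2 first.
- by apply: clpolyfunZ; [exact: polyfun_cst|exact: clpolyfun_dotpX].
- exact: clpolyfun_dotpX.
rewrite clgintZ; last exact: clpolyfun_dotpX.
(* The exponent n - 1 is below the degree l + 1 of M; for n = 0 the coefficient is 0. *)
rewrite [X in _ *: (X + _)](_ : _ = 0); last first.
  case: n nk nl => [|n] nk nl; first by rewrite mul0r scale0r.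
  rewrite (IH n l.+1)//; [|lia..].
  by rewrite (_ : (n == l.+1) = false) ?mul0r ?scale0r ?scaler0//; apply/negP; lia.
rewrite add0r (IH n l _ nk pdM (Dirac_directional pM M0) nl).
(* The directional derivative of M is evaluated at y itself, where Euler's identity returns (l + 1)
   M y; with the factor 1/2 this is one step of l! / 2^l. *)
rewrite eqSS /directional (hpoly_euler _ pM).
rewrite !scalerA -(@real_complex_nat R l.+1) -!real_complexM; congr (_%:C *: _).
by rewrite factS natrM exprS; field.
Qed.

(** The vector x is integrated by parts: M is monogenic, and the derivative of <x,y>^n is n
    <x,y>^(n-1) y, whose power is too low to pair with M. *)
Lemma clgint_dotpX_vec n l M : hpoly l M -> (forall x, Dirac M x = 0) -> (n <= l)%N ->
  clgint (fun x => (dotp x y ^+ n)%:C *: (vec x * M x)) = 0.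
Proof.
move=> pM M0 nl; have cM := hpoly_clpolyfun pM.
have c1 : clpolyfun (fun x => (dotp x y ^+ n)%:C *: 1 : cl).
  by apply: clpolyfun_dotpX; exact: clpolyfun_cst.
rewrite (_ : (fun x => _) = fun x => ((dotp x y ^+ n)%:C *: 1) * vec x * M x); last first.
  by apply/funext => x; rewrite -!scalerAl mul1r.
rewrite clgint_vec// (_ : (fun x => _) = fun x =>
    (n%:R)%:C *: (vec y * ((dotp x y ^+ n.-1)%:C *: M x))); last first.
  apply/funext => x; rewrite M0 mulr0 addr0 /Dirac_r.
  under eq_bigr => j _.
    rewrite partialZ; [|by apply: polyfunX; exact: polyfun_dotp|exact: clpolyfun_cst].
    rewrite partial_cst scaler0 addr0 derive_polyfunX; last exact: polyfun_dotp.
    rewrite derive_dotp real_complexM -scalerA -scalerAl.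
    rewrite -[_ *: 1 * _]scalerAl mul1r.
    over.
  rewrite /= -scaler_sumr -/(vec y) -scalerAl -scalerAr scalerA -real_complexM.
  by [].
case: n nl {c1} => [|n] nl.
  rewrite (_ : (fun x => _) = fun=> 0); last by apply/funext => x; rewrite scale0r.
  by rewrite clgint_cst !scaler0.
rewrite clgintZ; last by apply: clpolyfunM; [exact: clpolyfun_cst|exact: clpolyfun_dotpX].
rewrite clgint_mull; last exact: clpolyfun_dotpX.
rewrite (clgint_dotpX pM)//=; last exact: ltnW.
by rewrite ltn_eqF// mul0r scale0r mulr0 !scaler0.
Qed.

(** One x_j of each x_j^2 is integrated by parts: m from the derivatives of the other x_j, d from
    Euler's identity. *)
Lemma clgint_sqr d F : hpoly d F ->
  clgint (fun x => (dotp x x)%:C *: F x) = ((m + d)%:R / 2)%:C *: clgint F.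
Proof.
move=> pF; have cF := hpoly_clpolyfun pF.
have pj j : clpolyfun (fun x => (x 0 j)%:C *: F x).
  by apply: clpolyfunZ => //; exact: polyfun_coord.
rewrite (_ : (fun x => _) = fun x => \sum_j (x 0 j)%:C *: ((x 0 j)%:C *: F x)); last first.
  apply/funext => x; rewrite /dotp rmorph_sum scaler_suml; apply: eq_bigr => j _.
  by rewrite scalerA -real_complexM.
rewrite clgint_sum; last by move=> j; apply: clpolyfunZ => //; exact: polyfun_coord.
under eq_bigr do rewrite clgint_coordM//.
rewrite -scaler_sumr -clgint_sum; last by move=> j; exact: clpolyfun_partial.
rewrite (_ : (fun x => _) = fun x => ((m + d)%:R : R[i]) *: F x); last first.
  apply/funext => x; under eq_bigr => j _.
    rewrite partialZ//; last exact: polyfun_coord.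
    rewrite derive_coord eqxx scale1r; over.
  rewrite /= big_split /= (hpoly_euler _ pF) sumr_const card_ord natrD scalerDl.
  by rewrite !scaler_nat.
by rewrite clgintZ// scalerA mulrC real_complexM real_complex_nat.
Qed.

Lemma hpoly_dotppX n d F : hpoly d F ->
  hpoly (n * 2 + d) (fun x => (dotp x x ^+ n)%:C *: F x).
Proof. by move=> pF; apply: hpoly_scale => //; apply: hpoly_realX; exact: hpoly_sqr. Qed.

Lemma clgint_dotppX n d F : hpoly d F -> clgint F = 0 ->
  clgint (fun x => (dotp x x ^+ n)%:C *: F x) = 0.
Proof.
move=> pF F0; elim: n => [|n IH].
  by rewrite -[RHS]F0; congr clgint; apply/funext => x; rewrite expr0 scale1r.
rewrite (_ : (fun x => _) = fun x => (dotp x x)%:C *: ((dotp x x ^+ n)%:C *: F x)); last first.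
  by apply/funext => x; rewrite scalerA -real_complexM exprS.
by rewrite (clgint_sqr (hpoly_dotppX n pF)) IH scaler0.
Qed.

End Reproducing.

(** * The monogenic kernel *)

Section Gradient.
Context {R : realType} (m : nat).
Local Notation rv := 'rV[R]_m.
Local Notation cl := (cliff R m).
Local Notation e := (gen R).
Implicit Types (p : rv -> R) (F : rv -> cl) (x y c : rv).

Definition gradient p x : cl := \sum_j ('D_(delta_mx 0 j) p x)%:C *: e j.

Lemma Dirac_rZ p F x : polyfun p -> clpolyfun F ->
  Dirac_r (fun z => (p z)%:C *: F z) x = F x * gradient p x + (p x)%:C *: Dirac_r F x.
Proof.
move=> pp pF; rewrite /Dirac_r /gradient mulr_sumr scaler_sumr -big_split /=.
apply: eq_bigr => j _; rewrite partialZ// mulrDl; congr (_ + _).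
  by rewrite -scalerAl -scalerAr.
by rewrite -scalerAl.
Qed.

Lemma Dirac_real p x : polyfun p -> Dirac (fun z => (p z)%:C *: (1 : cl)) x = gradient p x.
Proof.
move=> pp; apply: eq_bigr => j _.
rewrite partialZ//; last exact: clpolyfun_cst.
by rewrite partial_cst scaler0 addr0 -scalerAr mulr1.
Qed.

Lemma Dirac_r_cst (a : cl) x : Dirac_r (fun=> a) x = 0.
Proof. by rewrite /Dirac_r big1// => j _; rewrite partial_cst mul0r. Qed.

Lemma Dirac_rD F (H : rv -> cl) x : clpolyfun F -> clpolyfun H ->
  Dirac_r (fun z => F z + H z) x = Dirac_r F x + Dirac_r H x.
Proof.
move=> pF pH; rewrite /Dirac_r -big_split; apply: eq_bigr => j _.
by rewrite partialD// mulrDl.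
Qed.

Lemma Dirac_r_mull (a : cl) F x : clpolyfun F ->
  Dirac_r (fun z => a * F z) x = a * Dirac_r F x.
Proof.
move=> pF; rewrite /Dirac_r mulr_sumr; apply: eq_bigr => j _.
rewrite partialM//; last exact: clpolyfun_cst.
by rewrite partial_cst mul0r add0r mulrA.
Qed.

Lemma Dirac_r_vec x : Dirac_r (@vec R m) x = - (m%:R)%:C *: 1.
Proof.
rewrite /Dirac_r; under eq_bigr do rewrite partial_vec.
by rewrite sum_gen_sqr real_complex_nat.
Qed.

Lemma gradient_dotp c x : gradient (fun z => dotp z c) x = vec c.
Proof. by apply: eq_bigr => j _; rewrite derive_dotp. Qed.

Lemma gradient_dotpp x : gradient (fun z => dotp z z) x = 2%:C *: vec x.
Proof.
rewrite /vec scaler_sumr; apply: eq_bigr => j _.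
by rewrite derive_dotpp real_complexM scalerA.
Qed.

Lemma gradient_mull (r : R) p x : polyfun p ->
  gradient (fun z => r * p z) x = r%:C *: gradient p x.
Proof.
move=> pp; rewrite /gradient scaler_sumr; apply: eq_bigr => j _.
rewrite (derive_polyfunM _ _ (polyfun_cst _ _) pp) derive_cst mul0r add0r.
by rewrite scalerA -real_complexM.
Qed.

Lemma polyfun_hgeg l k (s q : rv -> R) : polyfun s -> polyfun q ->
  polyfun (fun x => hgeg l k (s x) (q x)).
Proof.
move=> ps pq; case: k => n /=; last exact: polyfun_cst.
apply: polyfun_sum => j _; apply: polyfunM; last exact: polyfunX.
apply: polyfunM; first exact: polyfun_cst.
by apply: polyfunX; apply: polyfunM => //; exact: polyfun_cst.
Qed.

Lemma derive_hgeg l k (s q : rv -> R) (v x : rv) : polyfun s -> polyfun q ->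
  'D_v (fun x => hgeg l k (s x) (q x)) x =
  2 * l * hgeg (l + 1) (k - 1) (s x) (q x) * 'D_v s x -
  l * hgeg (l + 1) (k - 2) (s x) (q x) * 'D_v q x.
Proof.
move=> ps pq; rewrite -mulNr -mulNr -hgeg_ds -hgeg_dq.
case: k => n /=; last by rewrite !mul0r addr0 derive_cst.
rewrite /hgegnat !mulr_suml -big_split /= [RHS]big_mkcond.
under [X in derive X _ _]eq_fun do rewrite big_mkcond.
have p2s : polyfun (fun x => 2 * s x) by apply: polyfunM => //; exact: polyfun_cst.
rewrite derive_sum_polyfun; last first.
  move=> j; case: (2 * j <= n)%N; last exact: polyfun_cst.
  apply: polyfunM; last exact: polyfunX.
  by apply: polyfunM; [exact: polyfun_cst|exact: polyfunX].
apply: eq_bigr => j _; case: (2 * j <= n)%N; last exact: derive_cst.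
set a := (n - 2 * j)%N; set g := gegcoef l a j.
have pa : polyfun (fun x => (2 * s x) ^+ a) by exact: polyfunX.
have pga : polyfun (fun x => g * (2 * s x) ^+ a).
  by apply: polyfunM => //; exact: polyfun_cst.
rewrite (derive_polyfunM _ _ pga (polyfunX j pq)) (derive_polyfunX j _ _ pq).
rewrite (derive_polyfunM _ _ (polyfun_cst _ g) pa) derive_cst (derive_polyfunX a _ _ p2s).
rewrite (derive_polyfunM _ _ (polyfun_cst _ 2) ps) derive_cst.
by ring.
Qed.

(** Polynomial in [x] and symmetric in [x] and [c], so that one gradient formula serves the Dirac
    operators in both variables. *)
Definition zonal c l k x : R := hgeg l k (dotp x c) (dotp x x * dotp c c).

Lemma zonalC c l k x : zonal c l k x = zonal x l k c.
Proof. by rewrite /zonal dotpC mulrC. Qed.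

Lemma polyfun_zonal c l k : polyfun (zonal c l k).
Proof.
apply: polyfun_hgeg; first exact: polyfun_dotp.
by apply: polyfunM; [exact: polyfun_dotpp|exact: polyfun_cst].
Qed.

Lemma gradient_zonal c l k x : gradient (zonal c l k) x =
  (2 * l * zonal c (l + 1) (k - 1) x)%:C *: vec c -
  (2 * l * dotp c c * zonal c (l + 1) (k - 2) x)%:C *: vec x.
Proof.
rewrite /vec !scaler_sumr -sumrB; apply: eq_bigr => j _.
rewrite derive_hgeg; last 2 first.
- exact: polyfun_dotp.
- by apply: polyfunM; [exact: polyfun_dotpp|exact: polyfun_cst].
rewrite derive_dotp (derive_polyfunM _ _ (@polyfun_dotpp R m) (polyfun_cst _ _)).
rewrite derive_cst derive_dotpp mulr0 addr0 -/(zonal c _ _ x) -/(zonal c _ _ x).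
by rewrite !scalerA -scalerBl -!real_complexM -rmorphB; congr (_%:C *: _); ring.
Qed.

End Gradient.

(** * Clifford computations in the span of two elements *)

Section LinearCombinations.
Context {K : comNzRingType} {V : algType K}.
Implicit Types (u v a b w : V) (p q r s : K).

(** A normal form: once both sides are combinations of the same two elements, the noncommutative
    identity splits into two identities of commuting coefficients, which [ring] decides. *)
Definition comb u v p q : V := p *: u + q *: v.

Lemma combD u v p q p' q' :
  comb u v p q + comb u v p' q' = comb u v (p + p') (q + q').
Proof. by rewrite /comb !scalerDl addrACA. Qed.

Lemma combZ u v r p q : r *: comb u v p q = comb u v (r * p) (r * q).
Proof. by rewrite /comb scalerDr !scalerA. Qed.

Lemma combN u v p q : - comb u v p q = comb u v (- p) (- q).
Proof. by rewrite /comb opprD !scaleNr. Qed.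

Lemma combl u v p : p *: u = comb u v p 0.
Proof. by rewrite /comb scale0r addr0. Qed.

Lemma combr u v q : q *: v = comb u v 0 q.
Proof. by rewrite /comb scale0r add0r. Qed.

Lemma eq_comb u v p q p' q' : p = p' -> q = q' -> comb u v p q = comb u v p' q'.
Proof. by move=> -> ->. Qed.

Lemma reverse_product a b w s :
  b * a = - (a * b) - (2 * s) *: 1 -> a * b = w - s *: 1 -> b * a = - w - s *: 1.
Proof.
move=> -> ->; rewrite -[w]scale1r !(combl 1 w) !(combr 1 w).
by rewrite !(combN, combD); apply: eq_comb; ring.
Qed.

(* The product rule computations of the kernel, in terms of a = x, b = y and
   w = x /\ y. *)
Lemma kernel_products a b w s X Y c p1 p2 p3 p4 z1 z2 k m h t g :
  a * b = w - s *: 1 -> b * a = - w - s *: 1 -> a * a = - X *: 1 -> b * b = - Y *: 1 ->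
  c *: (b * (k *: (p1 *: a - p2 *: b)) + z1 *: (- m *: 1) +
        (z2 *: a * (h *: (t *: b)) + g *: (a * (p3 *: a - p4 *: b)))) =
  (c * (k * (- p1 * s + p2 * Y) - z1 * m - z2 * h * t * s + g * (- p3 * X + p4 * s))) *: 1 +
  (c * (- k * p1 + z2 * h * t - g * p4)) *: w.
Proof.
move=> ab ba aa bb.
rewrite !(mulrBr, =^~ scalerAr, =^~ scalerAl) aa ab ba bb -[w]scale1r.
rewrite !(combl 1 w) !(combr 1 w) !(combN, combD, combZ); apply: eq_comb; ring.
Qed.

(** The product rule for the right Dirac operator on [dagger_kernel], with a = x and b = y. The
    relations b a a = - X b and b a b = Y a - 2 s b bring every product back to the span of the two
    vectors. *)
Lemma kernel_monogenic a b s X Y al p1 p2 p3 p4 z m :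
  a * b = - (b * a) - (2 * s) *: 1 -> a * a = - X *: 1 -> b * b = - Y *: 1 ->
  al *: (p1 *: b - p2 *: a) + (s *: 1 + b * a) * (p3 *: b - p4 *: a) +
    z *: (b + b * (- m *: 1)) =
  (al * p1 - p3 * s + p4 * X + z * (1 - m)) *: b +
  (- al * p2 + p3 * Y - p4 * s) *: a.
Proof.
move=> ab aa bb.
have baa : b * a * a = - X *: b by rewrite -mulrA aa -scalerAr mulr1.
have bab : b * a * b = Y *: a - (2 * s) *: b.
  by rewrite -mulrA ab mulrBr mulrN mulrA bb -scalerAl mul1r -scalerAr mulr1 scaleNr opprK.
rewrite mulrDl !mulrBr -!scalerAr -!scalerAl !mul1r bab baa mulr1 -[in z *: (b + _)](scale1r b).
rewrite !(combl b a) !(combr b a) !(combN, combD, combZ); apply: eq_comb; ring.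
Qed.

End LinearCombinations.

(** The scalar part of the kernel. Here [zt] has parameter mu and degree k; [z1], [z2], [z'] have
    parameter mu + 1 and degrees k, k - 1, k - 2; [p1], [p2], [p3] have parameter mu + 2 and degrees
    k - 1, k - 2, k - 3. The hypotheses are instances of [hgeg_euler] and [hgeg_shift]. *)
Lemma kernel_scalar_identity (K : fieldType) (k mu m mk s X Y z1 z2 z' p1 p2 p3 zt : K) :
  mu != 0 -> mk != 0 -> m = 2 * mu + 2 -> mk = m + 2 * k -> (2 : K) != 0 ->
  k * z1 = 2 * (mu + 1) * (s * p1 - Y * X * p2) ->
  (k - 2 + 2 * (mu + 1)) * z' = 2 * (mu + 1) * (p2 - s * p3) ->
  k * zt = 2 * mu * (s * z2 - Y * X * z') ->
  (k + 2 * mu) * zt = 2 * mu * (z1 - s * z2) ->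
  - mk ^- 2 * (mk * (- (2 * (mu + 1) * p1) * s + 2 * (mu + 1) * X * p2 * Y) -
     mk * z1 * m - z2 * - mk * 2 * s +
     - mk * Y * (- (2 * (mu + 1) * p2) * X + 2 * (mu + 1) * X * p3 * s)) =
  (2 * mu + k) / (2 * mu) * zt.
Proof.
move=> mu0 mk0 mE mkE two0 E1 E2 E3 E4.
(* [E3] and [E4] give k [zt] and (k + 2 mu) [zt]; cross-multiplication eliminates [zt]. The factor k
   + 2 mu is also the one on the left of [E2]. *)
have E : (k + 2 * mu) * (Y * X * z') = (k + 2 * mu) * (s * z2) - k * (z1 - s * z2).
  apply: (mulfI (mulf_neq0 two0 mu0)).
  transitivity ((k + 2 * mu) * (2 * mu * (s * z2) - 2 * mu * (s * z2 - Y * X * z'))).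
    by ring.
  rewrite -E3 [RHS]mulrBr; transitivity ((k + 2 * mu) * (2 * mu * (s * z2)) -
    k * (2 * mu * (z1 - s * z2))); last by ring.
  by rewrite -E4; ring.
have -> : (2 * mu + k) / (2 * mu) * zt = z1 - s * z2.
  transitivity ((k + 2 * mu) * zt / (2 * mu)); first by ring.
  by rewrite E4; field; rewrite two0 mu0.
transitivity (- mk ^- 2 * (mk * (- (mk * (z1 - s * z2))))); last by field.
congr (_ * _).
transitivity (mk * (- (2 * (mu + 1) * (s * p1 - Y * X * p2)) +
  Y * X * (2 * (mu + 1) * (p2 - s * p3)) - m * z1 + 2 * s * z2)); first by ring.
congr (_ * _); rewrite -E1 -E2.
transitivity (- (k * z1) + (k + 2 * mu) * (Y * X * z') - m * z1 + 2 * s * z2).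
  by ring.
by rewrite E mkE mE; ring.
Qed.

(** The coefficient of the bivector x /\ y, with la = mu + 1. The last hypothesis is [hgeg_dim] in
    degree k - 1. *)
Lemma kernel_bivector_identity (K : fieldType) (k la mk X Y z2 p1 p3 : K) :
  mk != 0 -> mk = 2 * la + 2 * k ->
  (k - 1 + la) * z2 = la * (p1 - Y * X * p3) ->
  - mk ^- 2 * (- mk * (2 * la * p1) + z2 * - mk * 2 -
    - mk * Y * (2 * la * X * p3)) = z2.
Proof.
move=> mk0 mkE E.
transitivity (- mk ^- 2 * (- mk * (2 * (la * (p1 - Y * X * p3)) + 2 * z2))).
  by congr (_ * _); ring.
rewrite -E; transitivity (- mk ^- 2 * (- mk * ((2 * la + 2 * k) * z2))).
  by congr (_ * _); ring.
by rewrite -mkE; field.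
Qed.

Section Kernel.
Context {R : realType} (m : nat).
Hypothesis hm : (3 <= m)%N.
Local Notation rv := 'rV[R]_m.
Local Notation cl := (cliff R m).
Local Notation e := (gen R).
Local Notation mu := (gorder R m).
Implicit Types (x y : rv) (k : nat).

Lemma eq_scale2 (a b a' b' : R) (u v : cl) : a = a' -> b = b' ->
  a%:C *: u + b%:C *: v = a'%:C *: u + b'%:C *: v.
Proof. by move=> -> ->. Qed.

Lemma eq_scale2_real (a b : R[i]) (a' b' : R) (u v : cl) : a = a'%:C -> b = b'%:C ->
  a *: u + b *: v = a'%:C *: u + b'%:C *: v.
Proof. by move=> -> ->. Qed.

Lemma real_complexN (r : R) : (- r)%:C = - r%:C.
Proof. exact: rmorphN. Qed.

Lemma real_complexD (r s : R) : (r + s)%:C = r%:C + s%:C.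
Proof. exact: rmorphD. Qed.

Definition real_complexE :=
  (=^~ @real_complexM R, =^~ real_complexN, =^~ real_complexD).

Lemma vec_wedge_rev x y : vec y * vec x = - wedge x y - (dotp x y)%:C *: 1.
Proof.
have ba := vec_anticomm y x; rewrite dotpC real_complexM real_complex_nat in ba.
exact: (reverse_product ba (vec_wedge x y)).
Qed.

Lemma gorderE : mu = (m - 2)%:R / 2.
Proof. by rewrite /gorder natrB; [field|exact: ltnW]. Qed.

Lemma gorder_gt0 : 0 < mu.
Proof. by rewrite gorderE divr_gt0// ltr0n subn_gt0. Qed.

Lemma gorderD1 : mu + 1 = m%:R / 2.
Proof. by rewrite /gorder subrK. Qed.

Lemma Gamma_gorder_neq0 : Gamma mu != 0.
Proof. by rewrite gorderE gt_eqF// Gamma_half_gt0// subn_gt0. Qed.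

Lemma Gamma_gorderD1_neq0 : Gamma (mu + 1) != 0.
Proof. by rewrite gorderD1 gt_eqF// Gamma_half_gt0//; exact: ltn_trans hm. Qed.

Lemma enorm_sqr x : enorm x ^+ 2 = dotp x x.
Proof. by rewrite sqr_sqrtr// sumr_ge0// => j _; rewrite -expr2 sqr_ge0. Qed.

Lemma enorm_eq0 x y : enorm x = 0 -> dotp x y = 0.
Proof.
move=> x0; have : dotp x x = 0 by rewrite -enorm_sqr x0 expr0n.
move=> /eqP; rewrite psumr_eq0; last by move=> j _; rewrite -expr2 sqr_ge0.
move=> /allP H; rewrite /dotp big1// => j _.
have := H j (mem_index_enum j); rewrite /= mulf_eq0 orbb => /eqP ->.
by rewrite mul0r.
Qed.

Lemma enorm_cosine x y : enorm x * enorm y * cosine x y = dotp x y.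
Proof.
rewrite /cosine; have [x0|x0] := eqVneq (enorm x) 0.
  by rewrite (enorm_eq0 _ x0) x0 !mul0r.
have [y0|y0] := eqVneq (enorm y) 0.
  by rewrite dotpC (enorm_eq0 _ y0) y0 !(mul0r, mulr0).
by rewrite mulrC divfK// mulf_neq0.
Qed.

(** Zero vectors are covered, since the cosine only enters through |x| |y| t, which is <x,y> in all
    cases by [enorm_cosine]. *)
Lemma gegenbauer_zonal (nu : R) n x y : 0 < nu -> Gamma nu != 0 ->
  enorm x ^+ n * enorm y ^+ n * gegenbauer n nu (cosine x y) = zonal y nu n x.
Proof.
move=> nu0 G0; rewrite /gegenbauer /zonal /hgeg /hgegnat mulr_sumr.
rewrite [RHS](@big_cat_nat _ _ _ n./2.+1)//=; last by lia.
rewrite [X in _ + X]big_nat_cond [X in _ + X]big_pred0 ?addr0; last first.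
  by move=> j; apply/negP; lia.
rewrite [RHS]big_mkcond /= big_nat_cond [RHS]big_nat_cond.
apply: eq_bigr => j jn; have -> : (2 * j <= n)%N by lia.
(* Of the n factors |x| |y|, n - 2 j join the powers of t to form <x,y> and 2 j form q^j. *)
rewrite -exprMn Gamma_rising// -{1}(@enorm_cosine x y).
rewrite -!enorm_sqr -exprMn -exprM.
set t := cosine x y; rewrite (exprMn_comm _ (mulrC 2 t)) (exprMn_comm _ (mulrC 2 _)).
rewrite (exprMn_comm _ (mulrC _ t)).
have -> : (n - j = n - 2 * j + j)%N by lia.
have -> : (enorm x * enorm y) ^+ n =
    (enorm x * enorm y) ^+ (n - 2 * j) * (enorm x * enorm y) ^+ (2 * j).
  by rewrite -exprD subnK//; lia.
by rewrite /gegcoef; field; rewrite G0 !factr_neq0.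
Qed.

Lemma harmonic_kernelE n x y :
  harmonic_kernel n x y = (n%:R + mu) / mu * zonal y mu n x.
Proof.
rewrite -gegenbauer_zonal ?gorder_gt0 ?Gamma_gorder_neq0//.
by rewrite /harmonic_kernel; ring.
Qed.

Definition closed_scalar k : R := (2 * mu + k%:R) / (2 * mu).

Lemma monogenic_kernel_closedE k x y : monogenic_kernel_closed k x y =
  (closed_scalar k * zonal y mu k x)%:C *: 1 +
  (zonal y (mu + 1) (k%:Z - 1) x)%:C *: wedge x y.
Proof.
rewrite /monogenic_kernel_closed /cliff_real; apply: eq_scale2.
  rewrite -gegenbauer_zonal ?gorder_gt0 ?Gamma_gorder_neq0//.
  by rewrite /closed_scalar !mulrA.
(* For k = 0 the inverse norms are multiplied by C_(-1) = 0. *)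
case: k => [|k]; first by rewrite /= mulr0.
rewrite (_ : k.+1%:Z - 1 = k); last by rewrite intS addrC addKr.
rewrite -gegenbauer_zonal//; first by rewrite addr_gt0// gorder_gt0.
exact: Gamma_gorderD1_neq0.
Qed.

Lemma monogenic_kernelE k x y :
  monogenic_kernel k x y = monogenic_kernel_closed k x y.
Proof.
have mu0 : mu != 0 by rewrite gt_eqF// gorder_gt0.
set la := mu + 1; set a := vec x.
set mk : R := (m + 2 * k)%:R.
have k11 : k%:Z - 1 - 1 = k%:Z - 2 by lia.
have k12 : k%:Z - 1 - 2 = k%:Z - 3 by lia.
have k21 : k%:Z - 2 - 1 = k%:Z - 3 by lia.
have mE : m%:R = 2 * mu + 2 :> R by rewrite /gorder; field.
have mkE' : mk = m%:R + 2 * k%:R by rewrite /mk natrD natrM.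
have mk0 : mk != 0 by rewrite pnatr_eq0 -lt0n addn_gt0 (ltn_trans _ hm).
(* The factor (k + 1 + mu) / mu of the harmonic kernel times the 2 mu of the gradient is m + 2 k,
   whence the normalisation c_k. *)
have mkE : mk = 2 * (k.+1%:R + mu) by rewrite /mk /gorder natrD natrM -natr1; field.
have pz c l n : polyfun (zonal c l n : rv -> R) by exact: polyfun_zonal.
have DE z : Dirac (fun x' => cliff_real m (harmonic_kernel k.+1 x' z)) x =
    (mk * zonal x la k z)%:C *: vec z +
    (- mk * dotp z z)%:C *: ((zonal x la (k%:Z - 1) z)%:C *: a).
  rewrite /cliff_real (_ : (fun x' => _) =
    fun x' => ((k.+1%:R + mu) / mu * zonal z mu k.+1 x')%:C *: 1); last first.
    by apply/funext => x'; rewrite harmonic_kernelE.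
  rewrite Dirac_real; last by
    apply: polyfunM => //; exact: polyfun_cst.
  rewrite gradient_mull//.
  (* The symmetry turns the result into a polynomial in z with x fixed, ready for the operator in
     y. *)
  rewrite gradient_zonal -/la -/a !(zonalC z).
  rewrite (_ : k.+1%:Z - 1 = k); last by rewrite intS addrC addKr.
  rewrite (_ : k.+1%:Z - 2 = k%:Z - 1); last by rewrite intS; lia.
  rewrite scalerBr !scalerA -!real_complexM -scaleNr -rmorphN; apply: eq_scale2.
    by rewrite mkE; field.
  by rewrite mkE; field.
rewrite /monogenic_kernel.
rewrite (_ : (fun y' => _) = fun z => (mk * zonal x la k z)%:C *: vec z +
    (- mk * dotp z z)%:C *: ((zonal x la (k%:Z - 1) z)%:C *: a)); last exact/funext.
have p2 : polyfun (fun z : rv => - mk * dotp z z).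
  by apply: polyfunM; [exact: polyfun_cst|exact: polyfun_dotpp].
have c2 : clpolyfun (fun z => (zonal x la (k%:Z - 1) z)%:C *: a).
  by apply: clpolyfunZ => //; exact: clpolyfun_cst.
have p1 : polyfun (fun z => mk * zonal x la k z).
  by apply: polyfunM => //; exact: polyfun_cst.
rewrite Dirac_rD; [|by apply: clpolyfunZ => //; exact: clpolyfun_vec|exact: clpolyfunZ].
rewrite Dirac_rZ//; last exact: clpolyfun_vec.
rewrite Dirac_rZ// Dirac_rZ//; last exact: clpolyfun_cst.
rewrite Dirac_r_vec Dirac_r_cst scaler0 addr0 !gradient_mull//; last exact: polyfun_dotpp.
rewrite !gradient_zonal gradient_dotpp -/a.
set b := vec y; set w := wedge x y; set s := dotp x y.
set X := dotp x x; set Y := dotp y y.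
have ab : a * b = w - s%:C *: 1 by exact: vec_wedge.
have ba : b * a = - w - s%:C *: 1 by exact: vec_wedge_rev.
have aa : a * a = - X%:C *: 1 by exact: vec_sqr.
have bb : b * b = - Y%:C *: 1 by exact: vec_sqr.
rewrite (kernel_products _ _ _ _ _ _ _ _ _ _ _ _ ab ba aa bb).
rewrite monogenic_kernel_closedE -/w -/la !(zonalC y); apply: eq_scale2_real.
  rewrite !real_complexE; congr (_%:C).
  (* These relations link the parameters mu, mu + 1 and mu + 2 that two differentiations bring
     in. *)
  have := hgeg_euler la k s (Y * X); have := hgeg_shift la (k%:Z - 2) s (Y * X).
  have := hgeg_euler mu k s (Y * X); have := hgeg_shift mu k s (Y * X).
  rewrite -/la k11 k12 k21 intrB -(pmulrn 1 k) -/(k%:R).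
  rewrite /zonal (dotpC y x) -/s -/X -/Y -/mk.
  move: (hgeg la (k%:Z - 1) s (Y * X)) (hgeg la k s (Y * X)) (hgeg mu k s (Y * X)).
  move=> z2 z1 zt E4 E3 E2 E1.
  by apply: (kernel_scalar_identity mu0 mk0 mE mkE' _ E1 E2 E3 E4); rewrite pnatr_eq0.
rewrite !real_complexE; congr (_%:C).
have := hgeg_dim la (k%:Z - 1) s (Y * X).
rewrite k12 intrB -(pmulrn 1 k) -/(k%:R).
rewrite /zonal (dotpC y x) -/s -/X -/Y -/mk => E.
rewrite mulr1z in E.
apply: (@kernel_bivector_identity R k%:R la mk X Y _ _ _ mk0 _ E).
by rewrite mkE' mE /la; ring.
Qed.

End Kernel.

(** * The reproducing property *)

Section DaggerKernel.
Context {R : realType} (m : nat).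
Hypothesis hm : (3 <= m)%N.
Local Notation rv := 'rV[R]_m.
Local Notation cl := (cliff R m).
Local Notation mu := (gorder R m).
Implicit Types (x y : rv) (k : nat).

(** This is y /\ x, the conjugate of x /\ y. In the product y x the constant y stands on the left,
    out of reach of the Dirac operator that acts from the right. *)
Definition bivector_kernel y x : cl := (dotp x y)%:C *: 1 + vec y * vec x.

Definition dagger_kernel k y x : cl :=
  (closed_scalar m k * zonal y mu k x)%:C *: 1 +
  (zonal y (mu + 1) (k%:Z - 1) x)%:C *: bivector_kernel y x.

Lemma dagger1 : dagger (1 : cl) = 1.
Proof.
apply/ffunP => A; rewrite ffunE cliff_1E; case: eqP => [->|_].
  by rewrite swaps0l rmorph1 mulr1.
by rewrite rmorph0 mulr0.
Qed.

Lemma dagger_monogenic_kernel k x y :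
  dagger (monogenic_kernel k x y) = dagger_kernel k y x.
Proof.
rewrite monogenic_kernelE// monogenic_kernel_closedE// daggerD !dagger_scale_real dagger1.
rewrite /dagger_kernel; congr (_ + _ *: _).
have -> : wedge x y = vec x * vec y + (dotp x y)%:C *: 1 by rewrite vec_wedge subrK.
by rewrite daggerD daggerM !dagger_vec mulrNN dagger_scale_real dagger1 addrC.
Qed.

Lemma hpoly_zonal (nu : R) n y : hpoly n (fun x => (zonal y nu n x)%:C *: (1 : cl)).
Proof.
pose a j := (n - 2 * j)%N.
apply: (@hpoly_eq _ _ n n (fun x => \sum_(0 <= j < n.+1 | (2 * j <= n)%N)
  (gegcoef nu (a j) j * 2 ^+ a j * dotp y y ^+ j)%:C *:
    ((dotp x y ^+ a j)%:C *: ((dotp x x ^+ j)%:C *: 1)))) => //.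
  move=> x; rewrite /zonal /hgeg /hgegnat rmorph_sum /= scaler_suml.
  apply: eq_bigr => j _; rewrite !scalerA -!real_complexM; congr (_%:C *: _).
  by rewrite (exprMn_comm _ (mulrC 2 _)) (exprMn_comm _ (mulrC _ (dotp y y))); ring.
apply: hpoly_sum => j jn; apply: hpolyZ.
apply: (@hpoly_eq _ _ (a j * 1 + j * 2) _ (fun x => (dotp x y ^+ a j)%:C *: ((dotp x x ^+ j)%:C *: 1))) => //.
  by rewrite muln1 /a mulnC [(j * 2)%N]mulnC; lia.
by apply: hpoly_scale; apply: hpoly_realX; [exact: hpoly_dotp|exact: hpoly_sqr].
Qed.

Lemma hpoly_bivector y : hpoly 1 (bivector_kernel y).
Proof.
by apply: hpolyD; [exact: hpoly_dotp|apply: hpolyMl; exact: hpoly_vec].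
Qed.

Lemma hpoly_dagger_kernel k y : hpoly k (dagger_kernel k y).
Proof.
apply: hpolyD.
  apply: (hpoly_eq _ _ (hpolyZ (closed_scalar m k)%:C (hpoly_zonal mu k y))) => // x.
  by rewrite scalerA -real_complexM.
case: k => [|k].
  by apply: (@hpoly_eq _ _ 0 0 (fun=> 0)) => [//|x|]; [rewrite /zonal /= scale0r|exact: hpoly0].
rewrite (_ : k.+1%:Z - 1 = k); last by rewrite intS addrC addKr.
rewrite -[k.+1]addn1.
by apply: hpoly_scale; [exact: hpoly_zonal|exact: hpoly_bivector].
Qed.

Lemma Dirac_r_dagger_kernel k y x : Dirac_r (dagger_kernel k y) x = 0.
Proof.
have mu0 : mu != 0 by rewrite gt_eqF// gorder_gt0.
have pz l n : polyfun (zonal y l n : rv -> R) by exact: polyfun_zonal.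
have p1 : polyfun (fun z => closed_scalar m k * zonal y mu k z).
  by apply: polyfunM => //; exact: polyfun_cst.
have cb : clpolyfun (bivector_kernel y) by exact: (hpoly_clpolyfun (hpoly_bivector y)).
have c1 : clpolyfun (fun=> 1 : cl) by exact: clpolyfun_cst.
have cv := @clpolyfun_vec R m.
have cyv : clpolyfun (fun z => vec y * vec z).
  by apply: clpolyfunM => //; exact: clpolyfun_cst.
have ps := polyfun_dotp y.
rewrite /dagger_kernel Dirac_rD; [|exact: clpolyfunZ|exact: clpolyfunZ].
rewrite (Dirac_rZ _ p1 c1) (Dirac_rZ _ (pz _ _) cb) Dirac_r_cst scaler0 addr0 mul1r.
rewrite (gradient_mull _ _ (pz _ _)) !gradient_zonal.
rewrite /bivector_kernel Dirac_rD//; last exact: clpolyfunZ.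
rewrite (Dirac_rZ _ ps c1) Dirac_r_cst scaler0 addr0 mul1r gradient_dotp.
rewrite (Dirac_r_mull _ _ cv) Dirac_r_vec addrA.
have ab := vec_anticomm x y; rewrite real_complexM real_complex_nat in ab.
rewrite (kernel_monogenic _ _ _ _ _ _ _ ab (vec_sqr x) (vec_sqr y)).
have k11 : k%:Z - 1 - 1 = k%:Z - 2 by lia.
have k12 : k%:Z - 1 - 2 = k%:Z - 3 by lia.
have k21 : k%:Z - 2 - 1 = k%:Z - 3 by lia.
have mE : m%:R = 2 * mu + 2 :> R by rewrite /gorder; field.
rewrite k11 k12 -[1 - _]/(1%:C - _) !real_complexE.
have := hgeg_euler (mu + 1) (k%:Z - 1) (dotp x y) (dotp x x * dotp y y).
have := hgeg_shift (mu + 1) (k%:Z - 2) (dotp x y) (dotp x x * dotp y y).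
rewrite k11 k12 k21 !intrB -(pmulrn 1 k) -/(k%:R).
rewrite -!/(zonal y _ _ x) => E1 E2.
(* With this value the coefficient of y vanishes by [hgeg_euler] in degree k - 1, and that of x by
   [hgeg_shift] in degree k - 2. *)
have cE : closed_scalar m k * (2 * mu) = 2 * mu + k%:R by rewrite /closed_scalar; field.
rewrite (_ : _ + zonal y (mu + 1) (k%:Z - 1) x * _ = 0); last first.
  transitivity ((closed_scalar m k * (2 * mu) + 1 - m%:R) * zonal y (mu + 1) (k%:Z - 1) x -
    2 * (mu + 1) * (dotp x y * zonal y (mu + 1 + 1) (k%:Z - 2) x -
      dotp x x * dotp y y * zonal y (mu + 1 + 1) (k%:Z - 3) x)); first by ring.
  by rewrite -E2 cE mE; ring.
rewrite scale0r add0r (_ : _ - _ * dotp x y = 0) ?scale0r//.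
transitivity (dotp y y * (2 * (mu + 1) * (zonal y (mu + 1 + 1) (k%:Z - 2) x -
     dotp x y * zonal y (mu + 1 + 1) (k%:Z - 3) x) -
    closed_scalar m k * (2 * mu) * zonal y (mu + 1) (k%:Z - 2) x)); first by ring.
by rewrite -E1 cE; ring.
Qed.

(** Every term except the leading (2 <x,y>)^n has a factor |x|^2 and a power of <x,y> below a + n,
    so it integrates to 0 by [clgint_dotppX]. The exponent a is 1 for the part of the bivector that
    contains <x,y>. *)
Lemma clgint_zonal (nu : R) a n d y F : hpoly d F ->
  (forall b, (b < a + n)%N -> clgint (fun x => (dotp x y ^+ b)%:C *: F x) = 0) ->
  clgint (fun x => (zonal y nu n x)%:C *: ((dotp x y ^+ a)%:C *: F x)) =
  (rising nu n * 2 ^+ n / n`!%:R)%:C *: clgint (fun x => (dotp x y ^+ (a + n))%:C *: F x).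
Proof.
move=> hF F0; have cF := hpoly_clpolyfun hF.
pose t j := if (2 * j <= n)%N then gegcoef nu (n - 2 * j) j * 2 ^+ (n - 2 * j) * dotp y y ^+ j else 0.
pose G j x := (dotp x x ^+ j)%:C *: ((dotp x y ^+ (a + (n - 2 * j)))%:C *: F x).
have hs j : hpoly (j * 1 + d) (fun x => (dotp x y ^+ j)%:C *: F x).
  by apply: hpoly_scale => //; apply: hpoly_realX; exact: hpoly_dotp.
have cG j : clpolyfun (G j) := hpoly_clpolyfun (hpoly_dotppX j (hs _)).
have -> : (fun x => (zonal y nu n x)%:C *: ((dotp x y ^+ a)%:C *: F x)) =
    fun x => \sum_(0 <= j < n.+1) (t j)%:C *: G j x.
  apply/funext => x; rewrite /zonal /hgeg /hgegnat big_mkcond rmorph_sum /= scaler_suml.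
  apply: eq_bigr => j _; rewrite /t /G; case: ifP => jn; last by rewrite !scale0r.
  rewrite !scalerA -!real_complexM; congr (_%:C *: _).
  by rewrite exprD (exprMn_comm _ (mulrC 2 _)) (exprMn_comm _ (mulrC _ (dotp y y))); ring.
rewrite clgint_sum; last by move=> j; apply: clpolyfun_scale.
rewrite big_nat_recl// big1 ?addr0; last first.
  move=> j _; rewrite (clgintZ _ (cG _)) /t; case: ifP => jn; last by rewrite scale0r.
  rewrite (clgint_dotppX _ (hs _)) ?scaler0//.
  by apply: F0; lia.
rewrite (clgintZ _ (cG _)) /t muln0 subn0 /= /gegcoef addn0; congr (_%:C *: clgint _).
  by rewrite !expr0 mul1r !mulr1 mulrAC.
by apply/funext => x; rewrite /G expr0 scale1r muln0 subn0.
Qed.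

(** The total weight of the scalar part and the bivector part. For k > 0 both are multiples of (mu +
    1)_(k-1), with factors mu + k/2 and k/2. *)
Lemma rising_kernel k : closed_scalar m k * rising mu k +
  k%:R / 2 * rising (mu + 1) k.-1 = rising (mu + 1) k.
Proof.
have mu0 : mu != 0 by rewrite gt_eqF// gorder_gt0.
rewrite /closed_scalar; case: k => [|k].
  by rewrite /rising !big_nil mul0r mul0r addr0 addr0; field.
by rewrite risingSl risingSr /= -natr1; field.
Qed.

Lemma clgint_dagger_kernel k M y : hpoly k M -> (forall x, Dirac M x = 0) ->
  clgint (fun x => dagger_kernel k y x * M x) =
  (rising (mu + 1) k * Num.sqrt pi ^+ m)%:C *: M y.
Proof.
move=> hM M0; have cM := hpoly_clpolyfun hM.
pose z1 x := closed_scalar m k * zonal y mu k x.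
pose z2 x := zonal y (mu + 1) (k%:Z - 1) x.
have pz1 : polyfun z1 by apply: polyfunM; [exact: polyfun_cst|exact: polyfun_zonal].
have pz2 : polyfun z2 by exact: polyfun_zonal.
have csM : clpolyfun (fun x => (dotp x y)%:C *: M x).
  by apply: clpolyfunZ => //; exact: polyfun_dotp.
have hV : hpoly (1 + k) (fun x => vec x * M x) by exact: hpolyM (hpoly_vec _) hM.
have cV := hpoly_clpolyfun hV.
have c1 : clpolyfun (fun x => (z1 x)%:C *: M x) by exact: clpolyfunZ.
have c2 : clpolyfun (fun x => (z2 x)%:C *: ((dotp x y)%:C *: M x)) by exact: clpolyfunZ.
have c3 : clpolyfun (fun x => (z2 x)%:C *: (vec x * M x)) by exact: clpolyfunZ.
have c3' : clpolyfun (fun x => vec y * ((z2 x)%:C *: (vec x * M x))).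
  by apply: clpolyfunM => //; exact: clpolyfun_cst.
have -> : (fun x => dagger_kernel k y x * M x) = fun x => (z1 x)%:C *: M x +
    ((z2 x)%:C *: ((dotp x y)%:C *: M x) + vec y * ((z2 x)%:C *: (vec x * M x))).
  apply/funext => x; rewrite /dagger_kernel -/(z1 x) -/(z2 x).
  rewrite mulrDl -(scalerAl (z1 x)%:C) -(scalerAl (z2 x)%:C) mul1r.
  by rewrite mulrDl -(scalerAl (dotp x y)%:C) mul1r scalerDr -scalerAr mulrA.
rewrite clgintD//; last exact: clpolyfunD.
rewrite clgintD// clgint_mull//.
have clgint0 : clgint (fun=> 0 : cl) = 0 by rewrite clgint_cst scaler0.
have E1 : clgint (fun x => (z1 x)%:C *: M x) =
    (closed_scalar m k * rising mu k * Num.sqrt pi ^+ m)%:C *: M y.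
  have cz : clpolyfun (fun x => (zonal y mu k x)%:C *: ((dotp x y ^+ 0)%:C *: M x)).
    by apply: clpolyfunZ; [exact: polyfun_zonal|apply: clpolyfunZ => //; exact: polyfun_cst].
  transitivity ((closed_scalar m k)%:C *:
      clgint (fun x => (zonal y mu k x)%:C *: ((dotp x y ^+ 0)%:C *: M x))).
    rewrite -(clgintZ _ cz); congr clgint; apply/funext => x.
    by rewrite scale1r scalerA -real_complexM.
  rewrite (clgint_zonal _ hM); last first.
    by move=> b bk; rewrite (clgint_dotpX _ hM)//; [rewrite (ltn_eqF bk) mul0r scale0r|exact: ltnW].
  rewrite (clgint_dotpX _ hM)// add0n eqxx mul1r !scalerA -!real_complexM.
  congr (_%:C *: _); field.
  by rewrite factr_neq0 expf_neq0.
(* k/2 is the leading factor 2^(k-1) / (k-1)! of [z2] times k! / 2^k from [clgint_dotpX]. *)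
have E2 : clgint (fun x => (z2 x)%:C *: ((dotp x y)%:C *: M x)) =
    (k%:R / 2 * rising (mu + 1) k.-1 * Num.sqrt pi ^+ m)%:C *: M y.
  rewrite /z2; case: k hM {z1 z2 pz1 pz2 hV c1 c2 c3 c3' E1} => [|n] hM.
    rewrite !mul0r scale0r -clgint0.
    by congr clgint; apply/funext => x; rewrite /zonal /= scale0r.
  rewrite (_ : n.+1%:Z - 1 = n); last by rewrite intS addrC addKr.
  rewrite (_ : (fun x => _) = fun x => (zonal y (mu + 1) n x)%:C *: ((dotp x y ^+ 1)%:C *: M x)) //.
  rewrite (clgint_zonal _ hM); last first.
    move=> b bn; rewrite (clgint_dotpX _ hM)//; last by rewrite add1n in bn; exact: ltnW.
    by rewrite add1n in bn; rewrite (ltn_eqF bn) mul0r scale0r.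
  rewrite (clgint_dotpX _ hM)// add1n eqxx mul1r !scalerA -!real_complexM.
  congr (_%:C *: _); rewrite factS natrM exprS /=; field.
  by rewrite factr_neq0 expf_neq0.
(* Here even the leading power <x,y>^(k-1) integrates to 0, by [clgint_dotpX_vec]. *)
have E3 : clgint (fun x => (z2 x)%:C *: (vec x * M x)) = 0.
  rewrite /z2; case: k hM {z1 z2 pz1 pz2 c1 c2 c3 c3' E1 E2} hV => [|n] hM hV.
    by rewrite -clgint0; congr clgint; apply/funext => x; rewrite /zonal /= scale0r.
  rewrite (_ : n.+1%:Z - 1 = n); last by rewrite intS addrC addKr.
  have vX b : (b < n.+1)%N -> clgint (fun x => (dotp x y ^+ b)%:C *: (vec x * M x)) = 0.
    by move=> bn; rewrite (clgint_dotpX_vec _ hM)//; exact: ltnW.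
  transitivity (clgint (fun x => (zonal y (mu + 1) n x)%:C *:
      ((dotp x y ^+ 0)%:C *: (vec x * M x)))).
    apply: (congr1 (@clgint R m)); apply/funext => x.
    by rewrite expr0 scale1r.
  rewrite (clgint_zonal _ hV); last by move=> b bn; apply: vX; rewrite ltnS ltnW.
  by rewrite vX// scaler0.
rewrite E1 E2 E3 mulr0 addr0 -scalerDl -[in LHS]rmorphD -mulrDl rising_kernel //.
Qed.

End DaggerKernel.

Section Final.
Context {R : realType} (m : nat).
Hypothesis hm : (3 <= m)%N.
Local Notation rv := 'rV[R]_m.
Local Notation cl := (cliff R m).
Local Notation mu := (gorder R m).

Lemma sphere_inner_kernel k d (Q : rv -> cl) y : hpoly d Q ->
  sphere_inner (fun x => monogenic_kernel k x y) Q =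
  ((sphere_area R m * (Gamma ((m + (k + d))%:R / 2) / 2))^-1)%:C *:
    clgint (fun x => dagger_kernel k y x * Q x).
Proof.
move=> hQ; have m0 : (0 < m)%N by exact: ltn_trans hm.
have G0 : Gamma ((m + (k + d))%:R / 2) / 2 != 0 :> R.
  by rewrite gt_eqF// divr_gt0// Gamma_half_gt0// addn_gt0 m0.
rewrite (clgint_hpoly_sphere m0 (hpolyM (hpoly_dagger_kernel hm k y) hQ)).
rewrite scalerA -real_complexM invfM (mulfVK G0) /sphere_inner.
congr (_ *: cliff_sphere_integral _); apply/funext => x.
by rewrite dagger_monogenic_kernel.
Qed.

(** Gamma (m/2 + k) = (m/2)_k Gamma (m/2), and Gamma (m/2) cancels against the area. The result is
    the factor in [clgint_dagger_kernel], so the normalised pairing has constant 1. *)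
Lemma sphere_area_Gamma k : sphere_area R m * (Gamma ((m + (k + k))%:R / 2) / 2) =
  rising (mu + 1) k * Num.sqrt pi ^+ m.
Proof.
have m0 : (0 < m)%N by exact: ltn_trans hm.
have -> : (m + (k + k))%:R / 2 = k%:R + (mu + 1) :> R by rewrite gorderD1 !natrD; field.
rewrite Gamma_rising; last by rewrite addr_gt0// gorder_gt0.
have := Gamma_gorderD1_neq0 (R := R) hm; rewrite /sphere_area gorderD1 => G0.
rewrite (_ : pi `^ (m%:R / 2) = Num.sqrt pi ^+ m :> R); first by field.
by rewrite mulrC powRrM powR12_sqrt ?pi_ge0// powR_mulrn// sqrtr_ge0.
Qed.

End Final.

Theorem theorem3p3 (R : realType) (m : nat) (hm : (3 <= m)%N) (k l : nat) :
  (forall x y : 'rV[R]_m,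
     monogenic_kernel k x y = monogenic_kernel_closed k x y) /\
  (forall M : 'rV[R]_m -> cliff R m, spherical_monogenic l M ->
   forall y : 'rV[R]_m,
     sphere_inner (fun x => monogenic_kernel k x y) M = (k == l)%:R *: M y /\
     sphere_inner (fun x => monogenic_kernel k x y) (fun x => vec x * M x) = 0).
Proof.
split=> [x y|M [/homogeneous_poly_hpoly hM M0] y]; first exact: monogenic_kernelE.
have hP := hpoly_dagger_kernel hm k y.
have P0 := Dirac_r_dagger_kernel hm k y.
split; last first.
  rewrite (sphere_inner_kernel hm k y (hpolyM (hpoly_vec _ ) hM)).
  rewrite (_ : (fun x => _) = fun x => dagger_kernel k y x * vec x * M x); last first.
    by apply/funext => x; rewrite mulrA.
  by rewrite clgint_vec_monogenic ?scaler0//; [exact: hpoly_clpolyfun hP|exact: hpoly_clpolyfun hM].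
rewrite (sphere_inner_kernel hm k y hM).
have [kl|kl] := eqVneq k l; last first.
  by rewrite (clgint_monogenic_degree hP hM P0 M0 kl) scaler0 scale0r.
move: hM; rewrite -kl => hM; rewrite (clgint_dagger_kernel hm y hM M0) (sphere_area_Gamma hm).
rewrite scalerA -real_complexM mulVf ?scale1r//.
rewrite mulf_neq0 ?expf_neq0 ?gt_eqF ?sqrtr_gt0 ?pi_gt0//.
by rewrite prodr_gt0// => i _; rewrite ltr_wpDr// addr_gt0// gorder_gt0.
Qed.
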